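(* There exists $n_0>0$ such that for all integers $n\ge n_0$ the following holds. Let $G$ be an oriented graph on $n$ vertices such that $\deg^+(x)+\deg^-(y)\ge (3n-3)/4$ for all distinct vertices $x,y\in V(G)$ with $xy\notin E(G)$. Then $G$ contains a (directed) Hamilton cycle.
   Context: An oriented graph is a finite digraph without loops in which there is at most one arc between any two vertices (no directed 2-cycles). $xy$ denotes the edge directed from $x$ to $y$; $\deg^+(v)$ and $\deg^-(v)$ denote the outdegree and indegree of $v$. Paths and cycles in digraphs are always directed; a Hamilton cycle is a directed cycle through all vertices. *)

(* Defs.v *)
From mathcomp Require Import all_boot all_order all_algebra.

Set Implicit Arguments.
Unset Strict Implicit.
Unset Printing Implicit Defensive.

(* A digraph on the finite vertex type V is its arc relation e : rel V, with
   [e x y] when there is an edge directed from x to y. *)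

Definition oriented_graph (V : finType) (e : rel V) : Prop :=
  irreflexive e /\ forall x y : V, x != y -> ~~ (e x y && e y x).

Definition outdeg (V : finType) (e : rel V) (x : V) : nat :=
  #|[set y | e x y]|.

Definition indeg (V : finType) (e : rel V) (y : V) : nat :=
  #|[set x | e x y]|.

(* [ucycle e [::]] holds, so the empty sequence has to be excluded. In an
   oriented graph a nonempty ucycle has at least three vertices. *)
Definition directed_cycle (V : finType) (e : rel V) (c : seq V) : Prop :=
  0 < size c /\ ucycle e c.

Definition has_hamilton_cycle (V : finType) (e : rel V) : Prop :=
  exists2 c : seq V, directed_cycle e c & forall x : V, x \in c.

(* Main.v *)
(* A Hamilton cycle is a permutation with a single orbit that follows arcs, that
   is, a perfect matching of the bipartite double cover (every vertex is split
   into a tail and a head) with a connectedness condition.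

   Absorption supplies the connectedness. A C4 count gives a small set Q of arcs
   such that almost every arc u -> v sees many x -> y in Q with x -> v and u -> y.
   A short path P through Q and through the exceptional vertices is completed to a
   1-factor with few cycles: the rest of the double cover contains a regular
   subgraph, and a matching that mostly maps each colour class of a balanced
   colouring to the next one has few cycles. Every cycle avoiding P is
   then merged into it by exchanging u -> v, x -> y for u -> y, x -> v. This needs
   linear semidegrees, connectedness and robust expansion of the double cover.

   If e(S, T) is quadratic whenever S and T are not small and |S| + |T| is almost
   at least n, these hold. Otherwise, averaging the degree condition over pairs of
   classes shows that S \ T -> ~(S u T) -> T \ S -> S n T -> S \ T is almost a
   blow-up of a 4-cycle, where S n T and ~(S u T) have almost n/4 vertices and the
   other two classes span almost tournaments. Once a few vertices have changed
   sides, the arcs from S to ~T and from ~S to T expand robustly, and the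
   imbalance t = |S| + |T| - n (up to complements) is compensated by putting into P
   a linear forest of t arcs from S to T. Its existence is the only place where the
   exact bound (3n - 3) / 4 matters. *)

Require Import Defs.
From mathcomp Require Import all_boot all_order all_algebra all_fingroup.
From mathcomp Require Import zify.
From mathcomp Require Import ring lra.

Set Implicit Arguments.
Unset Strict Implicit.
Unset Printing Implicit Defensive.

(** * Merging the cycles of a permutation *)

(** The number of cycles need not be bounded. Outside the path the 1-factor uses only arcs that can
    be absorbed in at least [#|V| / gam] ways, with [gam] constant, so it suffices that all but
    [#|V| / gam] vertices are mapped to the next colour: a cycle made of such vertices only would
    raise its colour forever. For every permutation the arcs from S to T outnumber those from ~S to
    ~T by exactly |S| + |T| - n. Noncrossing arcs alone thus give a 1-factor only if |S| + |T| = n;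
    otherwise P carries the whole difference, and its connecting arcs are noncrossing so as not to
    disturb it. The expanding case is the instance where S is empty and T is everything. Near the
    blow-up one scale of expansion is not enough to connect a set with its complement: a part may be
    too small at the fine scale, and the argument then passes to a coarser one. Hence the two pairs
    [z1], [t1] and [z2], [t2]. The linear forest is found by induction on t. Vertices with many
    crossing arcs are set aside; without them, a greedy choice of t disjoint arcs needs order t^2
    crossing arcs, which three averages of the degree condition supply. *)

Lemma hamilton_of_one_orbit (V : finType) (e : rel V) (s : {perm V}) :
  (forall u, e u (s u)) -> #|porbits s| = 1 -> has_hamilton_cycle e.
Proof.
move=> es /eqP/cards1P[O sO].
have [x Ox] : exists x, O = porbit s x.
  have : O \in porbits s by rewrite sO inE.
  by case/imsetP=> x _ ->; exists x.
have all_x y : y \in porbit s x.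
  have : porbit s y \in porbits s by apply: imset_f.
  by rewrite sO inE Ox => /eqP <-; apply: porbit_id.
exists (traject s x #|porbit s x|); last first.
  by move=> y; rewrite -porbit_traject.
have := card_porbit_neq0 s x.
have := iter_porbit s x.
have := uniq_traject_porbit s x.
case: #|porbit s x| => // n Ut it _; split; first by rewrite size_traject.
rewrite /ucycle Ut andbT trajectS /cycle /=.
have -> : rcons (traject s (s x) n) x = traject s (s x) n.+1.
  by rewrite trajectSr -iterSr it.
by apply: sub_path (fpath_traject s x n.+1) => a b /eqP <-.
Qed.

(** Exchanging the images of [u] and [x] cuts both cycles open and splices them: [x] is now followed
    by the old successors of [u], up to [u] itself, and [u] by the old successors of [x]. *)
Lemma porbit_tperm_merge (V : finType) (s : {perm V}) (u x w : V) :
  u \notin porbit s x -> w \in porbit s x \/ w \in porbit s u ->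
  w \in porbit (tperm u x * s)%g x.
Proof.
move=> ux; set s' := (tperm u x * s)%g.
have s'u : s' u = s x by rewrite permM tpermL.
have s'x : s' x = s u by rewrite permM tpermR.
have s'D y : y != u -> y != x -> s' y = s y.
  by move=> yu yx; rewrite permM tpermD // eq_sym.
have step y : y \in porbit s' x -> s' y \in porbit s' x.
  by case/porbitP=> i ->; rewrite -permM -expgSr mem_porbit.
(* Whenever the iterate returns to [u], the induction restarts from [s u = s' x], which is known to
   lie in the orbit. *)
have pu i : (s ^+ i.+1)%g u \in porbit s' x.
  elim: i => [|i IH]; first by rewrite expg1 -s'x step // porbit_id.
  rewrite expgSr permM; set a := (s ^+ i.+1)%g u in IH *.
  have au : a \in porbit s u by apply: mem_porbit.
  have ax : a != x by apply: contraNneq ux => <-; rewrite porbit_sym.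
  case: (eqVneq a u) => [->|nau]; first by rewrite -s'x step // porbit_id.
  by rewrite -s'D // step.
have uO : u \in porbit s' x.
  have := pu (#[s]%g).-1; rewrite prednK ?order_gt0 // expg_order perm1; apply.
have px i : (s ^+ i.+1)%g x \in porbit s' x.
  elim: i => [|i IH]; first by rewrite expg1 -s'u step.
  rewrite expgSr permM; set a := (s ^+ i.+1)%g x in IH *.
  have ax : a \in porbit s x by apply: mem_porbit.
  have au : a != u by apply: contraNneq ux => <-.
  case: (eqVneq a x) => [->|nax]; first by rewrite -s'u step.
  by rewrite -s'D // step.
case=> /porbitP[[|i] ->]; rewrite ?perm1 ?porbit_id //.
Qed.

(** Each exchange uses up one element of [Q], costs an outside vertex at most one hit and lowers the
    number of orbits by one, so [m] hits per vertex are enough for [m.+1] orbits. The other elements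
    of [Q] and the vertices that stay outside keep their images, hence their remaining hits. *)
Lemma merge_orbits (V : finType) (e : rel V) (m : nat) :
  forall (s : {perm V}) (Q : {set V}) (z : V),
  (forall u, e u (s u)) ->
  {subset Q <= porbit s z} ->
  (forall u, u \notin porbit s z ->
     m <= #|[set x in Q | e x (s u) && e u (s x)]|) ->
  #|porbits s| <= m.+1 ->
  has_hamilton_cycle e.
Proof.
elim: m => [|m IH] s Q z es Qz hits sm.
  apply: (hamilton_of_one_orbit es); apply/eqP; rewrite eqn_leq sm lt0n.
  by rewrite cards_eq0; apply/set0Pn; exists (porbit s z); apply: imset_f.
have [oz|] := boolP [forall u, u \in porbit s z].
  apply: (hamilton_of_one_orbit es); apply/eqP/cards1P; exists (porbit s z).
  apply/setP=> O; rewrite inE; apply/imsetP/eqP => [[u _ ->]|->]; last by exists z.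
  by apply/eqP; rewrite eq_porbit_mem (forallP oz).
rewrite negb_forall => /existsP[u uz].
have /set0Pn[x] : [set x in Q | e x (s u) && e u (s x)] != set0.
  by rewrite -card_gt0; apply: leq_trans (hits u uz).
rewrite inE => /and3P[Qx exu eux].
have xz := Qz x Qx.
have zx : porbit s z = porbit s x by apply/esym/eqP; rewrite eq_porbit_mem.
have ux : u \notin porbit s x by rewrite -zx.
have nux : u != x by apply: contraNneq ux => ->; apply: porbit_id.
pose s' := (tperm u x * s)%g.
have s'u : s' u = s x by rewrite permM tpermL.
have s'x : s' x = s u by rewrite permM tpermR.
have s'D y : y != u -> y != x -> s' y = s y.
  by move=> yu yx; rewrite permM tpermD // eq_sym.
apply: (IH s' (Q :\ x) x) => [v|v|v v_out|].
- case: (eqVneq v u) => [->|vu]; first by rewrite s'u.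
  by case: (eqVneq v x) => [->|vx]; rewrite ?s'x ?s'D.
- rewrite !inE => /andP[_ /Qz]; rewrite zx => vx.
  by apply: porbit_tperm_merge => //; left.
- have vs : v \notin porbit s x.
    by apply: contra v_out => vx; apply: porbit_tperm_merge => //; left.
  have vu : v != u.
    by apply: contraNneq v_out => ->; apply: porbit_tperm_merge => //; right; apply: porbit_id.
  have vx : v != x by apply: contraNneq vs => ->; apply: porbit_id.
  have h : m.+1 <= #|[set x0 in Q | e x0 (s v) && e v (s x0)]| by apply: hits; rewrite zx.
  rewrite (cardsD1 x) in h.
  have {}h : m <= #|[set x0 in Q | e x0 (s v) && e v (s x0)] :\ x|.
    by rewrite -ltnS; apply: leq_trans h _; case: (x \in _).
  apply: leq_trans h _.
  apply/subset_leq_card/subsetP=> y; rewrite !inE => /and4P[yx yQ eyv evy].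
  have yu : y != u by apply: contraNneq ux => <-; rewrite -zx Qz.
  by rewrite yx yQ !s'D // eyv evy.
- have := porbits_mul_tperm s u x; rewrite /= -/s' ux nux /= => E.
  by rewrite -(leq_add2r 1.*2) E addn1 addnC.
Qed.

(** * Counting arcs and short paths *)

Definition arcs (V : finType) (r : rel V) (X Y : {set V}) : nat :=
  \sum_(x in X) \sum_(y in Y) (r x y : nat).

Lemma sum_rel_row (V : finType) (p : pred V) (Y : {set V}) :
  \sum_(y in Y) (p y : nat) = #|[set y in Y | p y]|.
Proof.
rewrite -sum1dep_card big_mkcondr /=; apply: eq_bigr => y _; by case: (p y).
Qed.

Lemma arcs_rows (V : finType) (r : rel V) (X Y : {set V}) :
  arcs r X Y = \sum_(x in X) #|[set y in Y | r x y]|.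
Proof. by apply: eq_bigr => x _; rewrite sum_rel_row. Qed.

Lemma arcs_cols (V : finType) (r : rel V) (X Y : {set V}) :
  arcs r X Y = \sum_(y in Y) #|[set x in X | r x y]|.
Proof. by rewrite /arcs exchange_big; apply: eq_bigr => y _; rewrite (sum_rel_row (r^~ y)). Qed.

Lemma arcs_leq_heads (V : finType) (r : rel V) (X Y : {set V}) :
  arcs r X Y <= #|X| * #|[set y in Y | [exists x in X, r x y]]|.
Proof.
rewrite arcs_cols mulnC -sum_nat_const.
rewrite big_mkcond [leqRHS]big_mkcond /=; apply: leq_sum => y _; rewrite inE.
case: (y \in Y) => //=; case: existsP => [_|no].
  by apply/subset_leq_card/subsetP=> x; rewrite inE => /andP[].
rewrite leqn0 cards_eq0; apply/eqP/setP=> x; rewrite !inE.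
by apply/negP=> /andP[xX rxy]; case: no; exists x; rewrite xX.
Qed.

Definition ball (V : finType) (r : rel V) (u : V) (i : nat) : {set V} :=
  iter i (fun X => X :|: [set y | [exists x in X, r x y]]) [set u].

Lemma ball_path (V : finType) (r : rel V) u i v :
  v \in ball r u i -> exists p, [/\ path r u p, last u p = v & size p <= i].
Proof.
elim: i v => [|i IH] v /=; first by rewrite inE => /eqP ->; exists [::].
rewrite inE => /orP[/IH[p [up lp sp]]|]; first by exists p; split=> //; apply: leqW.
rewrite inE => /existsP[x /andP[/IH[p [up lp sp]] rxv]].
by exists (rcons p v); rewrite rcons_path up lp last_rcons size_rcons.
Qed.

(** Breadth-first search: until a target is met, the ball gains [d] vertices per step, which can
    happen at most [#|V| / d] times. The first step has its own hypothesis because growth is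
    demanded only of sets containing all out-neighbours of [u]; in the applications these are the
    large ones. *)
Lemma reach_path (V : finType) (r : rel V) (u : V) (tgt : pred V) (d : nat) :
  0 < d ->
  (~~ tgt u -> d <= #|[set y | r u y && (y != u)]|) ->
  (forall X : {set V}, u \in X -> [set y | r u y] \subset X ->
     {in X, forall x, ~~ tgt x} ->
     d <= #|[set y | (y \notin X) && [exists x in X, r x y]]|) ->
  exists p, [/\ path r u p, uniq (u :: p), tgt (last u p) & size p * d <= #|V|].
Proof.
move=> d0 H1 H2.
have uB i : u \in ball r u i by elim: i => [|i IH]; rewrite /= !inE ?IH.
have NB i : [set y | r u y] \subset ball r u i.+1.
  apply/subsetP=> y; rewrite inE => ruy; rewrite !inE; apply/orP; right.
  by apply/existsP; exists u; rewrite uB.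
pose hit i := [exists x in ball r u i, tgt x].
have nohit i : ~~ hit i -> {in ball r u i, forall x, ~~ tgt x}.
  by move=> h x xB; apply: contra h => tx; apply/existsP; exists x; rewrite xB.
have grow i : ~~ hit i -> #|ball r u i| + d <= #|ball r u i.+1|.
  move=> hi.
  have -> : ball r u i.+1 = ball r u i :|:
      [set y | (y \notin ball r u i) && [exists x in ball r u i, r x y]].
    by apply/setP=> y; rewrite /= !inE; case: (y \in _).
  rewrite cardsU (_ : _ :&: _ = set0) ?cards0 ?subn0 ?leq_add2l.
    case: i hi => [|i] hi; last by apply: H2 (uB _) (NB _) (nohit _ hi).
    apply: leq_trans (H1 (nohit _ hi u (uB 0))) _; apply/subset_leq_card/subsetP=> y.
    rewrite !inE => /andP[ruy ->] /=; apply/existsP; exists u.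
    by rewrite inE eqxx.
  by apply/setP=> y; rewrite !inE; case: (y \in _).
have small k : (exists2 i, i < k & hit i) \/ k * d <= #|ball r u k|.
  elim: k => [|k [[i ik hi]|IH]]; first by right.
    by left; exists i => //; apply: ltnW.
  have [hk|hk] := boolP (hit k); first by left; exists k.
  by right; apply: leq_trans (grow _ hk); rewrite mulSn addnC leq_add2r.
have ex : exists i, hit i.
  case: (small #|V|.+1) => [[i _ hi]|]; first by exists i.
  move=> h; have := leq_trans h (max_card _); rewrite leqNgt.
  by rewrite (leq_trans (ltnSn _)) // leq_pmulr.
case: (ex_minnP ex) => i hi imin.
have {}imin : i * d <= #|V|.
  case: (small i) => [[j ji hj]|h]; last exact: leq_trans h (max_card _).
  by have := imin _ hj; rewrite leqNgt ji.
case/existsP: hi => v /andP[/ball_path[p [up lp sp]] tv].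
rewrite -lp in tv; case/shortenP: up tv => p' up' Up' sub tv.
exists p'; split=> //; apply: leq_trans imin; rewrite leq_mul2r.
rewrite (leq_trans _ sp) ?orbT //; apply: uniq_leq_size => //.
by case/andP: Up'.
Qed.

(** A set containing the out-neighbours of [u] is large; if no member has an arc to [v], its
    complement contains the in-neighbours of [v] and is large too. Expansion then yields at least
    [#|V| / M2] new heads, and [W] spoils at most [#|V| / (2 * M2)] of them. *)
Lemma connect_avoiding (V : finType) (g : rel V) (M M1 M2 : nat) (W : {set V}) (u v : V) :
  2 * M <= M1 -> M <= M2 ->
  (forall x, #|V| <= M * #|[set y | g x y]|) ->
  (forall y, #|V| <= M * #|[set x | g x y]|) ->
  (forall X : {set V}, #|V| <= M1 * #|X| -> #|V| <= M1 * #|~: X| ->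
     #|V| ^ 2 <= M2 * arcs g X (~: X)) ->
  u \in W -> v \in W -> 2 * M2 <= #|V| -> 2 * M2 * #|W| <= #|V| ->
  exists p, [/\ path g u (rcons p v), uniq p, {in p, forall x, x \notin W}
             & size p <= 4 * M2].
Proof.
move=> MM1 MM2 dout din exp uW vW nbig Wsmall.
set n := #|V| in dout din exp nbig Wsmall *.
have n0 : 0 < n by apply/card_gt0P; exists u.
have M0 : 0 < M by move: (leq_trans n0 (dout u)); rewrite muln_gt0 => /andP[].
have M20 : 0 < M2 by apply: leq_trans M0 MM2.
pose d := n %/ (2 * M2).
have d0 : 0 < d by rewrite divn_gt0 // muln_gt0.
have dn : 2 * M2 * d <= n by rewrite mulnC leq_divM.
have nd : n <= 4 * M2 * d.
  have := ltn_ceil n (isT : 0 < 2); have := ltn_ceil n (d := 2 * M2).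
  rewrite muln_gt0 M20 -/d => /(_ isT); nia.
pose r x y := g x y && (y \notin W).
have outr x : n <= 2 * M * #|[set y | r x y]|.
  have h : #|[set y | g x y]| <= #|[set y | r x y]| + #|W|.
    rewrite -cardsUI (leq_trans _ (leq_addr _ _)) //; apply/subset_leq_card/subsetP=> y.
    by rewrite !inE /r => ->; case: (y \in W).
  have := dout x; nia.
(* The target is an in-neighbour of [v]; the vertex [v] itself lies in [W] and is appended only at
   the end. *)
have [|X uX NX noX|p [rp Up tp sp]] := @reach_path _ r u (fun x => g x v) d d0.
- move=> _; rewrite (_ : [set y | _] = [set y | r u y]); last first.
    apply/setP=> y; rewrite !inE /r; case: eqP => [->|_]; rewrite ?andbT //.
    by rewrite uW /= !andbF.
  have h2 : 0 < 2 * M2 by rewrite muln_gt0.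
  rewrite -(leq_pmul2l h2); apply: leq_trans dn (leq_trans (outr u) _).
  by rewrite leq_mul2r leq_mul2l MM2 !orbT.
- have bX : n <= M1 * #|X|.
    apply: leq_trans (outr u) _; apply: leq_mul => //; exact: subset_leq_card.
  have bCX : n <= M1 * #|~: X|.
    apply: leq_trans (din v) _; apply: leq_mul; first by apply: leq_trans MM1; rewrite leq_pmull.
    apply/subset_leq_card/subsetP=> x; rewrite !inE => gxv.
    by apply/negP=> xX; have := noX x xX; rewrite gxv.
  set H := [set y in ~: X | [exists x in X, g x y]].
  have h : n <= M2 * #|H|.
    rewrite -(leq_pmul2l n0) mulnn; apply: leq_trans (exp X bX bCX) _.
    rewrite mulnCA leq_mul2l (leq_trans (arcs_leq_heads g X (~: X))) ?orbT //.
    by rewrite leq_mul ?max_card.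
  have hH : #|H| <= #|[set y | (y \notin X) && [exists x in X, r x y]]| + #|W|.
    rewrite -cardsUI (leq_trans _ (leq_addr _ _)) //; apply/subset_leq_card/subsetP=> y.
    rewrite !inE => /andP[-> /existsP[x /andP[xX gxy]]] /=.
    case: (boolP (y \in W)) => yW; rewrite ?orbT // orbF.
    by apply/existsP; exists x; rewrite xX /r gxy yW.
  have h2 : 0 < 2 * M2 by rewrite muln_gt0.
  rewrite -(leq_pmul2l h2) -(leq_add2r n).
  apply: (@leq_trans (2 * n)); first by rewrite (mul2n n) -addnn leq_add2r.
  apply: (@leq_trans (2 * M2 * #|H|)); first by rewrite -mulnA leq_mul2l h.
  rewrite (leq_trans _ (leq_add (leqnn _) Wsmall)) // -mulnDr leq_mul2l.
  by rewrite hH orbT.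
- exists p; split.
  + rewrite rcons_path tp andbT; apply: sub_path rp => x y /andP[] //.
  + by case/andP: Up.
  + move=> x xp; move: rp; clear -xp; elim: p u xp => //= y p IH u; rewrite inE.
    by case/orP=> [/eqP -> /andP[/andP[]]|xp /andP[_ /IH ->]].
  + have : size p * d <= 4 * M2 * d by apply: leq_trans nd.
    by rewrite leq_pmul2r.
Qed.

(** * Matchings in expanding blocks *)

Definition matches (V : finType) (K : rel V) (D : {set V}) (f : V -> V) : Prop :=
  {in D &, injective f} /\ {in D, forall x, K x (f x)}.

(** The flip of an augmenting path: every vertex of [u :: p] takes over the partner of its
    successor, and the last one receives the free head [w]. Within [D] only the vertices of [p]
    change partner, which bounds the loss in [h]. *)
Lemma flip_path (V : finType) (K h : rel V) (p : seq V) :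
  forall (D : {set V}) (f : V -> V) (u w : V),
  matches K D f -> u \notin D ->
  path (fun x v => (v \in D) && K x (f v)) u p -> uniq (u :: p) ->
  K (last u p) w -> w \notin f @: D ->
  exists f', matches K (u |: D) f' /\
    #|[set x in D | h x (f x)]| <= #|[set x in u |: D | h x (f' x)]| + size p.
Proof.
elim: p => [|v p IH] D f u w [fI fK] uD.
  move=> _ _ /= Kuw wD; pose f' x := if x == u then w else f x.
  have f'D x : x \in D -> f' x = f x.
    by move=> xD; rewrite /f'; case: eqP => // xu; rewrite -xu xD in uD.
  have f'u : f' u = w by rewrite /f' eqxx.
  exists f'; split; first split.
  - move=> x y; rewrite !inE; case/orP=> [/eqP ->|xD]; case/orP=> [/eqP ->|yD] //.
    + rewrite f'u f'D // => E; by rewrite E imset_f in wD.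
    + rewrite f'u f'D // => E; by rewrite -E imset_f in wD.
    + by rewrite !f'D //; apply: fI.
  - by move=> x; rewrite !inE; case/orP=> [/eqP ->|xD]; rewrite ?f'u ?f'D ?fK.
  - rewrite addn0; apply/subset_leq_card/subsetP=> x; rewrite !inE => /andP[xD].
    by rewrite f'D // xD orbT.
move=> /= /andP[/andP[vD Kuv] vp] /andP[]; rewrite inE negb_or => /andP[uv up] /andP[vnp Up].
move=> Klw wD.
pose D1 := u |: (D :\ v); pose f1 x := if x == u then f v else f x.
have f1u : f1 u = f v by rewrite /f1 eqxx.
have f1D x : x \in D -> f1 x = f x.
  by move=> xD; rewrite /f1; case: eqP => // xu; rewrite -xu xD in uD.
have D1E : v |: D1 = u |: D.
  apply/setP=> x; rewrite !inE; case: (eqVneq x v) => [->|] //=; by rewrite vD orbT.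
have sub1 : f1 @: D1 \subset f @: D.
  apply/subsetP=> _ /imsetP[x + ->]; rewrite !inE => /orP[/eqP ->|/andP[_ xD]].
    by rewrite f1u imset_f.
  by rewrite f1D // imset_f.
have [||||||f' [mf' cf']] := IH D1 f1 v w.
- split.
    move=> x y; rewrite !inE; case/orP=> [/eqP ->|/andP[xv xD]];
      case/orP=> [/eqP ->|/andP[yv yD]] //.
    + by rewrite f1u f1D // => /fI E; rewrite -E ?eqxx // in yv.
    + by rewrite f1u f1D // => /fI E; rewrite E ?eqxx // in xv.
    + by rewrite !f1D //; apply: fI.
  move=> x; rewrite !inE => /orP[/eqP ->|/andP[_ xD]]; first by rewrite f1u.
  by rewrite f1D // fK.
- by rewrite !inE eqxx /= orbF eq_sym.
- pose P z := (z != u) && (z != v).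
  have: all P p.
    apply/allP=> z zp; apply/andP; split; first by apply: contraNneq up => <-.
    by apply: contraNneq vnp => <-.
  elim: (p) (v) vp => //= z q IHq a /andP[/andP[zD Kaz] zq] /andP[/andP[zu zv] az].
  by rewrite IHq // andbT f1D // Kaz !inE zv zD orbT.
- by rewrite /= vnp.
- by [].
- by apply: contra wD; apply/subsetP.
exists f'; rewrite -D1E; split=> //.
apply: (@leq_trans (#|[set x in D1 | h x (f1 x)]| + 1)); last first.
  by rewrite addn1 addnS ltnS.
rewrite -(cards1 v) -cardsUI (leq_trans _ (leq_addr _ _)) //.
apply/subset_leq_card/subsetP=> x; rewrite !inE => /andP[xD hx].
by case: (eqVneq x v) => [|xv]; rewrite ?orbT //= f1D // xD hx !orbT.
Qed.

(* Two vertex classes Lb and Rb of the bipartite double cover, joined by K. *)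
Definition expanding_block (V : finType) (K : rel V) (Lb Rb : {set V}) (d1 d2 : nat) : Prop :=
  [/\ #|Lb| = #|Rb|,
      forall x y, K x y -> (x \in Lb) = (y \in Rb),
      {in Lb, forall x, d1 <= #|[set y in Rb | K x y]|},
      {in Rb, forall y, d1 <= #|[set x in Lb | K x y]|} &
      forall X : {set V}, X \subset Lb -> d1 <= #|X| -> #|X| + d1 <= #|Lb| ->
        #|X| + d2 <= #|[set y in Rb | [exists x in X, K x y]]|].

(** Breadth-first search along alternating paths, gaining [d2] vertices per level. A reached set of
    medium size grows by expansion. If it misses fewer than [d1] tails of the block, every head of
    the block has a neighbour in it and is therefore matched, which is impossible since [u] is
    unmatched and both classes have equal size. *)
Lemma augment_block (V : finType) (K h : rel V) (Lb Rb : {set V}) (d1 d2 : nat)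
    (D : {set V}) (f : V -> V) (u : V) :
  expanding_block K Lb Rb d1 d2 -> 0 < d2 <= d1 ->
  matches K D f -> u \in Lb -> u \notin D ->
  exists f' s, [/\ matches K (u |: D) f', s * d2 <= #|V| &
    #|[set x in D | h x (f x)]| <= #|[set x in u |: D | h x (f' x)]| + s].
Proof.
move=> [LR Kb dL dR exp] /andP[d20 d21] mf uL uD; have [fI fK] := mf.
pose r x v := (v \in D) && K x (f v).
pose tgt x := [exists w, (w \notin f @: D) && K x w].
have notgt x w : ~~ tgt x -> K x w -> exists2 y, r x y & w = f y.
  move=> nt Kxw; have : w \in f @: D.
    by apply: contraR nt => wD; apply/existsP; exists w; rewrite wD.
  by case/imsetP=> y yD E; exists y; rewrite // /r yD -E.
have [|X uX NX noX|p [rp Up]] := @reach_path _ r u tgt d2 d20.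
- move=> nt; apply: leq_trans d21 _; apply: leq_trans (dL u uL) _.
  apply: leq_trans (leq_imset_card f _); apply/subset_leq_card/subsetP=> w.
  rewrite inE => /andP[_ Kuw]; have [y ry ->] := notgt _ _ nt Kuw.
  rewrite imset_f // inE ry; apply: contraNneq uD => <-.
  by case/andP: ry.
- set Nw := [set y | _]; pose X' := X :&: Lb.
  have d1X : d1 <= #|X'|.
    apply: leq_trans (dL u uL) _; apply: leq_trans (leq_imset_card f _).
    apply/subset_leq_card/subsetP=> w; rewrite inE => /andP[wR Kuw].
    have [y ry E] := notgt _ _ (noX u uX) Kuw; rewrite E imset_f // inE.
    have yX : y \in X by apply: (subsetP NX); rewrite inE.
    by rewrite yX; case/andP: ry => yD _; rewrite (Kb _ _ (fK y yD)) -E.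
  have sub x w : x \in X' -> K x w -> w \in f @: ((X' :&: D) :|: Nw).
    rewrite inE => /andP[xX xL] Kxw; have [y ry ->] := notgt _ _ (noX x xX) Kxw.
    rewrite imset_f // !inE; case/andP: (ry) => yD Kxy.
    have yL : y \in Lb by rewrite (Kb _ _ (fK y yD)) -(Kb _ _ Kxy).
    rewrite yD yL !andbT; case: (boolP (y \in X)) => //= yX.
    by apply/existsP; exists x; rewrite xX ry.
  case: (leqP (#|X'| + d1) #|Lb|) => [small|big].
    have := exp X' (subsetIr _ _) d1X small => h1.
    have h2 : #|[set y in Rb | [exists x in X', K x y]]| <= #|X' :&: D| + #|Nw|.
      rewrite (leq_trans _ (leq_trans (leq_imset_card f _) (leq_card_setU _ _))) //.
      apply/subset_leq_card/subsetP=> w; rewrite inE => /andP[_ /existsP[x /andP[xX Kxw]]].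
      exact: sub Kxw.
    have h3 : #|X' :&: D| < #|X'|.
      apply: proper_card; apply/properP; split; first exact: subsetIl.
      by exists u; rewrite !inE ?uX ?uL // (negbTE uD) andbF.
    lia.
  suff : #|Rb| <= #|D :&: Lb|.
    rewrite -LR leqNgt proper_card //; apply/properP; split; first exact: subsetIr.
    by exists u => //; rewrite inE (negbTE uD).
  rewrite (leq_trans _ (leq_imset_card f _)) //; apply/subset_leq_card/subsetP=> w wR.
  have [x xX Kxw] : exists2 x, x \in X' & K x w.
    apply/exists_inP; apply/existsP; case: (boolP [exists x, (x \in X') && K x w]) => [/existsP//|].
    rewrite negb_exists => /forallP no; exfalso.
    have := dR w wR; rewrite leqNgt => /negP; apply.
    suff : #|[set x in Lb | K x w]| + #|X'| <= #|Lb| by lia.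
    rewrite -cardsUI (_ : _ :&: X' = set0) ?cards0 ?addn0.
      by apply/subset_leq_card; rewrite subUset subsetIr andbT; apply/subsetP=> x; rewrite inE => /andP[].
    apply/setP=> x; rewrite !inE; apply/negP=> /and3P[/andP[_ Kxw] xX xL].
    by have := no x; rewrite Kxw !inE xX xL.
  have := xX; rewrite inE => /andP[xX0 _].
  have [y /andP[yD Kxy] E] := notgt _ _ (noX x xX0) Kxw.
  by rewrite E imset_f // inE yD (Kb _ _ (fK y yD)) -E wR.
case/existsP=> w /andP[wD Klw] sp.
have [f' [mf' cf']] := flip_path h mf uD rp Up Klw wD.
by exists f', (size p).
Qed.

Lemma matching_extend (V : finType) (K h : rel V) (L0 : {set V}) (l : nat) :
  (forall D f u, matches K D f -> D \subset L0 -> u \in L0 -> u \notin D ->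
     exists f', matches K (u |: D) f' /\
       #|[set x in D | h x (f x)]| <= #|[set x in u |: D | h x (f' x)]| + l) ->
  forall D f, matches K D f -> D \subset L0 ->
  exists f', matches K L0 f' /\
    #|[set x in D | h x (f x)]| <= #|[set x in L0 | h x (f' x)]| + l * (#|L0| - #|D|).
Proof.
move=> aug D f; have [k] := ubnP (#|L0| - #|D|); elim: k D f => // k IH D f lk mf DL.
have [E|] := eqVneq D L0; first by exists f; rewrite -E subnn muln0 addn0.
rewrite eqEsubset DL /= => /subsetPn[u uL uD].
have [f1 [mf1 c1]] := aug D f u mf DL uL uD.
have DL1 : u |: D \subset L0 by rewrite subUset sub1set uL.
have lt1 : #|D| < #|L0|.
  by apply: proper_card; apply/properP; split=> //; exists u.
have cD : #|u |: D| = #|D|.+1 by rewrite cardsU1 uD.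
have [|f' [mf' c']] := IH _ _ _ mf1 DL1; first by rewrite cD; lia.
exists f'; split=> //; apply: leq_trans c1 _; apply: leq_trans (leq_add c' (leqnn _)) _.
rewrite -addnA leq_add2l cD -mulnSr leq_mul2l; apply/orP; right; lia.
Qed.

(** * Hall's theorem, its deficiency form, and regular subgraphs *)

Definition nbh (A B : finType) (r : A -> B -> bool) (S : {set A}) : {set B} :=
  [set b | [exists a in S, r a b]].

Lemma nbhP (A B : finType) (r : A -> B -> bool) (S : {set A}) b :
  reflect (exists2 a, a \in S & r a b) (b \in nbh r S).
Proof. by rewrite inE; apply: exists_inP. Qed.

(** Either a proper nonempty subset is tight, and it is matched separately from the rest, or every
    such subset has a spare neighbour, and an arbitrary edge may be matched first. The element [b0]
    is the value of the matching on an empty set. *)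
Lemma hall_matching (A B : finType) (b0 : B) (r : A -> B -> bool) (m : nat) :
  forall (S0 : {set A}) (T0 : {set B}), #|S0| <= m ->
  (forall S : {set A}, S \subset S0 -> #|S| <= #|nbh r S :&: T0|) ->
  exists f : A -> B, {in S0 &, injective f} /\ {in S0, forall a, r a (f a) && (f a \in T0)}.
Proof.
elim: m => [|m IH] S0 T0 Sm hall.
  have S00 : S0 = set0 by apply/eqP; rewrite -cards_eq0 -leqn0.
  by exists (fun=> b0); rewrite S00; split=> [a a'|a]; rewrite !inE.
have [|] := boolP [exists S : {set A},
  [&& S \subset S0, S != set0, S != S0 & #|nbh r S :&: T0| <= #|S|]].
  case/existsP=> S /and4P[SS0 Sn0 SnS0 tight].
  have pS : #|S| < #|S0| by apply: proper_card; rewrite properEneq SnS0.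
  have [||f1 [f1I f1r]] := IH S (nbh r S :&: T0).
  - by rewrite -ltnS; apply: leq_trans pS Sm.
  - move=> S' S'S; apply: leq_trans (hall S' (subset_trans S'S SS0)) _.
    apply/subset_leq_card/subsetP=> b; rewrite !inE => /andP[h ->]; rewrite h andbT.
    by case/exists_inP: h => a aS' rab; apply/exists_inP; exists a => //; apply: (subsetP S'S).
  have [||f2 [f2I f2r]] := IH (S0 :\: S) (T0 :\: nbh r S).
  - rewrite cardsD (setIidPr SS0).
    have : 0 < #|S| by rewrite card_gt0.
    lia.
  - move=> S' /subsetDP[S'S0 dS].
    have := hall (S' :|: S); rewrite subUset S'S0 SS0 => /(_ isT).
    rewrite cardsU (_ : S' :&: S = set0) ?cards0 ?subn0; last by apply/eqP; rewrite setI_eq0.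
    move=> h; suff : #|nbh r (S' :|: S) :&: T0| <=
       #|nbh r S' :&: (T0 :\: nbh r S)| + #|nbh r S :&: T0| by lia.
    rewrite (leq_trans _ (leq_card_setU _ _)) //; apply/subset_leq_card/subsetP=> b.
    rewrite inE => /andP[/nbhP[a]]; rewrite inE => aS rab bT.
    rewrite in_setU !in_setI in_setD bT !andbT.
    case: (boolP (b \in nbh r S)) => bS; rewrite ?orbT // orbF andbT.
    apply/nbhP; case/orP: aS => aS; first by exists a.
    by case/negP: bS; apply/nbhP; exists a.
  exists (fun a => if a \in S then f1 a else f2 a); split.
    have dis a a' : a \in S -> a' \in S0 -> a' \notin S -> f1 a <> f2 a'.
      move=> aS a'S0 a'S E; have := f1r a aS; have := f2r a'.
      by rewrite !in_setD a'S a'S0 => /(_ isT)/and3P[_ /negP h _]; rewrite E in_setI => /and3P[].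
    move=> a a' aS0 a'S0; case: (boolP (a \in S)) => aS; case: (boolP (a' \in S)) => a'S.
    - exact: f1I.
    - by move=> E; case: (dis a a').
    - by move=> /esym E; case: (dis a' a).
    - by apply: f2I; rewrite inE ?aS ?a'S.
  move=> a aS0; case: (boolP (a \in S)) => aS.
    by have := f1r a aS; rewrite in_setI => /and3P[-> _ ->].
  by have := f2r a; rewrite !in_setD aS aS0 => /(_ isT)/and3P[-> _ ->].
rewrite negb_exists => /forallP noS.
have [->|/set0Pn[a aS0]] := eqVneq S0 set0.
  by exists (fun=> b0); split=> [a a'|a]; rewrite !inE.
have [b] : exists b, b \in nbh r [set a] :&: T0.
  by apply/set0Pn; rewrite -card_gt0 (leq_trans _ (hall _ _)) ?cards1 ?sub1set.
rewrite inE => /andP[/nbhP[a1]]; rewrite inE => /eqP -> rab bT {a1}.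
have [||f [fI fr]] := IH (S0 :\ a) (T0 :\ b).
- by have := cardsD1 a S0; rewrite aS0; lia.
- move=> S'; rewrite subsetD1 => /andP[S'S0 aS'].
  have [->|S'0] := eqVneq S' set0; first by rewrite cards0.
  have := noS S'; rewrite S'S0 S'0 /= negb_and negbK -ltnNge => /orP[/eqP E|].
    by rewrite E aS0 in aS'.
  rewrite (cardsD1 b) => h.
  have : #|(nbh r S' :&: T0) :\ b| <= #|nbh r S' :&: (T0 :\ b)|.
    by apply/subset_leq_card/subsetP=> z; rewrite !inE => /and3P[-> -> ->].
  by move: h; case: (b \in _) => /=; lia.
exists (fun z => if z == a then b else f z); split.
  have nb z : z \in S0 -> z != a -> f z != b.
    by move=> zS za; have := fr z; rewrite !inE za zS => /(_ isT)/and3P[].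
  move=> z z' zS z'S; case: (eqVneq z a) => [->|za]; case: (eqVneq z' a) => [->|z'a] //.
  - by move=> E; have := nb _ z'S z'a; rewrite -E eqxx.
  - by move=> E; have := nb _ zS za; rewrite E eqxx.
  - by apply: fI; rewrite !inE ?za ?z'a.
move=> z zS; case: (eqVneq z a) => [->|za]; first by rewrite rab bT.
by have := fr z; rewrite !inE za zS => /(_ isT)/and3P[-> _ ->].
Qed.

(** Adding [d] dummy heads adjacent to everything restores Hall's condition. At most [d] tails are
    matched to dummies, and [D] consists of the others. *)
Lemma hall_deficiency (V : finType) (J : rel V) (S0 : {set V}) (d : nat) :
  (forall S : {set V}, S \subset S0 -> #|S| <= #|nbh J S| + d) ->
  exists (D : {set V}) (f : V -> V), [/\ D \subset S0, matches J D f & #|S0| <= #|D| + d].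
Proof.
move=> hall.
have [->|/set0Pn[v0 _]] := eqVneq S0 set0.
  by exists set0, id; split; rewrite ?cards0 ?sub0set //; split=> x; rewrite inE.
pose r (x : V) (b : V + 'I_d) := if b is inl y then J x y else true.
have [S SS0|f [fI fr]] := @hall_matching _ _ (inl v0) r #|S0| S0 setT (leqnn _).
  have [->|/set0Pn[x xS]] := eqVneq S set0; first by rewrite cards0.
  apply: leq_trans (hall S SS0) _; rewrite setIT.
  have inlI : injective (@inl V 'I_d) by move=> a b [].
  have inrI : injective (@inr V 'I_d) by move=> a b [].
  rewrite -(card_imset _ inlI) -[X in _ + X]card_ord -cardsT -(card_imset _ inrI).
  rewrite -cardsUI (_ : _ :&: _ = set0) ?cards0 ?addn0; last first.
    apply/setP=> b; rewrite !inE; apply/negP=> /andP[/imsetP[y _ ->] /imsetP[]] //.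
  apply/subset_leq_card/subsetP=> b; rewrite inE => /orP[] /imsetP[y].
    by case/nbhP=> a aS Jay ->; apply/nbhP; exists a.
  by move=> _ ->; apply/nbhP; exists x.
pose D := [set x in S0 | if f x is inl _ then true else false].
exists D, (fun x => if f x is inl y then y else x); split.
- by apply/subsetP=> x; rewrite inE => /andP[].
- split=> [x x'|x].
    rewrite !inE => /andP[xS fx] /andP[x'S fx'].
    case E: (f x) fx => [y|] // _; case E': (f x') fx' => [y'|] // _ yy.
    by apply: fI => //; rewrite E E' yy.
  rewrite inE => /andP[xS]; have := fr x xS; case: (f x) => // y /andP[] //.
- rewrite -(cardsID D S0) (setIidPr _); last by apply/subsetP=> x; rewrite inE => /andP[].
  rewrite leq_add2l -[d]card_ord -cardsT.
  pose g x : option 'I_d := if f x is inr i then Some i else None.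
  have gI : {in S0 :\: D &, injective g}.
    move=> x x'; rewrite !inE; case: (boolP (x \in S0)) => //= xS.
    case: (boolP (x' \in S0)) => //= x'S.
    rewrite /g; case E: (f x) => [|i] //; case E': (f x') => [|i'] // _ _ [ii].
    by apply: fI => //; rewrite E E' ii.
  rewrite -(card_in_imset gI) -(card_imset [set: 'I_d] (@Some_inj _)).
  apply/subset_leq_card/subsetP=> _ /imsetP[x xSD ->]; move: xSD; rewrite !inE /g.
  case: (boolP (x \in S0)) => //= _.
  by case: (f x) => // i _; apply: imset_f.
Qed.

(** Perfect matchings are peeled off one at a time. After [j < r] of them every vertex has lost at
    most [r] partners, so by hypothesis the remainder still has a perfect matching. *)
Lemma regular_subrelation (V : finType) (K : rel V) (L0 R0 : {set V}) (r : nat) :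
  #|L0| = #|R0| -> (forall x y, K x y -> (x \in L0) && (y \in R0)) ->
  (forall K' : rel V, (forall x y, K' x y -> K x y) ->
     (forall x, #|[set y | K x y && ~~ K' x y]| <= r) ->
     (forall y, #|[set x | K x y && ~~ K' x y]| <= r) ->
     exists f, matches K' L0 f) ->
  exists R : rel V, [/\ forall x y, R x y -> K x y,
    {in L0, forall x, #|[set y | R x y]| = r} & {in R0, forall y, #|[set x | R x y]| = r}].
Proof.
move=> LR KLR pm.
suff H j : j <= r -> exists R : rel V, [/\ forall x y, R x y -> K x y,
    {in L0, forall x, #|[set y | R x y]| = j} & {in R0, forall y, #|[set x | R x y]| = j}].
  exact: H.
elim: j => [|j IH] jr.
  exists (fun _ _ => false); split=> // x _; apply/eqP; rewrite cards_eq0; apply/eqP/setP=> y;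
    by rewrite !inE.
have [R [RK Rl Rr]] := IH (ltnW jr).
have [|x|y|f [fI fK]] := pm (fun x y => K x y && ~~ R x y).
- by move=> x y /andP[].
- rewrite (_ : [set y | _] = [set y | R x y]).
    have [xL|xL] := boolP (x \in L0); first by rewrite Rl // ltnW.
    rewrite (_ : [set y | _] = set0) ?cards0 //; apply/setP=> y; rewrite !inE.
    by apply/negP=> /RK/KLR; rewrite (negbTE xL).
  apply/setP=> y; rewrite !inE negb_and negbK.
  by case: (boolP (R x y)) => [/RK ->|_] //=; rewrite orbF; case: (K x y).
- rewrite (_ : [set x | _] = [set x | R x y]).
    have [yR|yR] := boolP (y \in R0); first by rewrite Rr // ltnW.
    rewrite (_ : [set x | _] = set0) ?cards0 //; apply/setP=> x; rewrite !inE.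
    by apply/negP=> /RK/KLR; rewrite (negbTE yR) andbF.
  apply/setP=> x; rewrite !inE negb_and negbK.
  by case: (boolP (R x y)) => [/RK ->|_] //=; rewrite orbF; case: (K x y).
exists (fun x y => R x y || (x \in L0) && (f x == y)); split=> [x y|x xL|y yR].
- by case/orP=> [/RK|/andP[xL /eqP <-]] //; case/andP: (fK x xL).
- rewrite (_ : [set y | _] = f x |: [set y | R x y]).
    by rewrite cardsU1 inE; case/andP: (fK x xL) => _ ->; rewrite Rl.
  by apply/setP=> y; rewrite !inE xL orbC eq_sym.
- have [x xL E] : exists2 x, x \in L0 & y = f x.
    apply/imsetP; have : f @: L0 \subset R0.
      by apply/subsetP=> _ /imsetP[x xL ->]; case/andP: (fK x xL) => /KLR /andP[].
    by move/subset_leqif_cards; rewrite (card_in_imset fI) LR => -[_ /esym]; rewrite eqxx => /eqP ->.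
  rewrite (_ : [set x | _] = x |: [set x | R x y]).
    by rewrite cardsU1 inE E; case/andP: (fK x xL) => _ ->; rewrite -E Rr.
  apply/setP=> z; rewrite !inE orbC; congr (_ || _).
  apply/andP/eqP=> [[zL /eqP]|->]; last by rewrite xL E.
  by rewrite E => /fI ->.
Qed.

(** * One-factors with few cycles *)

Import Order.TTheory GRing.Theory Num.Theory.

(** Independence of the colours of two vertices: the sum over all colourings factorises over the
    vertices, and the centred factor at [u] makes it vanish. *)
Lemma sum_coloring_eq0 (V : finType) (k : nat) (g h : 'I_k -> int) (u w : V) :
  u != w -> (\sum_j g j = 0)%R -> (\sum_(c : {ffun V -> 'I_k}) g (c u) * h (c w) = 0)%R.
Proof.
move=> uw g0.
pose F v j := (if v == u then g j else if v == w then h j else 1)%R.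
transitivity (\sum_(c : {ffun V -> 'I_k}) \prod_v F v (c v))%R.
  apply: eq_bigr => c _; rewrite (bigD1 u) //= (bigD1 w) 1?eq_sym //= big1 ?mulr1.
    by rewrite /F eqxx (eq_sym w u) (negbTE uw) eqxx.
  by move=> v /andP[vu vw]; rewrite /F (negbTE vu) (negbTE vw).
rewrite -(bigA_distr_bigA F) (bigD1 u) //= (_ : \sum_j F u j = 0)%R ?mul0r //.
by rewrite -[RHS]g0; apply: eq_bigr => j _; rewrite /F eqxx.
Qed.

Lemma sum_coloring1 (V : finType) (k : nat) (g : 'I_k -> int) (u : V) :
  (k%:R * \sum_(c : {ffun V -> 'I_k}) g (c u) = (k ^ #|V|)%:R * \sum_j g j)%R.
Proof.
pose F v j := (if v == u then g j else 1)%R.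
have -> : (\sum_(c : {ffun V -> 'I_k}) g (c u) = \sum_(c : {ffun V -> 'I_k}) \prod_v F v (c v))%R.
  apply: eq_bigr => c _; rewrite (bigD1 u) //= big1 ?mulr1 /F ?eqxx //.
  by move=> v /negbTE ->.
rewrite -(bigA_distr_bigA F) (bigD1 u) //= (_ : \sum_j F u j = \sum_j g j)%R; last first.
  by apply: eq_bigr => j _; rewrite /F eqxx.
have -> : (\prod_(v | v != u) \sum_j F v j = \prod_(v | v != u) k%:R :> int)%R.
  apply: eq_bigr => v /negbTE vu; rewrite (eq_bigr (fun _ => 1%R)); last by move=> j _; rewrite /F vu.
  by rewrite sumr_const card_ord.
rewrite prodr_const (_ : #|_| = #|V|.-1); last exact: cardC1.
rewrite mulrCA mulrC -exprS -natrX prednK //; apply/card_gt0P; exists u => //.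
Qed.

(** The variance of a binomial count, cleared of denominators. The centred indicators [X] of
    different vertices are uncorrelated, so only diagonal terms survive. *)
Lemma coloring_variance (V : finType) (k : nat) (N : {set V}) (i : 'I_k) :
  (\sum_(c : {ffun V -> 'I_k})
      ((k * #|[set u in N | c u == i]|)%:Z - #|N|%:Z) ^+ 2
   = ((k ^ #|V|) * (k.-1 * #|N|))%:Z)%R.
Proof.
have k0 : 0 < k by case: (k) i => // -[].
pose X j : int := (k%:R * (j == i)%:R - 1)%R.
have X0 : (\sum_j X j = 0)%R.
  rewrite sumrB -mulr_sumr (bigD1 i) //= eqxx big1 ?addr0 ?mulr1; last by move=> j /negbTE ->.
  by rewrite sumr_const card_ord subrr.
have X2 : (\sum_j X j ^+ 2 = (k * k.-1)%:R)%R.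
  rewrite (bigD1 i) //= /X eqxx mulr1 (eq_bigr (fun _ => 1%R)); last first.
    by move=> j /negbTE ->; rewrite mulr0 sub0r sqrrN expr1n.
  rewrite sumr_const (_ : #|_| = k.-1); last by rewrite -[k in RHS]card_ord -(cardC1 i).
  by case: (k) k0 => // m _ /=; lia.
have dev c : ((k * #|[set u in N | c u == i]|)%:Z - #|N|%:Z = \sum_(u in N) X (c u))%R.
  rewrite sumrB sumr_const -mulr_sumr; congr (_ - _)%R; last by rewrite natz.
  rewrite PoszM natz; congr (_ * _)%R.
  by rewrite -(sum_rel_row (fun u => c u == i)) -natz natr_sum.
rewrite (eq_bigr (fun c : {ffun V -> 'I_k} => \sum_(u in N) \sum_(w in N) X (c u) * X (c w))%R); last first.
  by move=> c _; rewrite dev expr2 mulr_suml; apply: eq_bigr => u _; rewrite mulr_sumr.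
rewrite exchange_big /= (eq_bigr (fun _ => ((k ^ #|V|) * k.-1)%:R)%R); last first.
  move=> u uN; rewrite exchange_big (bigD1 u) //= [X in (_ + X)%R]big1 ?addr0; last first.
    by move=> w /andP[_ wu]; apply: sum_coloring_eq0; rewrite // eq_sym.
  apply: (@mulfI _ (k%:R)%R); first by rewrite pnatr_eq0 -lt0n.
  rewrite (sum_coloring1 (fun j => X j * X j)%R).
  under eq_bigr do rewrite -expr2.
  by rewrite X2 !natrM mulrCA.
by rewrite sumr_const -mulrnA natz mulnA.
Qed.

Lemma balanced_coloring (V J : finType) (k : nat) (N : J -> {set V}) : 0 < k ->
  exists c : {ffun V -> 'I_k},
   (\sum_j \sum_i ((k * #|[set u in N j | c u == i]|)%:Z - #|N j|%:Z) ^+ 2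
     <= (k ^ 2 * \sum_j #|N j|)%:Z)%R.
Proof.
move=> k0; pose f := fun c : {ffun V -> 'I_k} =>
  (\sum_j \sum_i ((k * #|[set u in N j | c u == i]|)%:Z - #|N j|%:Z) ^+ 2)%R.
have tot : (\sum_c f c = (k ^ #|V| * (k * k.-1 * \sum_j #|N j|))%:Z)%R.
  rewrite exchange_big /=.
  under eq_bigr do rewrite exchange_big /=.
  under eq_bigr do under eq_bigr do rewrite coloring_variance.
  under eq_bigr do rewrite sumr_const card_ord.
  under eq_bigr do rewrite -natz.
  rewrite sumrMnl -natr_sum -mulrnA natz -big_distrr -big_distrr /=.
  by rewrite -!mulnA; congr (Posz (_ * _)); rewrite mulnA mulnC.
apply/existsP; apply: contraT; rewrite negb_exists => /forallP big.
have : (\sum_(c : {ffun V -> 'I_k}) (k ^ 2 * \sum_j #|N j|)%:Z < \sum_c f c)%R.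
  have c0 : {ffun V -> 'I_k} by exact: [ffun=> Ordinal k0].
  apply: ltr_sum; first by apply/hasP; exists c0; rewrite ?mem_index_enum.
  by move=> c _; rewrite ltNge; apply: big.
rewrite tot sumr_const card_ffun card_ord -mulr_natr natz -PoszM ltz_nat mulnC.
rewrite ltn_mul2l => /andP[_]; rewrite ltnNge; case/negP.
rewrite leq_mul2r; apply/orP; right; rewrite expnS expn1 leq_mul2l leq_pred orbT //.
Qed.

(** Chebyshev's inequality: a vertex is bad if some colour deviates from its expected share [r / k]
    among the neighbours by a relative error above [1 / T]. Tails and heads are handled together, as
    elements of [V + V]. If [r] is linear in [#|V|], the number of bad vertices is bounded. *)
Lemma near_regular_coloring (V : finType) (R : rel V) (L0 R0 : {set V}) (r k T : nat) :
  0 < k -> {in L0, forall x, #|[set y | R x y]| = r} ->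
  {in R0, forall y, #|[set x | R x y]| = r} ->
  exists (c : V -> 'I_k) (BL BR : {set V}), [/\
    (#|BL| + #|BR|) * r <= 2 * #|V| * k ^ 2 * T ^ 2,
    {in L0, forall x, x \notin BL -> forall i, let m := #|[set y | R x y && (c y == i)]| in
      T * r <= T * (k * m) + r /\ T * (k * m) <= T * r + r} &
    {in R0, forall y, y \notin BR -> forall i, let m := #|[set x | R x y && (c x == i)]| in
      T * r <= T * (k * m) + r /\ T * (k * m) <= T * r + r}].
Proof.
move=> k0 dL dR.
pose N (j : V + V) := match j with
  | inl x => if x \in L0 then [set y | R x y] else set0
  | inr y => if y \in R0 then [set x | R x y] else set0 end.
have Nr j : #|N j| <= r.
  case: j => x /=; case: ifP => [xL|_]; rewrite ?cards0 ?dL ?dR //.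
have [c hc] := balanced_coloring N k0.
pose dev j i := ((k * #|[set u in N j | c u == i]|)%:Z - #|N j|%:Z)%R.
pose Bad := [set j | [exists i, (r%:Z ^+ 2 < (T%:Z * dev j i) ^+ 2)%R]].
have sumN : \sum_j #|N j| <= 2 * #|V| * r.
  apply: (@leq_trans (\sum_(j : V + V) r)); first by apply: leq_sum => j _.
  by rewrite sum_nat_const card_sum addnn -mul2n.
have cB : #|Bad| * r <= 2 * #|V| * k ^ 2 * T ^ 2.
  have [->|r0] := posnP r; first by rewrite muln0.
  rewrite -(leq_pmul2r r0) -mulnA -lez_nat PoszM.
  apply: (@le_trans _ _ (T%:Z ^+ 2 * (k ^ 2 * \sum_j #|N j|)%:Z)%R); last first.
    rewrite expr2 -!PoszM lez_nat mulnn mulnA mulnC.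
    by apply: leq_trans (leq_mul sumN (leqnn _)) _; apply/eq_leq; nia.
  apply: (@le_trans _ _ (\sum_(j in Bad) (r%:Z ^+ 2))%R).
    by rewrite sumr_const -mulr_natl natz expr2 PoszM.
  apply: le_trans (ler_wpM2l _ hc); last exact: sqr_ge0.
  rewrite mulr_sumr big_mkcond /=; apply: ler_sum => j _.
  case: ifP => [|_]; last by rewrite mulr_ge0 ?sqr_ge0 // sumr_ge0 // => i _; apply: sqr_ge0.
  rewrite inE => /existsP[i /ltW /le_trans]; apply.
  rewrite exprMn ler_wpM2l ?sqr_ge0 // (bigD1 i) //= lerDl.
  by rewrite sumr_ge0 // => i' _; apply: sqr_ge0.
have good j i : j \notin Bad -> #|N j| = r ->
    let m := #|[set u in N j | c u == i]| in
    T * r <= T * (k * m) + r /\ T * (k * m) <= T * r + r.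
  rewrite inE negb_exists => /forallP/(_ i); rewrite -leNgt /dev => h Nj /=.
  move: h; rewrite Nj; set m := #|_|; set q := k * m => h.
  have : ((T%:Z * (q%:Z - r%:Z)) ^+ 2 <= r%:Z ^+ 2)%R by [].
  rewrite !expr2 mulrBr -!PoszM; set a := T * q; set b := T * r => h2; split; nia.
exists (fun v => c v), [set x | inl x \in Bad], [set y | inr y \in Bad]; split.
- apply: leq_trans cB; rewrite leq_mul2r; apply/orP; right.
  have inlI : injective (@inl V V) by move=> a b [].
  have inrI : injective (@inr V V) by move=> a b [].
  rewrite -(card_imset _ inlI) -(card_imset _ inrI) -cardsUI.
  rewrite (_ : _ :&: _ = set0) ?cards0 ?addn0; last first.
    apply/setP=> b; rewrite !inE; apply/negP=> /andP[/imsetP[y _ ->] /imsetP[]] //.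
  by apply/subset_leq_card/subsetP=> b; rewrite inE => /orP[] /imsetP[y]; rewrite inE => ? ->.
- move=> x xL; rewrite inE => xB i.
  have := good (inl x) i xB; rewrite /= xL dL // => /(_ erefl).
  by rewrite (_ : [set u in _ | _] = [set y | R x y && (c y == i)]) //; apply/setP=> u; rewrite !inE.
- move=> x xL; rewrite inE => xB i.
  have := good (inr x) i xB; rewrite /= xL dR // => /(_ erefl).
  by rewrite (_ : [set u in _ | _] = [set y | R y x && (c y == i)]) //; apply/setP=> u; rewrite !inE.
Qed.

(** After the colouring, consecutive colour classes are joined almost regularly, with degrees about
    [r / k], so Hall's theorem with a small deficiency matches nearly all tails to the next colour.
    The top class and the boundedly many bad tails are given up. *)
Lemma increasing_matching (W c : nat) : 0 < W ->
  exists n1, forall (V : finType) (R : rel V) (L0 R0 : {set V}) (r : nat),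
  n1 <= #|V| -> #|V| <= c * r -> 0 < r ->
  (forall x y, R x y -> (x \in L0) && (y \in R0)) ->
  {in L0, forall x, #|[set y | R x y]| = r} ->
  {in R0, forall y, #|[set x | R x y]| = r} ->
  exists (col : V -> nat) (D : {set V}) (f : V -> V), [/\ D \subset L0,
    matches (fun x y => R x y && (col y == (col x).+1)) D f &
    W * (#|L0| - #|D|) <= #|V|].
Proof.
move=> W0; pose k := 8 * W; pose T := 8 * W; pose B := 2 * k ^ 2 * T ^ 2 * c.
exists (2 * W * ((k + 2) * B + 1)) => V R L0 R0 r nbig rbig r0 RLR dL dR.
have k0 : 0 < k by rewrite muln_gt0.
have [col [BL [BR [cB gL gR]]]] := near_regular_coloring T k0 dL dR.
have bB : #|BL| + #|BR| <= B.
  rewrite -(leq_pmul2r r0); apply: leq_trans cB _.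
  rewrite (_ : B * r = 2 * (k ^ 2 * T ^ 2) * (c * r)); last by rewrite /B; ring.
  rewrite (_ : 2 * _ * _ * _ = 2 * (k ^ 2 * T ^ 2) * #|V|); last by ring.
  by rewrite leq_mul2l rbig orbT.
pose J x y := R x y && (val (col y) == (val (col x)).+1).
pose top := [set x in L0 | (val (col x)).+1 == k].
pose Ls := [set x in L0 | (x \notin BL) && ((val (col x)).+1 != k)].
pose d := (#|V| %/ (4 * W)).+1 + k * #|BR|.
have Td : 2 * #|V| + T * k * #|BR| <= T * d.
  rewrite /d /T mulnDr mulnA leq_add2r.
  have : #|V| < (#|V| %/ (4 * W)).+1 * (4 * W) by rewrite ltn_ceil // muln_gt0.
  set q := (_ %/ _).+1 => h; nia.
have indeg (S : {set V}) y i : y \in R0 -> y \notin BR ->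
   T * k * #|[set x in S | R x y && (col x == i)]| <= (T + 1) * r.
  move=> yR yB; have [_] := gR y yR yB i; rewrite mulnA mulnDl mul1n; apply: leq_trans.
  rewrite leq_mul2l; apply/orP; right; apply/subset_leq_card/subsetP=> x.
  by rewrite !inE => /andP[].
have indeg2 (S : {set V}) y (p : pred V) : #|[set x in S | R x y && p x]| <= r.
  have [yR|yR] := boolP (y \in R0).
    by rewrite -(dR y yR) subset_leq_card //; apply/subsetP=> x; rewrite !inE => /and3P[].
  rewrite (_ : [set x in S | _] = set0) ?cards0 //; apply/setP=> x; rewrite !inE.
  by apply/negP=> /and3P[_ /RLR]; rewrite (negbTE yR) andbF.
have sumB (Y : {set V}) (F : V -> nat) : (forall y, F y <= r) ->
    (forall y, y \notin BR -> T * k * F y <= (T + 1) * r) ->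
    T * k * (\sum_(y in Y) F y) <= (#|Y| * (T + 1) + T * k * #|BR|) * r.
  move=> F1 F2; rewrite mulnDl big_distrr /=.
  apply: (@leq_trans (\sum_(y in Y) ((T + 1) * r + (y \in BR) * (T * k * r)))).
    apply: leq_sum => y _; case: (boolP (y \in BR)) => yB.
      by rewrite mul1n (leq_trans _ (leq_addl _ _)) // leq_mul2l F1 orbT.
    by rewrite addn0 F2.
  rewrite big_split /=; apply: leq_add; first by rewrite sum_nat_const mulnA.
  rewrite -big_distrl /= [leqRHS](_ : _ = #|BR| * (T * k * r)); last by ring.
  rewrite leq_mul2r (sum_rel_row (fun i => i \in BR)); apply/orP; right.
  by apply/subset_leq_card/subsetP=> y; rewrite inE => /andP[].
(* In units of [r / (T * k)], a tail of [S] sends at least [T - 1] and a good head receives at most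
   [T + 1]. So the deficiency is at most [(#|S| + #|nbh J S|) / T], apart from the bad heads. *)
have hall (S : {set V}) : S \subset Ls -> #|S| <= #|nbh J S| + d.
  move=> SL.
  have lo : #|S| * (T.-1 * r) <= T * k * arcs J S (nbh J S).
    rewrite arcs_rows big_distrr /= -sum_nat_const; apply: leq_sum => x xS.
    have := subsetP SL x xS; rewrite inE => /and3P[xL xB xt].
    have ix : (val (col x)).+1 < k by rewrite ltn_neqAle xt ltn_ord.
    have [h _] := gL x xL xB (Ordinal ix).
    have -> : [set y in nbh J S | J x y] = [set y | R x y && (col y == Ordinal ix)].
      apply/setP=> y; rewrite in_set [RHS]in_set /J -val_eqE /= andb_idl // => Jxy.
      by apply/nbhP; exists x.
    move: h; rewrite -mulnA; set m := k * _.
    rewrite -[X in X * r](@prednK T) ?muln_gt0 // mulSn addnC leq_add2r //.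
  have hi : T * k * arcs J S (nbh J S) <= (#|nbh J S| * (T + 1) + T * k * #|BR|) * r.
    rewrite arcs_cols; apply: sumB => y; first exact: indeg2.
    move=> yB; case: (posnP (col y)) => [y0|y0].
      rewrite (_ : [set x in S | _] = set0) ?cards0 ?muln0 //; apply/setP=> x; rewrite !inE.
      by rewrite /J /= y0 /= !andbF.
    have yk : (col y).-1 < k by rewrite (leq_ltn_trans (leq_pred _)).
    have [yR|yR] := boolP (y \in R0); last first.
      rewrite (_ : [set x in S | _] = set0) ?cards0 ?muln0 //; apply/setP=> x; rewrite !inE.
      by apply/negP=> /and3P[_ /RLR]; rewrite (negbTE yR) andbF.
    apply: leq_trans (indeg S y (Ordinal yk) yR yB); rewrite leq_mul2l; apply/orP; right.
    apply/subset_leq_card/subsetP=> x; rewrite !inE -val_eqE /= => /and3P[-> -> /eqP ->] /=.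
    by rewrite eqxx.
  have := leq_trans lo hi; rewrite mulnA leq_pmul2r // => h.
  have T0 : 0 < T by rewrite muln_gt0.
  have nV : #|nbh J S| <= #|V| := max_card _; have sV : #|S| <= #|V| := max_card _.
  rewrite -(leq_pmul2l T0) mulnDr; apply: leq_trans (leq_add (leqnn _) Td).
  rewrite mulnDr muln1 in h.
  suff : T * #|S| = #|S| * T.-1 + #|S| by clearbody T k d; nia.
  by rewrite -mulnSr prednK // mulnC.
have [D [f [DL mf cD]]] := hall_deficiency hall.
exists (fun v => val (col v)), D, f; split.
- by apply: subset_trans DL _; apply/subsetP=> x; rewrite inE => /andP[].
- by [].
have cL : #|L0| <= #|Ls| + #|BL| + #|top|.
  rewrite (leq_trans _ (leq_add (leq_card_setU _ _) (leqnn _))) //.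
  rewrite (leq_trans _ (leq_card_setU _ _)) //; apply/subset_leq_card/subsetP=> x xL.
  by rewrite !inE xL /=; case: (x \in BL); case: (_ == k).
have ctop : T * k * #|top| <= #|V| * (T + 1) + T * k * #|BR|.
  have ik : k.-1 < k by rewrite prednK.
  rewrite -(leq_pmul2r r0); apply: (@leq_trans (T * k * arcs R top R0)).
    rewrite -mulnA leq_mul2l arcs_rows -sum_nat_const; apply/orP; right.
    apply: leq_sum => x; rewrite inE => /andP[xL _]; rewrite -(dL x xL).
    apply/subset_leq_card/subsetP=> y; rewrite !inE => Rxy; rewrite Rxy andbT.
    by case/andP: (RLR _ _ Rxy).
  rewrite arcs_cols (leq_trans (sumB R0 _ _ _)) //.
  - move=> y; apply: leq_trans (indeg2 top y predT); apply/subset_leq_card/subsetP=> x.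
    by rewrite !inE andbT.
  - move=> y yB; have [yR|yR] := boolP (y \in R0); last first.
      rewrite (_ : [set x in top | _] = set0) ?cards0 ?muln0 //; apply/setP=> x; rewrite !inE.
      by apply/negP=> /andP[_ /RLR]; rewrite (negbTE yR) andbF.
    apply: leq_trans (indeg top y (Ordinal ik) yR yB); rewrite leq_mul2l; apply/orP; right.
    apply/subset_leq_card/subsetP=> x; rewrite !inE -val_eqE /= => /andP[/andP[xL E] Rxy].
    by rewrite xL E Rxy /=; apply/eqP; move/eqP: E => /=; clear; lia.
  - by rewrite leq_mul2r leq_add2r leq_mul2r max_card !orbT.
have hq : #|V| %/ (4 * W) * (4 * W) <= #|V| by apply: leq_divM.
rewrite /d in cD; set q := #|V| %/ (4 * W) in hq cD.
have {}ctop : 4 * W * #|top| <= #|V| + 4 * W * #|BR|.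
  have T0 : 0 < T by rewrite muln_gt0.
  rewrite -(leq_pmul2l T0).
  have : #|V| * (T + 1) <= 2 * (T * #|V|) by nia.
  move: ctop; rewrite /k; nia.
have h2 : #|L0| - #|D| <= q.+1 + k * #|BR| + #|BL| + #|top|.
  move: cL cD; move: (k * #|BR|) => z; move: #|L0| #|D| #|Ls| #|BL| #|top| (q); clear => *; lia.
have h1 : k * #|BR| + #|BL| + #|BR| + 1 <= (k + 2) * B + 1.
  move: bB; move: #|BL| #|BR| (B) (k); clear => *; nia.
move: nbig hq ctop h1 h2; move: ((k + 2) * B + 1) (k * #|BR|) => E z; move: #|L0| #|D| #|BL| #|BR| #|top|.
move: (#|V|) (q) (W); clear => v q w l dd bl br tp nbig hq ctop h1 h2.
have {}h2 : 4 * w * (l - dd) <= 4 * w * (q.+1 + z + bl + tp) by rewrite leq_mul2l h2 orbT.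
have {}h1 : 4 * w * (z + bl + br + 1) <= 4 * w * E by rewrite leq_mul2l h1 orbT.
nia.
Qed.

(** * Absorbing paths *)

Lemma sqr_sum_leq (I : finType) (a : I -> nat) :
  (\sum_i a i) ^ 2 <= #|I| * \sum_i a i ^ 2.
Proof.
rewrite -(leq_pmul2l (isT : 0 < 2)) -mulnn big_distrlr /= big_distrr /=.
apply: (@leq_trans (\sum_i \sum_j (a i ^ 2 + a j ^ 2))).
  apply: leq_sum => i _; rewrite big_distrr /=; apply: leq_sum => j _.
  by rewrite nat_Cauchy.
rewrite (eq_bigr (fun i => #|I| * a i ^ 2 + \sum_j a j ^ 2)); last first.
  by move=> i _; rewrite big_split /= sum_nat_const.
by rewrite big_split /= sum_nat_const -big_distrr /= addnn mul2n.
Qed.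

(** The Cauchy-Schwarz inequality, applied twice through the codegrees [cod], gives at least
    [#|V| ^ 4 / c ^ 4] alternating closed walks of length four, and some arc has the average share
    of them. The pairs [p] are the arcs that can exchange heads with [(x, y)] inside [N]. *)
Lemma exists_arc_in_many_C4 (V : finType) (N : rel V) (c : nat) :
  0 < #|V| -> #|V| ^ 2 <= c * arcs N setT setT ->
  exists x y, N x y /\
    #|V| ^ 2 <= c ^ 4 * #|[set p : V * V | [&& N p.1 p.2, N x p.2 & N p.1 y]]|.
Proof.
move=> n0 dense; set n := #|V| in n0 dense *.
have E0 : arcs N setT setT = \sum_y \sum_x (N x y : nat).
  by rewrite /arcs exchange_big; apply: eq_big => y *; rewrite ?inE //; apply: eq_bigl => x; rewrite inE.
pose cod x u := \sum_y (N x y * N u y).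
have E1 : (arcs N setT setT) ^ 2 <= n * \sum_(p : V * V) cod p.1 p.2.
  rewrite E0; apply: leq_trans (sqr_sum_leq _) _; rewrite leq_mul2l; apply/orP; right.
  rewrite -(pair_big predT predT cod) /= /cod; apply: eq_leq.
  rewrite [RHS](eq_bigr (fun x => \sum_y \sum_u N x y * N u y)); last by move=> x _; rewrite exchange_big.
  rewrite [RHS]exchange_big /=; apply: eq_bigr => y _.
  by rewrite -mulnn big_distrlr.
pose F x y := #|[set p : V * V | [&& N p.1 p.2, N x p.2 & N p.1 y]]|.
have E2 : \sum_(p : V * V) cod p.1 p.2 ^ 2 <= \sum_x \sum_(y | N x y) F x y.
  rewrite -(pair_big predT predT (fun x u => cod x u ^ 2)) /=; apply: leq_sum => x _.
  rewrite (eq_bigr (fun u => \sum_v \sum_y (N x v * N u v) * (N x y * N u y))); last first.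
    by move=> u _; rewrite -mulnn /cod big_distrlr.
  rewrite [leqRHS]big_mkcond /=.
  under eq_bigr do rewrite exchange_big.
  rewrite exchange_big /=; apply: leq_sum => y _; case: ifP => Nxy; last first.
    by rewrite big1 // => u _; rewrite big1 // => v _; rewrite muln0.
  rewrite /F -sum1dep_card pair_big /= [leqRHS]big_mkcond /=; apply: leq_sum => -[u v] _ /=.
  by case: (N u v); case: (N x v); case: (N u y).
have E3 : (\sum_(p : V * V) cod p.1 p.2) ^ 2 <= n ^ 2 * \sum_x \sum_(y | N x y) F x y.
  apply: leq_trans (sqr_sum_leq _) _; rewrite card_prod -/n mulnn leq_mul2l.
  by rewrite E2 orbT.
have [[x /existsP[y /andP[Nxy h]]]|no] := 
  altP (@existsP _ (fun x => [exists y, N x y && (n ^ 2 <= c ^ 4 * F x y)])).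
  by exists x, y.
have : c ^ 4 * (\sum_x \sum_(y | N x y) F x y) < n ^ 4.
  rewrite big_distrr /= (_ : n ^ 4 = \sum_(x : V) n ^ 3); last first.
    by rewrite sum_nat_const -/n -expnS.
  have [v0 _] : exists v0 : V, v0 \in V by apply/card_gt0P.
  apply: (@leq_ltn_trans (\sum_(x : V) (n ^ 3).-1)); last first.
    by rewrite !sum_nat_const -/n ltn_mul2l n0 /= prednK ?expn_gt0 ?n0.
  apply: leq_sum => x _; rewrite big_distrr /=.
  move: no; rewrite negb_exists => /forallP/(_ x); rewrite negb_exists => /forallP no.
  apply: (@leq_trans (\sum_(y : V) (n ^ 2).-1)).
    rewrite big_mkcond /=; apply: leq_sum => y _; case: ifP => // Nxy.
    have := no y; rewrite Nxy /= -ltnNge => h.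
    by rewrite -ltnS prednK ?expn_gt0 ?n0.
  rewrite sum_nat_const -/n (_ : n ^ 3 = n * n ^ 2); last by rewrite -expnS.
  have : 0 < n ^ 2 by rewrite expn_gt0 n0.
  move: n0; clear; nia.
move: dense E1 E3; move: (arcs _ _ _) (\sum_(p : _) _) (\sum_x _) => a b s.
rewrite ltnNge => dense E1 E3 /negP[].
have h1 : n ^ 4 <= c ^ 2 * a ^ 2 by rewrite -expnMn (expnM n 2 2) leq_exp2r.
have h2 : n ^ 3 <= c ^ 2 * b.
  rewrite -(leq_pmul2l n0) -expnS; apply: leq_trans h1 _.
  by rewrite mulnCA leq_mul2l E1 orbT.
have h3 : n ^ 6 <= c ^ 4 * b ^ 2 by rewrite (expnM c 2 2) -expnMn (expnM n 3 2) leq_exp2r.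
rewrite -(@leq_pmul2l (n ^ 2)) ?expn_gt0 ?n0 // -expnD; apply: leq_trans h3 _.
by rewrite mulnCA leq_mul2l E3 orbT.
Qed.

Definition arc_vertices (V : Type) (Q : seq (V * V)) : seq V :=
  flatten [seq [:: a.1; a.2] | a <- Q].

(* The arcs (x, y) of Q that can absorb the arc (u, v): exchanging the heads gives
   the arcs (x, v) and (u, y). *)
Definition hits (V : Type) (g : rel V) (Q : seq (V * V)) (u v : V) : nat :=
  count (fun a => g a.1 v && g u a.2) Q.

(* Greedy choice: as long as many arcs have few hits, they span an arc lying in
   many 4-cycles of such arcs, and adding it to Q raises many hit counts. *)
Lemma absorbing_arcs (c eta : nat) : 0 < c ->
  exists gam n1, 0 < gam /\ forall (V : finType) (g : rel V) (W : {set V}),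
  n1 <= #|V| -> irreflexive g -> 8 * c * #|W| <= #|V| ->
  exists Q : seq (V * V), [/\ all (fun a => g a.1 a.2) Q,
    uniq (arc_vertices Q), {in arc_vertices Q, forall x, x \notin W},
    eta * size Q <= #|V| &
    c * #|[set p : V * V | g p.1 p.2 && (gam * hits g Q p.1 p.2 < #|V|)]| < #|V| ^ 2].
Proof.
move=> c0; pose c' := (2 * c) ^ 4; pose eta' := eta + 16 * c; pose gam := 4 * c' * eta'.
have c'0 : 0 < c' by rewrite expn_gt0 muln_gt0 c0.
have e0 : 0 < eta' by rewrite addn_gt0 muln_gt0 c0 orbT.
have gam0 : 0 < gam by rewrite /gam muln_gt0 e0 andbT muln_gt0 /=.
exists gam, (4 * eta' * (c' + 1)); split=> // V g W nbig irr Wsmall; set n := #|V| in nbig Wsmall *.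
have n0 : 0 < n by apply: leq_trans nbig; rewrite !muln_gt0 e0 addn1.
pose h := (n %/ gam).+1.
have bad_h Q u v : gam * hits g Q u v < n -> hits g Q u v < h.
  by move=> hh; rewrite ltnS leq_divRL // mulnC ltnW.
pose valid Q := [/\ all (fun a => g a.1 a.2) Q,
    uniq (arc_vertices Q) & {in arc_vertices Q, forall x, x \notin W}].
pose bad Q := [set p : V * V | g p.1 p.2 && (gam * hits g Q p.1 p.2 < n)].
(* Hit counts are truncated at [h], so the potential never exceeds [n ^ 2 * h], while each added arc
   raises it by at least [n ^ 2 / c']. Hence fewer than [n / eta'] arcs are needed;
   [gam = 4 * c' * eta'] is chosen to make [c' * h] smaller than that. *)
pose Phi Q := \sum_(p : V * V) minn (hits g Q p.1 p.2) h.
have step Q : valid Q -> eta' * size Q <= n -> n ^ 2 <= c * #|bad Q| ->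
    exists a, valid (a :: Q) /\ n ^ 2 + c' * Phi Q <= c' * Phi (a :: Q).
  move=> [Qg QU QW] Qs Qb; pose Z := W :|: [set x in arc_vertices Q].
  have sZ : 4 * c * #|Z| <= n.
    have : #|Z| <= #|W| + 2 * size Q.
      apply: leq_trans (leq_card_setU _ _) _; rewrite leq_add2l cardsE.
      apply: leq_trans (card_size _) _; rewrite /arc_vertices; clear; elim: Q => //= a Q IH; move: IH; lia.
    move: Wsmall Qs; rewrite /eta'; move: (size Q) #|Z| #|W| => s z w; clear -c0; nia.
  (* Arcs meeting [Z] are dropped so that the new arc is disjoint from [W] and from [Q]. There are
     at most [2 * #|Z| * n <= n ^ 2 / (2 * c)] of them, half of the bad arcs available. *)
  pose N x y := [&& g x y, gam * hits g Q x y < n, x \notin Z & y \notin Z].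
  have dN : n ^ 2 <= 2 * c * arcs N setT setT.
    have H : #|bad Q| <= arcs N setT setT + 2 * #|Z| * n.
      apply: (@leq_trans (arcs N setT setT + (\sum_(x in Z) n + \sum_(y in Z) n))); last first.
        by rewrite !sum_nat_const leq_add2l mul2n -addnn mulnDl.
      rewrite -sum1dep_card.
      rewrite (eq_bigl (fun p : V * V => predT p.1 && (g p.1 p.2 && (gam * hits g Q p.1 p.2 < n)))) //.
      rewrite -(pair_big_dep predT (fun x y => g x y && (gam * hits g Q x y < n)) (fun _ _ => 1)) /=.
      have -> : arcs N setT setT = \sum_x \sum_y N x y.
        by apply: eq_big => x *; rewrite ?inE //; apply: eq_bigl => y; rewrite inE.
      have A1 : \sum_(x in Z) n = \sum_x \sum_(y : V) (x \in Z : nat).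
        rewrite big_mkcond; apply: eq_bigr => x _; rewrite sum_nat_const -/n.
        by case: (x \in Z); rewrite ?muln1 ?muln0.
      have A2 : \sum_(y in Z) n = \sum_(x : V) \sum_y (y \in Z : nat).
        rewrite exchange_big big_mkcond; apply: eq_bigr => x _; rewrite sum_nat_const -/n.
        by case: (x \in Z); rewrite ?muln1 ?muln0.
      rewrite {1}A1 A2 -!big_split /=; apply: leq_sum => x _; rewrite -!big_split /= big_mkcond /=.
      apply: leq_sum => y _; rewrite /N; case: (g x y && _) / andP => [[-> ->]|_] //=.
      by case: (x \in Z); case: (y \in Z).
    have ar (a b z m : nat) : m ^ 2 <= c * b -> 4 * c * z <= m -> b <= a + 2 * z * m ->
        m ^ 2 <= 2 * c * a by clear; nia.
    exact: ar Qb sZ H.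
  have [x [y [Nxy C4]]] := exists_arc_in_many_C4 n0 dN.
  exists (x, y); split.
    case/and4P: Nxy => gxy _; rewrite !inE !negb_or => /andP[xW xQ] /andP[yW yQ].
    split; first by rewrite /= gxy.
      rewrite /= inE negb_or xQ yQ QU !andbT; apply: contraTneq gxy => ->; by rewrite irr.
    by move=> z; rewrite !inE => /or3P[/eqP ->|/eqP ->|/QW].
  apply: leq_trans (leq_add C4 (leqnn _)) _; rewrite -/c' -mulnDr leq_mul2l; apply/orP; right.
  rewrite -sum1dep_card big_mkcond -big_split /=; apply: leq_sum => -[u v] _ /=.
  case: ifP => [/and3P[/and4P[guv hb _ _] /andP[gxv _] /andP[guy _]]|_].
    by rewrite gxv guy /=; have := bad_h _ _ _ hb; rewrite /hits; clear; lia.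
  by rewrite add0n leq_min geq_minr andbT geq_min leq_addl.
have main k : eta' * k <= n -> exists2 Q, valid Q &
    size Q <= k /\ (c * #|bad Q| < n ^ 2 \/ n ^ 2 * k <= c' * Phi Q).
  elim: k => [|k IH] kn; first by exists [::] => //; split=> //; right; rewrite muln0.
  have [|Q vQ [sQ [bQ|pQ]]] := IH; first by apply: leq_trans kn; rewrite leq_mul2l leqnSn orbT.
    by exists Q => //; split; [apply: leqW | left].
  have [bQ|bQ] := ltnP (c * #|bad Q|) (n ^ 2).
    by exists Q => //; split; [apply: leqW | left].
  have [|a [va Pa]] := step Q vQ _ bQ.
    by apply: leq_trans kn; rewrite leq_mul2l (leq_trans sQ) ?orbT.
  exists (a :: Q) => //; split; first by rewrite /= ltnS.
  by right; apply: leq_trans Pa; rewrite mulnS leq_add2l.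
have hk : eta' * (n %/ eta') <= n by rewrite mulnC leq_divM.
have [Q [Qg QU QW] [sQ fin]] := main _ hk.
exists Q; split=> //.
  apply: leq_trans hk; apply: leq_mul => //; exact: leq_addr.
case: fin => // big; exfalso; move: big; apply/negP; rewrite -ltnNge.
have PhiB : Phi Q <= n ^ 2 * h.
  rewrite /Phi; apply: (@leq_trans (\sum_(p : V * V) h)).
    by apply: leq_sum => p _; rewrite geq_minr.
  by rewrite sum_nat_const card_prod mulnn.
apply: (@leq_ltn_trans (n ^ 2 * (c' * h))); first by rewrite mulnCA leq_mul2l PhiB orbT.
rewrite ltn_mul2l expn_gt0 n0 /=.
have d1 : n < (n %/ eta').+1 * eta' by rewrite ltn_ceil.
have d2 : n %/ gam * gam <= n by rewrite leq_divM.
have ar (m C e a b : nat) : m < a.+1 * e -> b * (4 * C * e) <= m -> 4 * e * (C + 1) <= m ->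
    C * b.+1 < a.
  clear; move=> d1 d2 d3; have : 4 * (C * b * e) <= m by apply: leq_trans d2; apply: eq_leq; ring.
  have : 4 * (C * e) + 4 * e <= m by apply: leq_trans d3; apply: eq_leq; ring.
  rewrite mulnS => h1 h2; have : (C + C * b) * e < a * e by move: d1; rewrite mulSn mulnDl; lia.
  by rewrite ltn_mul2r => /andP[].
exact: ar d1 d2 nbig.
Qed.

(* A path is given by its first vertex and the list of the following ones. *)
Definition path_vertices (V : Type) (q : V * seq V) : seq V := q.1 :: q.2.

Definition path_arcs (V : Type) (q : V * seq V) : seq (V * V) := pairmap pair q.1 q.2.

(* The number of arcs from S to T minus the number of arcs from ~: S to ~: T. *)
Definition excess (V : finType) (S T : {set V}) (s : seq (V * V)) : int :=
  (\sum_(a <- s) ((a.1 \in S)%:Z + (a.2 \in T)%:Z - 1))%R.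

Lemma excess_cat (V : finType) (S T : {set V}) s1 s2 :
  excess S T (s1 ++ s2) = (excess S T s1 + excess S T s2)%R.
Proof. exact: big_cat. Qed.

Lemma path_arcs_all (V : finType) (e : rel V) x p :
  path e x p = all (fun a => e a.1 a.2) (path_arcs (x, p)).
Proof. by elim: p x => //= y p IH x; rewrite IH. Qed.

Lemma path_arcs_cat (V : finType) (x y : V) p1 p2 :
  path_arcs (x, p1 ++ y :: p2) = path_arcs (x, rcons p1 y) ++ path_arcs (y, p2).
Proof. by rewrite -cat_rcons /path_arcs pairmap_cat last_rcons. Qed.

Lemma excess_noncross (V : finType) (g : rel V) (S T : {set V}) x p :
  (forall x y, g x y -> (x \in S) = (y \notin T)) -> path g x p ->
  excess S T (path_arcs (x, p)) = 0%R.
Proof.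
move=> gST; rewrite path_arcs_all /excess => /allP gp; rewrite big_seq big1 // => a /gp /gST ->.
by case: (a.2 \in T).
Qed.

(** The connectors consist of arcs of [g], each contributing zero to the excess. The term
    [l * size qs] reserves room within [B] for all connectors still to come. *)
Lemma join_paths (V : finType) (e g : rel V) (S T : {set V}) (l B : nat) :
  (forall (W : {set V}) u v, #|W| <= B -> u \in W -> v \in W ->
     exists p, [/\ path g u (rcons p v), uniq p, {in p, forall x, x \notin W} & size p <= l]) ->
  (forall x y, g x y -> e x y) -> (forall x y, g x y -> (x \in S) = (y \notin T)) ->
  forall (qs : seq (V * seq V)) x p,
  path e x p -> all (fun q => path e q.1 q.2) qs ->
  uniq (x :: p ++ flatten (map (@path_vertices V) qs)) ->
  size (x :: p ++ flatten (map (@path_vertices V) qs)) + l * size qs <= B ->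
  exists p', [/\ path e x p', uniq (x :: p'),
    size (x :: p') <= B,
    {subset path_arcs (x, p) ++ flatten (map (@path_arcs V) qs) <= path_arcs (x, p')} &
    {subset x :: p ++ flatten (map (@path_vertices V) qs) <= x :: p'} /\
    excess S T (path_arcs (x, p')) =
      excess S T (path_arcs (x, p) ++ flatten (map (@path_arcs V) qs))].
Proof.
move=> conn ge gST; elim=> [|[y q] qs IH] x p ep /=.
  by rewrite !cats0 muln0 addn0 => _ U s; exists p; split=> //; split.
move=> /andP[eq aqs] U sB; set F := flatten _ in U sB *.
pose W := [set z in x :: p ++ y :: q ++ F].
have WB : #|W| <= B.
  rewrite cardsE; apply: leq_trans (card_size _) _; apply: leq_trans sB.
  by rewrite leq_addr.
have [||c [gc Uc cW cl]] := conn W (last x p) y WB.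
- by rewrite inE -cat_cons mem_cat mem_last.
- by rewrite inE -cat_cons mem_cat (mem_head y) orbT.
have cW' : {in c, forall z, z \notin x :: p ++ y :: q ++ F}.
  by move=> z /cW; rewrite inE.
have [||||p' [ep' Up' sp' ap' [vp' xp']]] := IH x (p ++ c ++ y :: q).
- rewrite cat_path ep -cat_rcons cat_path last_rcons eq andbT.
  by apply: sub_path gc.
- by [].
- have: perm_eq (x :: (p ++ c ++ y :: q) ++ F) (c ++ (x :: p ++ y :: q ++ F)).
    have -> : x :: (p ++ c ++ y :: q) ++ F = (x :: p) ++ c ++ (y :: q ++ F) by rewrite /= -!catA.
    by rewrite perm_catCA.
  move/perm_uniq => ->; rewrite cat_uniq; apply/and3P; split=> //; apply/hasPn=> z zin.
  by apply: contraTN zin => /cW'.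
- apply: leq_trans sB; do !rewrite size_cat /=; rewrite -/F mulnS; move: cl; clear; lia.
have aE : path_arcs (x, p ++ c ++ y :: q) =
    path_arcs (x, p) ++ path_arcs (last x p, rcons c y) ++ path_arcs (y, q).
  by rewrite /path_arcs -cat_rcons !pairmap_cat last_rcons.
exists p'; split=> //.
- move=> a; rewrite catA mem_cat mem_cat => H; apply: ap'; rewrite aE !mem_cat.
  by case/orP: H => [/orP[]|] ->; rewrite ?orbT.
- split.
    move=> z H; apply: vp'; move: H; rewrite !inE !mem_cat !inE !mem_cat.
    by case/or3P=> [->|->|/or3P[]->]; rewrite ?orbT.
  by rewrite xp' aE !excess_cat (excess_noncross gST gc) add0r addrA.
Qed.

(* In the bipartite double cover, these arcs join the tails in S to the heads
   outside T, and the tails outside S to the heads in T. *)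
Definition noncross (V : finType) (e : rel V) (S T : {set V}) : rel V :=
  fun x y => e x y && ((x \in S) == (y \notin T)).

(** Arcs with too few absorbing partners in [Q]; the 1-factor has to avoid them on cycles that do
    not contain the path. *)
Definition sparse_arc (V : finType) (g : rel V) (gam : nat) (Q : seq (V * V)) : rel V :=
  fun u v => g u v && (gam * hits g Q u v < #|V|).

Lemma size_path_vertices (V : Type) (qs : seq (V * seq V)) :
  size qs <= size (flatten (map (@path_vertices V) qs)).
Proof. by elim: qs => //= q qs IH; rewrite size_cat /= ltnS (leq_trans IH) // leq_addl. Qed.

Lemma card_rel (V : finType) (r : rel V) :
  #|[set p : V * V | r p.1 p.2]| = \sum_x #|[set y | r x y]|.
Proof.
rewrite -sum1dep_card -(pair_big_dep predT (fun x y => r x y) (fun _ _ => 1)) /=.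
by apply: eq_bigr => x _; rewrite sum1dep_card.
Qed.

Lemma few_heavy_vertices (V : finType) (r : rel V) (c k : nat) : 0 < #|V| ->
  c * k * #|[set p : V * V | r p.1 p.2]| < #|V| ^ 2 ->
  k * #|[set v | #|V| < c * #|[set y | r v y]|]| <= #|V|.
Proof.
move=> n0 cB; set U := [set v | _].
have h : #|U| * #|V| <= c * #|[set p : V * V | r p.1 p.2]|.
  rewrite card_rel big_distrr -sum_nat_const /= big_mkcond /=.
  by apply: leq_sum => v _; rewrite inE; case: ltnP => // /ltnW.
rewrite -(leq_pmul2r n0) mulnn ltnW // (leq_ltn_trans _ cB) //.
by rewrite -mulnA (leq_trans (leq_mul (leqnn k) h)) // mulnA (mulnC k).
Qed.

(** Besides [ps] and the arcs of [Q], the path swallows every vertex with many sparse arcs, as a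
    one-vertex piece. At any vertex off the path, dropping the sparse arcs then costs at most
    [#|V| / c] out-arcs and as many in-arcs. *)
Lemma absorbing_path (M M1 M2 b c : nat) : 0 < M -> 2 * M <= M1 -> M <= M2 ->
  2 * M2 <= b -> 0 < c ->
  exists gam M3 n0, 0 < gam /\
  forall (V : finType) (e : rel V) (S T : {set V}) (ps : seq (V * seq V)),
  let g := noncross e S T in
  n0 <= #|V| -> irreflexive e ->
  (forall x, #|V| <= M * #|[set y | g x y]|) ->
  (forall y, #|V| <= M * #|[set x | g x y]|) ->
  (forall X : {set V}, #|V| <= M1 * #|X| -> #|V| <= M1 * #|~: X| ->
     #|V| ^ 2 <= M2 * arcs g X (~: X)) ->
  all (fun q => path e q.1 q.2) ps ->
  uniq (flatten (map (@path_vertices V) ps)) ->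
  M3 * size (flatten (map (@path_vertices V) ps)) <= #|V| ->
  exists x p Q,
  [/\ path e x p, uniq (x :: p), b * size (x :: p) <= #|V|,
      {subset Q <= path_arcs (x, p)} & uniq (arc_vertices Q)] /\
  [/\ excess S T (path_arcs (x, p)) = excess S T (flatten (map (@path_arcs V) ps)),
      c * #|[set a : V * V | sparse_arc g gam Q a.1 a.2]| < #|V| ^ 2,
      forall v, v \notin x :: p -> c * #|[set y | sparse_arc g gam Q v y]| <= #|V| &
      forall v, v \notin x :: p -> c * #|[set y | sparse_arc g gam Q y v]| <= #|V|].
Proof.
(* A connector has at most [l] vertices, so each vertex of a piece is charged [l + 1]. The constant
   [h] makes the three kinds of pieces fit together into [#|V| / b]. *)
move=> M0 MM1 MM2 M2b c0; pose l := 4 * M2; pose h := 8 * b * (l + 1).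
have M20 : 0 < M2 by apply: leq_trans MM2.
have b0 : 0 < b by apply: leq_trans M2b; rewrite muln_gt0.
have h0 : 0 < h by rewrite !muln_gt0 b0 addn1.
pose c1 := c * (2 * h).
have c10 : 0 < c1 by rewrite /c1 muln_gt0 c0 muln_gt0.
have [gam [n1 [gam0 abs]]] := absorbing_arcs h c10.
exists gam, (h + 8 * c1), (n1 + b); split=> // V e S T ps g nbig irr dout din exp eps Ups sps.
set n := #|V| in nbig sps *.
have n0 : 0 < n by apply: leq_trans nbig; rewrite addn_gt0 b0 orbT.
set fps := flatten _ in Ups sps.
have girr : irreflexive g by move=> x; rewrite /g /noncross irr.
have [||Q [Qg QU Qps Qs Qbad]] := abs V g [set x in fps] _ girr.
- by apply: leq_trans nbig; apply: leq_addr.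
- apply: leq_trans sps; apply: leq_mul; first exact: leq_addl.
  by rewrite cardsE card_size.
rewrite -/n in Qs Qbad.
pose U := [set v | n < c * #|[set y | sparse_arc g gam Q v y]|] :|:
          [set v | n < c * #|[set y | sparse_arc g gam Q y v]|].
have cU : 2 * h * #|U| <= 2 * n.
  have h1 := @few_heavy_vertices V (sparse_arc g gam Q) c (2 * h) n0 Qbad.
  have h2 : 2 * h * #|[set v | n < c * #|[set y | sparse_arc g gam Q y v]|]| <= n.
    apply: (@few_heavy_vertices V (fun u v => sparse_arc g gam Q v u) c (2 * h) n0).
    apply: leq_ltn_trans Qbad; rewrite leq_mul2l; apply/orP; right.
    pose sw (p : V * V) := (p.2, p.1).
    have swI : injective sw by move=> [a1 a2] [b1 b2] [-> ->].
    rewrite -(card_imset _ swI); apply/subset_leq_card/subsetP=> _ /imsetP[[u v] + ->].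
    by rewrite !inE.
  apply: leq_trans (leq_mul (leqnn _) (leq_card_setU _ _)) _.
  by rewrite mulnDr (mul2n n) -addnn leq_add.
pose qs := ps ++ [seq (a.1, [:: a.2]) | a <- Q] ++
  [seq (v, [::]) | v <- enum (U :\: [set x in fps ++ arc_vertices Q])].
pose us := enum (U :\: [set x in fps ++ arc_vertices Q]).
have vQ : flatten (map (@path_vertices V) [seq (a.1, [:: a.2]) | a <- Q]) = arc_vertices Q.
  by rewrite /arc_vertices; clear; elim: Q => //= a Q ->.
have vU : flatten (map (@path_vertices V) [seq (v, [::]) | v <- us]) = us.
  by clear; elim: us => //= u us ->.
have vqs : flatten (map (@path_vertices V) qs) = fps ++ arc_vertices Q ++ us.
  by rewrite /qs !map_cat !flatten_cat vQ vU.
have aQ : flatten (map (@path_arcs V) [seq (a.1, [:: a.2]) | a <- Q]) = Q.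
  by clear; elim: Q => //= -[a1 a2] Q ->.
have aU : flatten (map (@path_arcs V) [seq (v, [::]) | v <- us]) = [::].
  by clear; elim: us => //= u us.
have aqs : flatten (map (@path_arcs V) qs) = flatten (map (@path_arcs V) ps) ++ Q.
  by rewrite /qs !map_cat !flatten_cat aQ aU cats0.
have eqs : all (fun q => path e q.1 q.2) qs.
  rewrite /qs !all_cat eps /=; apply/andP; split; last by apply/allP=> _ /mapP[u _ ->].
  apply/allP=> _ /mapP[a aQ' ->] /=; rewrite andbT.
  by have := allP Qg a aQ'; rewrite /g /noncross => /andP[].
have Uqs : uniq (flatten (map (@path_vertices V) qs)).
  rewrite vqs catA cat_uniq enum_uniq andbT; apply/andP; split.
    rewrite cat_uniq Ups QU andbT; apply/hasPn=> x /Qps.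
    by rewrite inE.
  by apply/hasPn=> x; rewrite mem_enum inE inE => /andP[].
have sqs : (l + 1) * size (flatten (map (@path_vertices V) qs)) <= n %/ b.
  rewrite leq_divRL // vqs !size_cat.
  have s1 : h * size fps <= n by apply: leq_trans sps; rewrite leq_mul2r leq_addr orbT.
  have s2 : size (arc_vertices Q) = 2 * size Q.
    by rewrite /arc_vertices; clear; elim: Q => //= a Q; lia.
  have s3 : size us <= #|U|.
    by rewrite -cardE; apply/subset_leq_card; rewrite subsetDl.
  have ar (L B f q u v m : nat) : 8 * B * L * f <= m -> 8 * B * L * q <= m ->
     2 * (8 * B * L) * u <= 2 * m -> v <= u -> L * (f + (2 * q + v)) * B <= m.
    clear; move=> h1 h2 h3 vu; have h4 : B * L * v <= B * L * u by rewrite leq_mul2l vu orbT.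
    move: h1 h2 h3 h4; rewrite (_ : L * _ * B = B * L * f + 2 * (B * L * q) + B * L * v); last by ring.
    rewrite -!mulnA !(mulnA B); move: (B * L) => H; lia.
  by rewrite s2; apply: ar s1 Qs cU s3.
have conn (W : {set V}) u v : #|W| <= n %/ b -> u \in W -> v \in W ->
     exists p, [/\ path g u (rcons p v), uniq p, {in p, forall x, x \notin W} & size p <= l].
  move=> Wb uW vW; apply: (connect_avoiding MM1 MM2 dout din exp uW vW).
    by apply: leq_trans M2b (leq_trans _ nbig); apply: leq_addl.
  apply: leq_trans (leq_mul M2b Wb) _; rewrite mulnC; exact: leq_divM.
have ge x y : g x y -> e x y by case/andP.
have gST x y : g x y -> (x \in S) = (y \notin T) by case/andP=> _ /eqP.
have [x [p [q' [xp_uniq ep [sq aq vq eq']]]]] : exists (x : V) (p : seq V) (q' : seq (V * seq V)),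
    [/\ uniq (x :: p ++ flatten (map (@path_vertices V) q')), path e x p &
     [/\ size (x :: p ++ flatten (map (@path_vertices V) q')) + l * size q' <= n %/ b,
     path_arcs (x, p) ++ flatten (map (@path_arcs V) q') = flatten (map (@path_arcs V) ps) ++ Q,
     {subset flatten (map (@path_vertices V) qs) <= x :: p ++ flatten (map (@path_vertices V) q')} &
     all (fun q => path e q.1 q.2) q']].
  rewrite -aqs; clear -n0 b0 nbig eqs Uqs sqs.
  case: qs eqs Uqs sqs => [|[x p] q'] /=.
    have /card_gt0P[v _] : 0 < #|V| by [].
    exists v, [::], [::]; split=> //; split=> //; rewrite muln0 addn0 /= divn_gt0 //.
    by apply: leq_trans nbig; apply: leq_addl.
  move=> /andP[ep eq'] U' s'; exists x, p, q'; split=> //; split=> //.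
  apply: leq_trans s'; rewrite mulnDl mul1n addnC leq_add // leq_mul2l.
  by rewrite /= size_cat (leq_trans (size_path_vertices q')) ?orbT // ltnW // ltnS leq_addl.
have [p' [ep' Up' sp' ap' [vp' xp']]] := join_paths conn ge gST ep eq' xp_uniq sq.
have notU v : v \notin x :: p' -> v \notin U.
  apply: contra => vU'; apply: vp'; apply: vq; rewrite vqs catA mem_cat.
  case: (boolP (v \in fps ++ arc_vertices Q)) => //= vn.
  by rewrite mem_enum inE vU' inE vn.
exists x, p', Q; split; split=> //.
- by rewrite mulnC -leq_divRL.
- by move=> a aQ'; apply: ap'; rewrite aq mem_cat aQ' orbT.
- by rewrite xp' aq excess_cat addrC (_ : excess S T Q = 0%R) ?add0r // /excess big_seq big1 // => a /(allP Qg)/gST ->; case: (a.2 \in T).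
- apply: leq_ltn_trans Qbad; rewrite leq_mul2r; apply/orP; right.
  by rewrite /c1 leq_pmulr // muln_gt0.
- by move=> v /notU; rewrite !inE negb_or -!leqNgt => /andP[].
- by move=> v /notU; rewrite !inE negb_or -!leqNgt => /andP[].
Qed.

Lemma path_arcs_tails (V : Type) (x : V) p : map fst (path_arcs (x, p)) = belast x p.
Proof. by rewrite /path_arcs /=; elim: p x => //= y p IH x; rewrite IH. Qed.

Lemma path_arcs_heads (V : Type) (x : V) p : map snd (path_arcs (x, p)) = p.
Proof. by rewrite /path_arcs /=; elim: p x => //= y p IH x; rewrite IH. Qed.

Lemma path_successor (V : eqType) (x : V) p : uniq (x :: p) -> exists nx : V -> V,
  [/\ {in path_arcs (x, p), forall a, nx a.1 = a.2}, {in belast x p &, injective nx},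
      {in belast x p, forall v, nx v \in p} &
      {in belast x p, forall v, (v, nx v) \in path_arcs (x, p)}].
Proof.
elim: p x => [|y p IH] x; first by exists id; split=> v.
case/andP=> xyp Uyp; have [nx [n1 n2 n3 n4]] := IH y Uyp.
have tailD a : a \in path_arcs (y, p) -> a.1 \in belast y p.
  by move=> ap; rewrite -path_arcs_tails map_f.
have bD v : v \in belast y p -> (v == x) = false.
  by move=> vb; apply: contraNF xyp => /eqP <-; apply: mem_belast.
exists (fun v => if v == x then y else nx v); split.
- move=> a; rewrite inE => /orP[/eqP -> /=|ap]; first by rewrite eqxx.
  by rewrite bD ?tailD // n1.
- have yD v : v \in belast y p -> nx v <> y.
    by move=> /n3 + E; rewrite E => yp; case/andP: Uyp; rewrite yp.
  move=> u v /=; rewrite !inE => /orP[/eqP ->|ub] /orP[/eqP ->|vb] //; rewrite ?eqxx ?bD //.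
  + by move=> E; case: (yD v vb).
  + by move=> E; case: (yD u ub).
  + exact: n2.
- move=> v /=; rewrite !inE => /orP[/eqP ->|vb]; rewrite ?eqxx ?bD // n3 ?orbT //.
- move=> v /=; rewrite !inE => /orP[/eqP ->|vb]; rewrite ?eqxx ?bD // n4 ?orbT //.
Qed.

Lemma sum_mem_uniq (V : finType) (s : seq V) (S : {set V}) : uniq s ->
  (\sum_(v <- s) (v \in S)%:Z = #|[set v in s | v \in S]|%:Z)%R.
Proof.
move=> Us; rewrite (_ : [set v in s | _] = [set v in [set v in s] | v \in S]); last first.
  by apply/setP=> v; rewrite !inE.
rewrite -(sum_rel_row (fun v => v \in S)) -natz natr_sum big_uniq //=.
rewrite [RHS](eq_bigl (mem s)); last by move=> v; rewrite inE.
by apply: eq_bigr => v _; rewrite natz.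
Qed.

Lemma excess_path (V : finType) (S T : {set V}) (x : V) p : uniq (x :: p) ->
  (excess S T (path_arcs (x, p)) =
   #|[set v in belast x p | v \in S]|%:Z + #|[set v in p | v \in T]|%:Z - (size p)%:Z)%R.
Proof.
move=> Up; have Ub : uniq (belast x p) by move: Up; rewrite lastI rcons_uniq => /andP[].
case/andP: Up => _ Up; rewrite /excess big_split big_split /=; congr (_ + _ + _)%R.
- by rewrite -sum_mem_uniq // -path_arcs_tails big_map.
- by rewrite -[p in RHS](path_arcs_heads x) -sum_mem_uniq ?path_arcs_heads // -{2}(path_arcs_heads x p) big_map.
- rewrite big_const_seq count_predT -(size_map snd) path_arcs_heads.
  by elim: (size p) => //= m ->; lia.
Qed.

(** If [X] had too few neighbours, the remaining heads [Y] would receive no arc of [K] from [X],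
    although [#|X| + #|Y|] is almost [#|Lb|]. There [g] has many arcs, more than the passage from
    [g] to [K] can lose. *)
Lemma robust_block (V : finType) (g K : rel V) (Lb Rb : {set V}) (M1 M2 : nat) :
  0 < M1 -> M1 <= M2 -> #|Lb| = #|Rb| ->
  (forall x y, K x y -> (x \in Lb) = (y \in Rb)) ->
  {in Lb, forall x, 2 * (#|V| %/ M1).+1 <= #|[set y in Rb | K x y]|} ->
  {in Rb, forall y, 2 * (#|V| %/ M1).+1 <= #|[set x in Lb | K x y]|} ->
  (forall X Y : {set V}, X \subset Lb -> Y \subset Rb ->
     #|V| <= M1 * #|X| -> #|V| <= M1 * #|Y| ->
     2 * M2 * #|Lb| <= 2 * M2 * (#|X| + #|Y|) + #|V| ->
     #|V| ^ 2 <= M2 * arcs g X Y) ->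
  (forall X Y : {set V}, X \subset Lb -> Y \subset Rb ->
     M2 * arcs g X Y < M2 * arcs K X Y + #|V| ^ 2) ->
  expanding_block K Lb Rb (2 * (#|V| %/ M1).+1) (#|V| %/ (2 * M2)).
Proof.
move=> M10 M12 LR Kb dL dR rh loss; split=> // X XL dX XdL; set n := #|V| in dL dR rh loss dX XdL *.
set N := [set y in Rb | _]; rewrite leqNgt; apply/negP=> small.
pose Y := Rb :\: N.
have YR : Y \subset Rb by apply: subsetDl.
have cY : #|N| + #|Y| = #|Lb|.
  rewrite LR -(cardsID N Rb); congr (_ + _); apply: eq_card => y; rewrite !inE.
  by case: (y \in Rb).
have d2 : n %/ (2 * M2) <= n %/ M1.
  by rewrite leq_div2l // (leq_trans M12) // mul2n -addnn leq_addr.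
have h2 : 2 * M2 * (n %/ (2 * M2)) <= n by rewrite mulnC leq_divM.
have h1 : n < (n %/ M1).+1 * M1 by rewrite ltn_ceil.
have bigd : n <= M1 * (n %/ M1).+1 by rewrite mulnC ltnW.
have no : arcs K X Y = 0.
  rewrite /arcs big1 // => x xX; rewrite big1 // => y; rewrite !inE negb_and => /andP[yN yR].
  move: yN; rewrite yR /=; case Kxy: (K x y) => //= /negP[].
  by apply/existsP; exists x; rewrite xX.
have := loss X Y XL YR; rewrite no muln0 add0n ltnNge => /negP; apply; apply: rh => //.
- apply: leq_trans bigd _; rewrite leq_mul2l; apply/orP; right.
  by apply: leq_trans dX; rewrite mul2n -addnn leq_addr.
- apply: leq_trans bigd _; rewrite leq_mul2l; apply/orP; right.
  move: XdL small cY d2; clear; move: #|X| #|N| #|Y| #|Lb| (n %/ M1) (n %/ _); lia.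
- apply: leq_trans (leq_add (leqnn _) h2); rewrite -mulnDr leq_mul2l; apply/orP; right.
  move: small cY; clear; lia.
Qed.

Lemma matching_block_augment (V : finType) (K h : rel V) (L0 S R0 R1 : {set V}) (d1 d2 l : nat) :
  expanding_block K (L0 :&: S) (R0 :&: R1) d1 d2 ->
  expanding_block K (L0 :\: S) (R0 :\: R1) d1 d2 ->
  0 < d2 <= d1 -> #|V| < l.+1 * d2 ->
  forall D f u, matches K D f -> D \subset L0 -> u \in L0 -> u \notin D ->
     exists f', matches K (u |: D) f' /\
       #|[set x in D | h x (f x)]| <= #|[set x in u |: D | h x (f' x)]| + l.
Proof.
move=> b1 b2 d12 Vl D f u mf DL uL uD.
have [f' [s [mf' sd cf']]] : exists f' s, [/\ matches K (u |: D) f', s * d2 <= #|V| &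
    #|[set x in D | h x (f x)]| <= #|[set x in u |: D | h x (f' x)]| + s].
  have [uS|uS] := boolP (u \in S).
    by apply: (augment_block h b1 d12 mf) => //; rewrite inE uL.
  by apply: (augment_block h b2 d12 mf) => //; rewrite inE uL uS.
exists f'; split=> //; apply: leq_trans cf' _; rewrite leq_add2l.
have := leq_ltn_trans sd Vl; rewrite ltn_mul2r ltnS => /andP[] //.
Qed.

(** * Hamilton cycles from robust expansion *)

(** An orbit other than that of [z] must meet [H]: otherwise its colour would increase at every step
    and yet return to its initial value. *)
Lemma few_orbits (V : finType) (s : {perm V}) (col : V -> nat) (z : V) (H : {set V}) :
  (forall v, v \notin porbit s z -> v \notin H -> col (s v) = (col v).+1) ->
  #|porbits s| <= #|H|.+1.
Proof.
move=> inc; apply: (@leq_trans #|porbit s z |: (porbit s @: H)|); last first.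
  rewrite cardsU1; apply: (leq_add (leq_b1 _) (leq_imset_card _ _)).
apply/subset_leq_card/subsetP=> _ /imsetP[v _ ->]; rewrite !inE.
have [vz|vz] := boolP (v \in porbit s z); first by rewrite eq_porbit_mem vz.
apply/orP; right; have [/existsP[w /andP[wv wH]]|no] :=
  boolP [exists w, (w \in porbit s v) && (w \in H)].
  by apply/imsetP; exists w => //; apply/eqP; rewrite eq_sym eq_porbit_mem.
exfalso; have it i : col ((s ^+ i)%g v) = col v + i.
  elim: i => [|i IH]; first by rewrite perm1 addn0.
  rewrite expgSr permM inc ?IH ?addnS //.
    by apply: contra vz => iz; rewrite -!eq_porbit_mem porbit_perm in iz *.
  by move: no; rewrite negb_exists => /forallP/(_ ((s ^+ i)%g v)); rewrite mem_porbit.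
have := it (#[s]%g); rewrite expg_order perm1; have := order_gt0 s; lia.
Qed.

Lemma path_sub_porbit (V : finType) (s : {perm V}) (x : V) p :
  {in path_arcs (x, p), forall a, s a.1 = a.2} -> {subset x :: p <= porbit s x}.
Proof.
elim: p x => [|y p IH] x sp v; first by rewrite inE => /eqP ->; apply: porbit_id.
rewrite inE => /orP[/eqP ->|vp]; first exact: porbit_id.
have xy : s x = y by apply: (sp (x, y)); rewrite inE eqxx.
have := IH y _ v vp; rewrite -xy.
have -> : porbit s (s x) = porbit s x by have := porbit_perm s 1 x; rewrite expg1.
by apply=> a ap; apply: sp; rewrite xy in ap; rewrite inE ap orbT.
Qed.

Lemma arcs_loss (V : finType) (g K B D : rel V) (X Y : {set V}) :
  (forall x y, x \in X -> y \in Y -> g x y -> [|| K x y, B x y | D x y]) ->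
  arcs g X Y <= arcs K X Y + #|[set a : V * V | B a.1 a.2]| + \sum_x #|[set y | D x y]|.
Proof.
move=> H; rewrite card_rel -addnA -big_split /= !arcs_rows.
rewrite big_mkcond [X in _ <= X + _]big_mkcond -big_split /=; apply: leq_sum => x _.
case: ifP => // xX; rewrite (leq_trans _ (leq_add (leqnn _) (leq_card_setU _ _))) //.
rewrite (leq_trans _ (leq_card_setU _ _)) //; apply/subset_leq_card/subsetP=> y.
by rewrite !inE => /andP[yY /(H x y xX yY)]; rewrite yY.
Qed.

Lemma row_loss (V : finType) (g K B D : pred V) (P : {set V}) :
  (forall y, g y -> [|| K y, B y, D y | y \in P]) ->
  #|[set y | g y]| <= #|[set y | K y]| + (#|[set y | B y]| + #|[set y | D y]| + #|P|).
Proof.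
move=> H; rewrite -addnA (leq_trans _ (leq_add (leqnn _) (leq_add (leqnn _) (leq_card_setU _ _)))) //.
rewrite (leq_trans _ (leq_add (leqnn _) (leq_card_setU _ _))) // (leq_trans _ (leq_card_setU _ _)) //.
by apply/subset_leq_card/subsetP=> y; rewrite !inE => /H.
Qed.

(** Expansion of [X] against its complement serves to build the path; the next two conditions make
    the two blocks of the double cover expand, with room to delete some arcs. The excess prescribed
    for [ps] is the one that every permutation of [V] has. *)
Theorem robust_hamilton (M M1 M2 : nat) : 0 < M -> 4 * M <= M1 -> M1 <= M2 ->
  exists M3 n0, forall (V : finType) (e : rel V) (S T : {set V}) (ps : seq (V * seq V)),
  let g := noncross e S T in
  n0 <= #|V| -> irreflexive e ->
  (forall x, #|V| <= M * #|[set y | g x y]|) ->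
  (forall y, #|V| <= M * #|[set x | g x y]|) ->
  (forall X : {set V}, #|V| <= M1 * #|X| -> #|V| <= M1 * #|~: X| ->
     #|V| ^ 2 <= M2 * arcs g X (~: X)) ->
  (forall X Y : {set V}, X \subset S -> Y \subset ~: T ->
     #|V| <= M1 * #|X| -> #|V| <= M1 * #|Y| ->
     M2 * #|S| <= M2 * (#|X| + #|Y|) + #|V| -> #|V| ^ 2 <= M2 * arcs g X Y) ->
  (forall X Y : {set V}, X \subset ~: S -> Y \subset T ->
     #|V| <= M1 * #|X| -> #|V| <= M1 * #|Y| ->
     M2 * #|T| <= M2 * (#|X| + #|Y|) + #|V| -> #|V| ^ 2 <= M2 * arcs g X Y) ->
  all (fun q => path e q.1 q.2) ps ->
  uniq (flatten (map (@path_vertices V) ps)) ->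
  (excess S T (flatten (map (@path_arcs V) ps)) = #|S|%:Z + #|T|%:Z - #|V|%:Z)%R ->
  M3 * size (flatten (map (@path_vertices V) ps)) <= #|V| ->
  has_hamilton_cycle e.
Proof.
move=> M0 MM1 M12; pose c := 8 * M2.
have M20 : 0 < M2 by apply: leq_trans M12; apply: leq_trans MM1; rewrite muln_gt0.
have MM2 : 4 * M <= M2 by apply: leq_trans M12.
have c0 : 0 < c by rewrite muln_gt0.
have [|||gam [M3 [n1 [gam0 abs]]]] := @absorbing_path M M1 M2 c c M0 _ _ _ c0.
- by apply: leq_trans MM1; rewrite leq_mul2r orbT.
- by apply: leq_trans MM2; rewrite leq_pmull.
- by rewrite leq_mul2r orbT.
(* Matching one more tail changes at most [c] other images, so a loss of [#|V| / (gam * (c + 1))] at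
   this stage becomes at most [#|V| / gam] in the end. *)
have [|n2 incm] := @increasing_matching (gam * (c + 1)) (2 * c).
  by rewrite muln_gt0 gam0 addn1.
exists M3, (n1 + n2 + c) => V e S T ps g; set n := #|V| => nbig irr dout din Hexp H1 H2 eps Ups xps sps.
have nc : c <= n by apply: leq_trans nbig; apply: leq_addl.
have n0 : 0 < n by apply: leq_trans nc.
have [|x0 [p [Q [[ep Up sp QP QU] [xp badQ badr badc]]]]] :=
  abs V e S T ps _ irr dout din Hexp eps Ups sps.
  by apply: leq_trans nbig; rewrite -addnA leq_addr.
rewrite -/n in sp badQ badr badc; rewrite -/g in badQ badr badc.
pose P := [set v in x0 :: p].
have cP : c * #|P| <= n by apply: leq_trans sp; rewrite leq_mul2l cardsE card_size orbT.
have [nx [nx1 nxI nxp nxa]] := path_successor Up.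
have Ub : uniq (belast x0 p) by move: Up; rewrite lastI rcons_uniq => /andP[].
have Upp : uniq p by case/andP: Up.
pose t0 := last x0 p.
(* The last vertex [t0] of the path still needs an image and the first vertex [x0] a preimage: [t0]
   remains a tail and [x0] a head. *)
pose L0 := ~: [set v in belast x0 p]; pose R0 := ~: [set v in p].
have cL0 : #|L0| + size p = n.
  have := cardsC [set v in belast x0 p]; rewrite -/L0 -/n cardsE (card_uniqP Ub) size_belast; lia.
have cR0 : #|R0| + size p = n.
  have := cardsC [set v in p]; rewrite -/R0 -/n cardsE (card_uniqP Upp); lia.
have LR0 : #|L0| = #|R0| by lia.
have L0P x : x \in L0 -> x != t0 -> x \notin x0 :: p.
  move=> xL xt; apply/negP; rewrite lastI mem_rcons inE (negbTE xt) /= => h.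
  by move: xL; rewrite !inE h.
have R0P y : y \in R0 -> y != x0 -> y \notin x0 :: p.
  by rewrite !inE => yb /negbTE ->; rewrite (negbTE yb).
pose sparse := sparse_arc g gam Q.
(* Sparse arcs are allowed at [t0] and into [x0]. These vertices lie on the path, where nothing
   bounds their sparse arcs, and the arcs in question belong to the cycle through the path, which
   does not have to be absorbed. *)
pose K x y := [&& x \in L0, y \in R0, g x y & [|| ~~ sparse x y, x == t0 | y == x0]].
have gST x y : g x y -> (x \in S) = (y \notin T) by case/andP=> _ /eqP.
have KLR x y : K x y -> (x \in L0) && (y \in R0) by case/and4P=> -> ->.
(* The excess of the path is exactly what balances the remaining classes. *)
have balS : #|L0 :&: S| = #|R0 :\: T|.
  have := excess_path S T Up; rewrite xp xps.
  have h1 : #|L0 :&: S| + #|[set v in belast x0 p | v \in S]| = #|S|.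
    rewrite addnC -(cardsID [set v in belast x0 p] S); congr (_ + _); apply: eq_card => v; rewrite !inE andbC //.
  have h2 : #|R0 :\: T| + #|T| + size p = n + #|[set v in p | v \in T]|.
    rewrite -cR0 -(cardsID T R0) [#|T|](_ : _ = #|R0 :&: T| + #|[set v in p | v \in T]|); first by clear; lia.
    rewrite addnC -(cardsID [set v in p] T); congr (_ + _); apply: eq_card => v; rewrite !inE andbC //.
  move: h1 h2; rewrite -/n; move: #|L0 :&: S| #|R0 :\: T| #|S| #|T| (n) #|_| #|_| (size p); clear; lia.
have balC : #|L0 :\: S| = #|R0 :&: T|.
  have := cardsID S L0; have := cardsID T R0; rewrite balS LR0; clear; lia.
pose r := n %/ c.
have rn : c * r <= n by rewrite mulnC leq_divM.
have nr : n <= 2 * c * r.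
  have : n < r.+1 * c by rewrite ltn_ceil.
  have : 0 < r by rewrite divn_gt0.
  move: (c) => c'; clear; nia.
have r0 : 0 < r by rewrite divn_gt0.
(* The allowance of [r] deletions at every vertex is what peeling off matchings requires. Deleted
   arcs, sparse arcs and the vertices of the path cost at most [n / c] each per vertex, little
   compared with [n / M]. *)
have blocks (K' : rel V) : (forall x y, K' x y -> K x y) ->
     (forall x, #|[set y | K x y && ~~ K' x y]| <= r) ->
     (forall y, #|[set x | K x y && ~~ K' x y]| <= r) ->
     expanding_block K' (L0 :&: S) (R0 :\: T) (2 * (n %/ M1).+1) (n %/ (2 * M2)) /\
     expanding_block K' (L0 :\: S) (R0 :&: T) (2 * (n %/ M1).+1) (n %/ (2 * M2)).
  move=> K'K Kr Kc.
  have q1 : M1 * (n %/ M1) <= n by rewrite mulnC leq_divM.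
  have ar2 (m m1 m2 q dk bd dd sz : nat) : m <= M * (dk + (bd + dd + sz)) ->
      8 * m2 * bd <= m -> 8 * m2 * dd <= m -> 8 * m2 * sz <= m -> 4 * M <= m2 ->
      m1 * q <= m -> 4 * M <= m1 -> 8 * m2 <= m -> 2 * q.+1 <= dk.
    clear -M0; move=> h0 h1 h2 h3 h4 h5 h6 h7.
    have g1 (z : nat) : 8 * m2 * z <= m -> 32 * (M * z) <= m.
      apply: leq_trans; rewrite mulnA leq_mul2r; apply/orP; right; lia.
    have g2 : 4 * (M * q) <= m by apply: leq_trans h5; rewrite mulnA leq_mul2r h6 orbT.
    move: (g1 _ h1) (g1 _ h2) (g1 _ h3) h0; rewrite !mulnDr => u1 u2 u3 u0.
    rewrite leqNgt; apply/negP=> u4.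
    have : M * dk <= M * (2 * q + 1) by rewrite leq_mul2l; apply/orP; right; lia.
    rewrite mulnDr muln1 mulnCA; lia.
  have loss (X Y : {set V}) : X \subset L0 -> Y \subset R0 -> M2 * arcs g X Y < M2 * arcs K' X Y + n ^ 2.
    move=> XL YR.
    have h1 : arcs g X Y <= arcs K' X Y + #|[set a : V * V | sparse a.1 a.2]| +
        \sum_x #|[set y | K x y && ~~ K' x y]|.
      apply: (@arcs_loss V g K' sparse (fun x y => K x y && ~~ K' x y)) => x y xX yY gxy.
      rewrite /K (subsetP XL x xX) (subsetP YR y yY) gxy /=.
      by case: (K' x y) => //=; rewrite andbT; case: (sparse x y).
    have h2 : \sum_x #|[set y | K x y && ~~ K' x y]| <= n * r.
      by rewrite -sum_nat_const; apply: leq_sum => x _; apply: Kr.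
    have ar (m m2 u s a a' : nat) : 8 * m2 * u < m ^ 2 -> 8 * m2 * r <= m ->
        a <= a' + u + s -> s <= m * r -> m2 * a < m2 * a' + m ^ 2.
      clear; move=> h1 h2 h3 h4.
      have g1 : m2 * a <= m2 * a' + m2 * u + m2 * s by rewrite -!mulnDr leq_mul2l h3 orbT.
      have g2 : 8 * (m2 * s) <= m ^ 2.
        rewrite -mulnn mulnA; apply: leq_trans (leq_mul (leqnn _) h4) _.
        by rewrite mulnCA leq_mul2l h2 orbT.
      move: h1; rewrite -mulnA; lia.
    exact: ar badQ rn h1 h2.
  have dL x : x \in L0 -> 2 * (n %/ M1).+1 <= #|[set y | K' x y]|.
    move=> xL; pose B y := sparse x y && (x != t0).
    have cB : c * #|[set y | B y]| <= n.
      have [xt|xt] := eqVneq x t0.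
        by rewrite (_ : [set y | _] = set0) ?cards0 ?muln0 //; apply/setP=> y; rewrite !inE /B xt eqxx andbF.
      apply: leq_trans (badr x (L0P x xL xt)); rewrite leq_mul2l; apply/orP; right.
      by apply/subset_leq_card/subsetP=> y; rewrite !inE => /andP[].
    have h1 := @row_loss V (g x) (K' x) B (fun y => K x y && ~~ K' x y) P _.
    apply: (ar2 n M1 M2 _ _ #|[set y | B y]| #|[set y | K x y && ~~ K' x y]| #|P|) => //.
    + apply: leq_trans (dout x) _; rewrite leq_mul2l h1 ?orbT // => y gxy.
      rewrite inE; case: (boolP (y \in x0 :: p)) => yP; rewrite ?orbT // !orbF.
      have yR : y \in R0 by move: yP; rewrite !inE negb_or => /andP[].
      rewrite /K xL yR gxy /B /=.
      by case: (K' x y) => //=; case: (sparse x y) => //=; case: (x == t0).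
    + by apply: leq_trans rn; rewrite leq_mul2l Kr orbT.
  have dR y : y \in R0 -> 2 * (n %/ M1).+1 <= #|[set x | K' x y]|.
    move=> yR; pose B x := sparse x y && (y != x0).
    have cB : c * #|[set x | B x]| <= n.
      have [yx|yx] := eqVneq y x0.
        by rewrite (_ : [set x | _] = set0) ?cards0 ?muln0 //; apply/setP=> x; rewrite !inE /B yx eqxx andbF.
      apply: leq_trans (badc y (R0P y yR yx)); rewrite leq_mul2l; apply/orP; right.
      by apply/subset_leq_card/subsetP=> x; rewrite !inE => /andP[].
    have h1 := @row_loss V (g^~ y) (K'^~ y) B (fun x => K x y && ~~ K' x y) P _.
    apply: (ar2 n M1 M2 _ _ #|[set x | B x]| #|[set x | K x y && ~~ K' x y]| #|P|) => //.
    + apply: leq_trans (din y) _; rewrite leq_mul2l h1 ?orbT // => x gxy.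
      rewrite inE; case: (boolP (x \in x0 :: p)) => xP; rewrite ?orbT // !orbF.
      have xL : x \in L0 by move: xP; rewrite lastI mem_rcons !inE negb_or => /andP[].
      rewrite /K xL yR gxy /B /=.
      by case: (K' x y) => //=; case: (sparse x y) => //=; case: (y == x0); rewrite ?orbT.
    + by apply: leq_trans rn; rewrite leq_mul2l Kc orbT.
  have K'b x y : K' x y -> [&& x \in L0, y \in R0 & (x \in S) == (y \notin T)].
    by move=> /K'K /and4P[-> -> /gST -> _] /=; rewrite eqxx.
  have ar3 (m m2 s lb pp k : nat) : 8 * m2 * pp <= m -> s <= lb + pp ->
     2 * m2 * lb <= 2 * m2 * k + m -> m2 * s <= m2 * k + m.
    clear; move=> h1 h2 h3; have : m2 * s <= m2 * lb + m2 * pp by rewrite -mulnDr leq_mul2l h2 orbT.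
    by move: h1 h3; rewrite -!mulnA; lia.
  have M10 : 0 < M1 by apply: leq_trans MM1; rewrite muln_gt0.
  split; apply: (@robust_block V g K') => //.
  - by move=> x y /K'b /and3P[xL yR /eqP xy]; rewrite !inE in xL yR *; rewrite xL yR xy andbT.
  - move=> x; rewrite inE => /andP[xL xS]; apply: leq_trans (dL x xL) _.
    apply/subset_leq_card/subsetP=> y; rewrite inE => Kxy; have /and3P[_ yR] := K'b _ _ Kxy.
    by rewrite xS => /eqP yT; rewrite in_set Kxy in_setD yR -yT.
  - move=> y; rewrite inE => /andP[yT yR]; apply: leq_trans (dR y yR) _.
    apply/subset_leq_card/subsetP=> x; rewrite inE => Kxy; have /and3P[xL _] := K'b _ _ Kxy.
    by rewrite yT => /eqP xS; rewrite in_set Kxy in_setI xL xS.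
  - move=> X Y XL YR bX bY XY; apply: H1 => //.
    + exact: subset_trans XL (subsetIr _ _).
    + by apply: subset_trans YR _; apply/subsetP=> y; rewrite !inE => /andP[].
    + apply: ar3 cP _ XY; rewrite (leq_trans _ (leq_card_setU _ _)) //.
      apply/subset_leq_card/subsetP=> v vS; rewrite in_setU in_setI vS andbT !inE.
      by case: (boolP (v \in belast x0 p)) => //= /mem_belast; rewrite inE.
  - by move=> X Y XL YR; apply: loss; [apply: subset_trans XL (subsetIl _ _) | apply: subset_trans YR (subsetDl _ _)].
  - by move=> x y /K'b /and3P[xL yR /eqP xy]; rewrite !inE in xL yR *; rewrite xL yR xy andbT negbK.
  - move=> x; rewrite inE => /andP[xS xL]; apply: leq_trans (dL x xL) _.
    apply/subset_leq_card/subsetP=> y; rewrite inE => Kxy; have /and3P[_ yR] := K'b _ _ Kxy.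
    by rewrite (negbTE xS) => /eqP yT; rewrite in_set Kxy in_setI yR -[_ \in T]negbK -yT.
  - move=> y; rewrite inE => /andP[yR yT]; apply: leq_trans (dR y yR) _.
    apply/subset_leq_card/subsetP=> x; rewrite inE => Kxy; have /and3P[xL _] := K'b _ _ Kxy.
    by rewrite yT => /eqP xS; rewrite in_set Kxy in_setD xL xS.
  - move=> X Y XL YR bX bY XY; apply: H2 => //.
    + by apply: subset_trans XL _; apply/subsetP=> x; rewrite !inE => /andP[].
    + exact: subset_trans YR (subsetIr _ _).
    + apply: ar3 cP _ XY; rewrite balC (leq_trans _ (leq_card_setU _ _)) //.
      apply/subset_leq_card/subsetP=> v vS; rewrite in_setU in_setI vS andbT !inE.
      by case: (boolP (v \in p)) => //= _; rewrite orbT.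
  - by move=> X Y XL YR; apply: loss; [apply: subset_trans XL (subsetDl _ _) | apply: subset_trans YR (subsetIl _ _)].
have M10 : 0 < M1 by apply: leq_trans MM1; rewrite muln_gt0.
pose d1 := 2 * (n %/ M1).+1; pose d2 := n %/ (2 * M2).
have n2M : 2 * M2 <= n by apply: leq_trans nc; rewrite leq_mul2r orbT.
have d20 : 0 < d2 by rewrite divn_gt0 // muln_gt0.
have d12 : 0 < d2 <= d1.
  rewrite d20 /d1; apply: (@leq_trans (n %/ M1)); last by rewrite mul2n -addnn leqW // leq_addr.
  by rewrite leq_div2l // (leq_trans M12) // mul2n -addnn leq_addr.
have nd2 : n < c.+1 * d2.
  have : n < d2.+1 * (2 * M2) by rewrite ltn_ceil // muln_gt0.
  rewrite /c; move: d20; clear; nia.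
have aug (h K' : rel V) : (forall x y, K' x y -> K x y) ->
     (forall x, #|[set y | K x y && ~~ K' x y]| <= r) ->
     (forall y, #|[set x | K x y && ~~ K' x y]| <= r) ->
  forall (D : {set V}) f, matches K' D f -> D \subset L0 ->
  exists f', matches K' L0 f' /\
    #|[set x in D | h x (f x)]| <= #|[set x in L0 | h x (f' x)]| + c * (#|L0| - #|D|).
  move=> k1 k2 k3; have [b1 b2] := blocks K' k1 k2 k3.
  apply: matching_extend; apply: (@matching_block_augment V K' h L0 S R0 (~: T) d1 d2) => //.
    by rewrite -setDE.
  by rewrite (setDE R0) setCK.
have [|R [RK Rl Rr]] := regular_subrelation LR0 KLR (r := r).
  move=> K' k1 k2 k3; have [||f [mf _]] := aug (fun _ _ => false) K' k1 k2 k3 set0 id.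
  - by split=> x; rewrite inE.
  - exact: sub0set.
  by exists f.
have [||||||col [D [f [DL [fI fR] cD]]]] := incm V R L0 R0 r => //.
- by apply: leq_trans nbig; rewrite addnC addnA leq_addl.
- by move=> x y /RK/KLR.
pose h (x y : V) := col y == (col x).+1.
have [|x|x|||f' [[f'I f'K] cf']] := aug h K _ _ _ D f => //.
- by rewrite (_ : [set y | _] = set0) ?cards0 //; apply/setP=> y; rewrite !inE; case: (K x y).
- by rewrite (_ : [set y | _] = set0) ?cards0 //; apply/setP=> y; rewrite !inE; case: (K y x).
- by split=> // x xD; apply: RK; case/andP: (fR x xD).
(* The tails at which the colour does not increase. The number of orbits is at most [#|H|.+1], and
   every arc used outside the orbit of the path has at least [n / gam >= #|H|] hits, as
   [merge_orbits] demands. *)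
pose H := [set x in L0 | ~~ h x (f' x)].
have cH : gam * #|H| <= n.
  have h1 : #|[set x in D | h x (f x)]| = #|D|.
    by apply: eq_card => x; rewrite !inE /h; case: (boolP (x \in D)) => // /fR /andP[_ ->].
  have h2 : #|[set x in L0 | h x (f' x)]| + #|H| = #|L0|.
    rewrite -(cardsID [set x | h x (f' x)] L0); congr (_ + _); apply: eq_card => x; rewrite !inE andbC //.
  have h3 : #|H| <= (c + 1) * (#|L0| - #|D|).
    move: cf'; rewrite h1 mulnDl mul1n; have := subset_leq_card DL.
    move: h2; clear; move: (c * _) => z; lia.
  by apply: leq_trans cD; rewrite -mulnA leq_mul2l h3 orbT.
pose F v := if v \in belast x0 p then nx v else f' v.
have FL v : v \in L0 -> F v = f' v by rewrite /F !inE => /negbTE ->.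
have Fb v : v \in belast x0 p -> F v = nx v by rewrite /F => ->.
have notb v : v \notin belast x0 p -> v \in L0 by rewrite !inE.
have Finj : injective F.
  have dis a b : a \in belast x0 p -> b \in L0 -> F a <> F b.
    move=> ab bL; rewrite Fb // FL // => E; have := nxp a ab; rewrite E.
    by have /and3P[_ + _] := f'K b bL; rewrite !inE => /negbTE ->.
  move=> a b; have [ab|/notb aL] := boolP (a \in belast x0 p);
    have [bb|/notb bL] := boolP (b \in belast x0 p).
  - by rewrite !Fb //; apply: nxI.
  - by move=> E; case: (dis a b).
  - by move=> /esym E; case: (dis b a).
  - by rewrite !FL //; apply: f'I.
pose s := perm Finj.
have sE v : s v = F v by rewrite permE.
have path_sub : {subset x0 :: p <= porbit s x0}.
  apply: path_sub_porbit => a ap; rewrite sE Fb ?nx1 //.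
  by rewrite -path_arcs_tails map_f.
have outP v : v \notin porbit s x0 -> v \in L0 /\ v != t0.
  move=> vz; have vp : v \notin x0 :: p by apply: contra vz => /path_sub.
  by move: vp; rewrite lastI mem_rcons inE negb_or => /andP[-> /notb].
apply: (@merge_orbits V e #|H| s [set a.1 | a in Q] x0).
- move=> u; rewrite sE; have [ub|/notb uL] := boolP (u \in belast x0 p).
    rewrite Fb //; move: ep; rewrite path_arcs_all => /allP /(_ _ (nxa u ub)) //.
  by rewrite FL //; have /and4P[_ _ /andP[]] := f'K u uL.
- move=> _ /imsetP[a aQ ->]; apply: path_sub; apply: mem_belast.
  by rewrite -path_arcs_tails map_f // QP.
- move=> u uz; have [uL ut] := outP u uz.
  have sx0 : f' u != x0.
    apply: contra uz => /eqP E; rewrite -E -FL // -sE porbit_sym.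
    by have := mem_porbit s 1 u; rewrite expg1.
  have /and4P[_ _ gu] := f'K u uL; rewrite (negbTE ut) (negbTE sx0) !orbF negb_and gu /= -leqNgt => hu.
  have {}hu : #|H| <= hits g Q u (s u).
    by rewrite sE FL // -(leq_pmul2l gam0) (leq_trans cH).
  apply: leq_trans hu _; rewrite /hits -size_filter -(size_map fst).
  have Uf : uniq (map fst (filter (fun a => g a.1 (s u) && g u a.2) Q)).
    have sub : subseq (map fst Q) (arc_vertices Q).
      rewrite /arc_vertices; clear; elim: Q => //= a Q IH; rewrite eqxx.
      exact: (subseq_trans IH (subseq_cons _ a.2)).
    apply: subseq_uniq QU; apply: subseq_trans sub; apply: map_subseq; exact: filter_subseq.
  rewrite -(card_uniqP Uf); apply/subset_leq_card/subsetP=> x /mapP[a].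
  rewrite mem_filter => /andP[/andP[ga gua] aQ] ->; rewrite inE imset_f //=.
  have -> : s a.1 = a.2.
    by rewrite sE Fb ?nx1 ?QP // -path_arcs_tails map_f // QP.
  by case/andP: ga => -> _; case/andP: gua.
- apply: (@few_orbits V s col x0 H) => v vz vH; have [vL vt] := outP v vz.
  by move: vH; rewrite inE vL /= negbK sE FL // => /eqP.
Qed.

(** * The degree condition *)

(** The degree condition multiplied by four, with the constant moved to the right so that no
    truncated subtraction occurs. *)
Definition ore (V : finType) (e : rel V) : Prop :=
  forall x y : V, x != y -> ~~ e x y -> 3 * #|V| <= 4 * (outdeg e x + indeg e y) + 3.

Definition nonarcs (V : finType) (e : rel V) (X Y : {set V}) : nat :=
  \sum_(x in X) \sum_(y in Y) ((x != y) && ~~ e x y : nat).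

Lemma oriented_rev (V : finType) (e : rel V) :
  oriented_graph e -> oriented_graph (fun x y => e y x).
Proof.
by case=> irr anti; split=> [x|x y xy]; rewrite ?irr // andbC; apply: anti.
Qed.

Lemma ore_rev (V : finType) (e : rel V) : ore e -> ore (fun x y => e y x).
Proof.
move=> oe x y xy nyx; have := oe y x; rewrite eq_sym xy nyx (addnC (outdeg e y)).
exact.
Qed.

Lemma arcs_rev (V : finType) (e : rel V) (X Y : {set V}) :
  arcs (fun x y => e y x) X Y = arcs e Y X.
Proof. by rewrite /arcs exchange_big. Qed.

Lemma arcs_splitr (V : finType) (e : rel V) (X Y Z : {set V}) :
  arcs e X Y = arcs e X (Y :&: Z) + arcs e X (Y :\: Z).
Proof. by rewrite /arcs -big_split; apply: eq_bigr => x _; rewrite (big_setID Z). Qed.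

Lemma arcs_splitl (V : finType) (e : rel V) (X Y Z : {set V}) :
  arcs e X Y = arcs e (X :&: Z) Y + arcs e (X :\: Z) Y.
Proof. by rewrite /arcs (big_setID Z). Qed.

Lemma arcs_sub (V : finType) (e : rel V) (X Y X' Y' : {set V}) :
  X \subset X' -> Y \subset Y' -> arcs e X Y <= arcs e X' Y'.
Proof.
move=> /setIidPr XX /setIidPr YY; rewrite (arcs_splitl e X' Y' X) XX (arcs_splitr e X Y' Y) YY.
by rewrite -addnA leq_addr.
Qed.

Lemma arcs_leq (V : finType) (e : rel V) (X Y : {set V}) : arcs e X Y <= #|X| * #|Y|.
Proof.
rewrite arcs_rows -sum_nat_const; apply: leq_sum => x _.
by apply/subset_leq_card/subsetP=> y; rewrite inE => /andP[].
Qed.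

Lemma arcs_anti (V : finType) (e : rel V) (X Y : {set V}) : oriented_graph e ->
  arcs e X Y + arcs e Y X <= #|X| * #|Y|.
Proof.
move=> [irr anti]; rewrite -(arcs_rev e X Y) /arcs -big_split /= -sum_nat_const.
apply: leq_sum => x _; rewrite -big_split /= -[leqRHS]sum1_card; apply: leq_sum => y _.
have [->|xy] := eqVneq x y; first by rewrite irr.
by have := anti x y xy; case: (e x y); case: (e y x).
Qed.

Lemma arcs_diag (V : finType) (e : rel V) (X : {set V}) : oriented_graph e ->
  2 * arcs e X X + #|X| <= #|X| ^ 2.
Proof.
move=> [irr anti]; rewrite mul2n -addnn -{1}(arcs_rev e X X) /arcs -big_split /=.
rewrite -[X in _ + X <= _]sum1_card -big_split /= -mulnn -sum_nat_const.
apply: leq_sum => x xX; rewrite -big_split /= (bigD1 x) //= irr !add0n.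
rewrite -[leqRHS]sum1_card [leqRHS](bigD1 x) //= addnC leq_add2l.
apply: leq_sum => y /andP[_ xy].
by have := anti y x xy; case: (e x y); case: (e y x).
Qed.

Lemma sum_outdeg (V : finType) (e : rel V) (X : {set V}) :
  \sum_(x in X) outdeg e x = arcs e X setT.
Proof.
rewrite arcs_rows; apply: eq_bigr => x _; apply: eq_card => y; by rewrite !inE.
Qed.

Lemma sum_indeg (V : finType) (e : rel V) (Y : {set V}) :
  \sum_(y in Y) indeg e y = arcs e setT Y.
Proof.
rewrite arcs_cols; apply: eq_bigr => x _; apply: eq_card => y; by rewrite !inE.
Qed.

Lemma nonarcs_count (V : finType) (e : rel V) (X Y : {set V}) : irreflexive e ->
  nonarcs e X Y + arcs e X Y + #|X :&: Y| = #|X| * #|Y|.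
Proof.
move=> irr; rewrite /nonarcs /arcs -big_split /=.
have -> : #|X :&: Y| = \sum_(x in X) \sum_(y in Y) (x == y : nat).
  rewrite (_ : X :&: Y = [set x in X | x \in Y]); last by apply/setP=> x; rewrite !inE.
  rewrite -(sum_rel_row (fun x => x \in Y)); apply: eq_bigr => x _; case xY: (x \in Y).
    by rewrite (bigD1 x) //= eqxx big1 // => y /andP[_ /negbTE]; rewrite eq_sym => ->.
  by rewrite big1 // => y yY; case: eqP => // E; rewrite E yY in xY.
rewrite -big_split /= -sum_nat_const; apply: eq_bigr => x _.
rewrite -!big_split /= -[RHS]sum1_card; apply: eq_bigr => y _.
by have [->|] := eqVneq x y; rewrite ?irr //=; case: (e x y).
Qed.

Lemma ore_nonarcs (V : finType) (e : rel V) (X Y : {set V}) : ore e ->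
  3 * #|V|.-1 * nonarcs e X Y <=
  4 * \sum_(x in X) \sum_(y in Y) ((x != y) && ~~ e x y) * (outdeg e x + indeg e y).
Proof.
move=> oe; rewrite /nonarcs !big_distrr /=; apply: leq_sum => x _.
rewrite !big_distrr /=; apply: leq_sum => y _.
have [/andP[xy nxy]|] := boolP (_ && _); last by rewrite muln0.
have := oe x y xy nxy; rewrite /= muln1 mul1n -subn1 mulnBr muln1; move: (outdeg e x + _) => z; lia.
Qed.

Lemma ore_average (V : finType) (e : rel V) (X Y : {set V}) : ore e ->
  3 * #|V|.-1 * nonarcs e X Y <= 4 * (#|Y| * arcs e X setT + #|X| * arcs e setT Y).
Proof.
move=> oe; apply: leq_trans (ore_nonarcs X Y oe) _; rewrite leq_mul2l /=.
rewrite -sum_outdeg -sum_indeg big_distrr /= -sum_nat_const -big_split /=.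
apply: leq_sum => x _; rewrite -[#|Y| * _]sum_nat_const -big_split /=.
apply: leq_sum => y _; by case: (_ && _); rewrite ?mul1n // mul0n.
Qed.

(** A vertex is not paired with itself, whence the factor [#|X|.-1]. This gain of lower order over
    [ore_average] matters in the exact count of crossing arcs. *)
Lemma ore_average_diag (V : finType) (e : rel V) (X : {set V}) : ore e ->
  3 * #|V|.-1 * nonarcs e X X <= 4 * (#|X|.-1 * (arcs e X setT + arcs e setT X)).
Proof.
move=> oe; apply: leq_trans (ore_nonarcs X X oe) _; rewrite leq_mul2l /=.
rewrite (eq_bigr (fun x => \sum_(y in X) ((x != y) && ~~ e x y) * outdeg e x +
  \sum_(y in X) ((x != y) && ~~ e x y) * indeg e y)); last first.
  by move=> x _; rewrite -big_split /=; apply: eq_bigr => y _; rewrite mulnDr.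
rewrite big_split /= mulnDr -sum_outdeg -sum_indeg; apply: leq_add.
  rewrite big_distrr /=; apply: leq_sum => x xX; rewrite -big_distrl /= leq_mul2r; apply/orP; right.
  rewrite (bigD1 x) //= eqxx add0n (cardsD1 x X) xX /= -sum1_card.
  rewrite [leqRHS](eq_bigl (fun y => (y \in X) && (y != x))); last by move=> y; rewrite !inE andbC.
  by apply: leq_sum => y _; case: (_ && _).
rewrite exchange_big big_distrr /=; apply: leq_sum => x xX; rewrite -big_distrl /= leq_mul2r; apply/orP; right.
rewrite (bigD1 x) //= eqxx add0n (cardsD1 x X) xX /= -sum1_card.
rewrite [leqRHS](eq_bigl (fun y => (y \in X) && (y != x))); last by move=> y; rewrite !inE andbC.
by apply: leq_sum => y _; case: (_ && _).
Qed.

(** If [x] had fewer than [n / 8] out-neighbours, the other vertices, about [7 * n / 8] in number,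
    would have indegree about [5 * n / 8] or more. As [35 / 64 > 1 / 2], these are more arcs than an
    oriented graph can have. *)
Lemma ore_outdeg (V : finType) (e : rel V) (x : V) : oriented_graph e -> ore e ->
  100 <= #|V| -> #|V| <= 8 * outdeg e x.
Proof.
move=> oe ore_e nbig; set n := #|V| in nbig *; set d := outdeg e x; rewrite leqNgt; apply/negP=> small.
have h1 := @arcs_diag V e setT oe; have h2 := @arcs_sub V e setT (~: [set y | (y == x) || e x y]) setT setT (subxx _) (subsetT _).
have [irr _] := oe.
set Y := ~: _ in h2.
have h2' : arcs e setT Y <= arcs e setT setT by apply: arcs_sub; rewrite ?subsetT ?subxx.
have cY : #|Y| + d + 1 = n.
  have := cardsC [set y | (y == x) || e x y]; rewrite -/Y -/n.
  rewrite (_ : [set y | _] = x |: [set y | e x y]); last by apply/setP=> y; rewrite !inE.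
  rewrite cardsU1 inE irr /= -/(outdeg e x) -/d; lia.
have h3 : #|Y| * (3 * n) <= 4 * (#|Y| * d + arcs e setT Y) + 3 * #|Y|.
  rewrite -sum_indeg -sum_nat_const.
  have -> : 4 * (#|Y| * d + \sum_(y in Y) indeg e y) + 3 * #|Y| =
      \sum_(y in Y) (4 * (d + indeg e y) + 3).
    by rewrite big_split /= -big_distrr /= big_split /= !sum_nat_const (mulnC 3).
  apply: leq_sum => y; rewrite !inE negb_or => /andP[yx nxy].
  by apply: ore_e; rewrite // eq_sym.
rewrite cardsT -/n in h1.
move: (arcs e setT setT) (arcs e setT Y) h1 h2' h3 cY small nbig.
move: #|Y| (n) d; clear; move=> y n d u v h1 h2 h3 cY small nbig.
have h4 : y * (8 * d) <= y * n by rewrite leq_mul2l ltnW ?orbT.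
have h5 : n * (7 * n) <= n * (8 * y + 8) by rewrite leq_mul2l; apply/orP; right; lia.
have h6 : 100 * n <= n * n by rewrite leq_mul2r nbig orbT.
have h7 : y <= n by lia.
move: h1 h2 h3 h4 h5 h6; rewrite expnS expn1; lia.
Qed.

Lemma ore_indeg (V : finType) (e : rel V) (x : V) : oriented_graph e -> ore e ->
  100 <= #|V| -> #|V| <= 8 * indeg e x.
Proof. by move=> oe ore_e; apply: (ore_outdeg x (oriented_rev oe) (ore_rev ore_e)). Qed.

(* A vertex changes sides when few of its out-arcs are noncrossing. *)
Definition side (V : finType) (e : rel V) (S T : {set V}) : {set V} :=
  [set x | if x \in S then #|V| <= 40 * #|[set y in ~: T | e x y]|
           else 40 * #|[set y in T | e x y]| < #|V|].

Lemma outdeg_split (V : finType) (e : rel V) (T : {set V}) (x : V) :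
  outdeg e x = #|[set y in T | e x y]| + #|[set y in ~: T | e x y]|.
Proof.
rewrite /outdeg -(cardsID T); congr (_ + _); apply: eq_card => y; by rewrite !inE andbC.
Qed.

Lemma card_in_leq (V : finType) (p : pred V) (T T' : {set V}) :
  #|[set y in T | p y]| <= #|[set y in T' | p y]| + #|T :\: T'|.
Proof.
apply: leq_trans (leq_card_setU _ _); apply/subset_leq_card/subsetP=> y; rewrite !inE.
by move=> /andP[-> ->]; rewrite !andbT orbN.
Qed.

(** A vertex on its new side has at least [#|V| / 40] noncrossing out-neighbours with respect to
    [T], either by definition or because it has fewer than [#|V| / 40] of the other kind and
    [1 / 8 - 1 / 40 = 1 / 10]. Passing to [T'] costs [#|V| / 1000], and [1 / 40 - 1 / 1000] exceeds
    [1 / 50]. *)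
Lemma side_outdeg (V : finType) (e : rel V) (S T T' : {set V}) (x : V) :
  #|V| <= 8 * outdeg e x -> 1000 * #|T :\: T'| <= #|V| -> 1000 * #|T' :\: T| <= #|V| ->
  #|V| <= 50 * #|[set y | noncross e (side e S T) T' x y]|.
Proof.
move=> d8 t1 t2; rewrite (outdeg_split e T) in d8.
have h1 := card_in_leq (e x) T T'; have h2 := card_in_leq (e x) (~: T) (~: T').
have cT : #|~: T :\: ~: T'| = #|T' :\: T| by apply: eq_card => y; rewrite !inE negbK andbC.
rewrite {}cT in h2.
have [xS|xS] := boolP (x \in side e S T).
  have -> : [set y | noncross e (side e S T) T' x y] = [set y in ~: T' | e x y].
    by apply/setP=> y; rewrite !inE /noncross xS andbC; case: (y \in T').
  have : #|V| <= 40 * #|[set y in ~: T | e x y]|.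
    move: xS; rewrite inE; case: ifP => _ //; move: d8; clear.
    by move: #|[set y in T | e x y]| #|[set y in ~: T | e x y]| #|V|; lia.
  move: h2 t2; clear.
  by move: #|[set y in ~: T | e x y]| #|[set y in ~: T' | e x y]| #|T' :\: T| #|V|; lia.
have -> : [set y | noncross e (side e S T) T' x y] = [set y in T' | e x y].
  by apply/setP=> y; rewrite !inE /noncross (negbTE xS) andbC; case: (y \in T').
have : #|V| <= 40 * #|[set y in T | e x y]|.
  move: xS; rewrite inE; case: ifP => _; rewrite -?ltnNge -?leqNgt //; move: d8; clear.
  by move: #|[set y in T | e x y]| #|[set y in ~: T | e x y]| #|V|; lia.
move: h1 t1; clear.
by move: #|[set y in T | e x y]| #|[set y in T' | e x y]| #|T :\: T'| #|V|; lia.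
Qed.

Lemma side_indeg (V : finType) (e : rel V) (S T S' : {set V}) (y : V) :
  #|V| <= 8 * indeg e y -> 1000 * #|S :\: S'| <= #|V| -> 1000 * #|S' :\: S| <= #|V| ->
  #|V| <= 50 * #|[set x | noncross e S' (side (fun x y => e y x) T S) x y]|.
Proof.
move=> d8 s1 s2; have := @side_outdeg V (fun x y => e y x) T S S' y d8 s1 s2.
set T' := side _ _ _ => h; apply: leq_trans h _; rewrite leq_mul2l /= subset_leq_card //.
by apply/subsetP=> x; rewrite !in_set /noncross; case: (x \in S'); case: (y \in T').
Qed.

(** * Disjoint crossing arcs *)

Lemma path_arcs_rcons (V : Type) (u x : V) p :
  path_arcs (u, rcons p x) = rcons (path_arcs (u, p)) (last u p, x).
Proof. by rewrite /path_arcs /=; elim: p u => //= y p IH u; rewrite IH. Qed.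

Lemma forest_cover_vertex (V : finType) (ps : seq (V * seq V)) (v : V) :
  uniq (flatten (map (@path_vertices V) ps)) ->
  exists ps1, [/\ uniq (flatten (map (@path_vertices V) ps1)),
    flatten (map (@path_arcs V) ps1) = flatten (map (@path_arcs V) ps),
    size (flatten (map (@path_vertices V) ps1)) <= size (flatten (map (@path_vertices V) ps)) + 1,
    {subset v :: flatten (map (@path_vertices V) ps) <= flatten (map (@path_vertices V) ps1)} &
    forall q, q \in ps1 -> q \in ps \/ q = (v, [::])].
Proof.
move=> U; have [vp|vp] := boolP (v \in flatten (map (@path_vertices V) ps)).
  exists ps; split=> //; first exact: leq_addr; last by move=> q qp; left.
  by move=> z; rewrite inE => /orP[/eqP ->|].
exists ((v, [::]) :: ps); split=> //=; first by rewrite vp.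
  by rewrite addn1.
by move=> q; rewrite inE => /orP[/eqP|]; [right|left].
Qed.

(** Endpoints not yet covered become one-vertex paths; then [x] ends a path, [y] starts one, and the
    arc joins the two. The last hypothesis excludes that they are the same path, which would close a
    cycle. *)
Lemma forest_add_arc (V : finType) (ps : seq (V * seq V)) (x y : V) :
  uniq (flatten (map (@path_vertices V) ps)) -> x != y ->
  x \notin map fst (flatten (map (@path_arcs V) ps)) ->
  y \notin map snd (flatten (map (@path_arcs V) ps)) ->
  (forall q, q \in ps -> q.1 = y -> last q.1 q.2 != x) ->
  exists ps', [/\ uniq (flatten (map (@path_vertices V) ps')),
    perm_eq (flatten (map (@path_arcs V) ps')) ((x, y) :: flatten (map (@path_arcs V) ps)) &
    size (flatten (map (@path_vertices V) ps')) <= size (flatten (map (@path_vertices V) ps)) + 2].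
Proof.
move=> U xy xt yh nc.
have [ps1 [U1 A1 s1 i1 q1]] := forest_cover_vertex x U.
have [ps2 [U2 A2 s2 i2 q2]] := forest_cover_vertex y U1.
have nc2 q : q \in ps2 -> q.1 = y -> last q.1 q.2 != x.
  move=> /q2[/q1[qp|->]|->] /=; [exact: nc | by move=> E; rewrite E eqxx in xy | by rewrite eq_sym].
have [q qin qx] : exists2 q, q \in ps2 & last q.1 q.2 = x.
  have /flattenP[_ /mapP[q qin ->] xq] : x \in flatten (map (@path_vertices V) ps2).
    by apply: i2; rewrite inE i1 ?orbT // inE eqxx.
  exists q => //; move: xq; rewrite /path_vertices lastI mem_rcons inE => /orP[/eqP ->//|xb].
  case/negP: xt; rewrite -A1 -A2; have : x \in map fst (path_arcs q) by case: (q) xb => a b; rewrite path_arcs_tails.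
  case/mapP=> a aq ->; apply: map_f; apply/flattenP; exists (path_arcs q) => //; exact: map_f.
have [q' q'in q'y] : exists2 q, q \in ps2 & q.1 = y.
  have /flattenP[_ /mapP[q' q'in ->] yq] : y \in flatten (map (@path_vertices V) ps2).
    by apply: i2; rewrite inE eqxx.
  exists q' => //; move: yq; rewrite inE => /orP[/eqP ->//|yb].
  case/negP: yh; rewrite -A1 -A2; have : y \in map snd (path_arcs q') by case: (q') yb => a b; rewrite path_arcs_heads.
  case/mapP=> a aq ->; apply: map_f; apply/flattenP; exists (path_arcs q') => //; exact: map_f.
have nqq : q' != q.
  by apply: contraTneq (nc2 q' q'in q'y) => ->; rewrite qx eqxx.
have pe : perm_eq ps2 (q :: q' :: rem q' (rem q ps2)).
  rewrite (perm_trans (perm_to_rem qin)) // perm_cons perm_to_rem //.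
  have := perm_mem (perm_to_rem qin) q'; rewrite q'in inE (negbTE nqq) /= => <- //.
move: (rem q' _) pe => rest pe.
case: q q' nqq qx q'y pe {qin q'in} => [u p] [y' p'] /= _ ux -> pe {y'}.
have pv := perm_flatten (perm_map (@path_vertices V) pe).
have pa := perm_flatten (perm_map (@path_arcs V) pe).
have vE : flatten (map (@path_vertices V) ((u, p ++ y :: p') :: rest)) =
    flatten (map (@path_vertices V) ((u, p) :: (y, p') :: rest)).
  by rewrite /= /path_vertices /= -catA.
exists ((u, p ++ y :: p') :: rest); split.
- by rewrite vE -(perm_uniq pv).
- rewrite -A1 -A2 /= path_arcs_cat path_arcs_rcons ux cat_rcons -catA.
  by rewrite perm_catC /= -catA perm_cons perm_sym (perm_trans pa) //= perm_catC -catA.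
- by rewrite vE -(perm_size pv) (leq_trans s2) // addn1 addn2 ltnS -addn1.
Qed.

(** Greedy choice: the arcs chosen so far have at most two endpoints each, and an endpoint blocks at
    most [L] arcs. *)
Lemma disjoint_arcs (V : finType) (r : rel V) (t L : nat) : irreflexive r ->
  (forall z, #|[set y | r z y]| + #|[set x | r x z]| <= L) -> 0 < L ->
  2 * t * L <= #|[set a : V * V | r a.1 a.2]| ->
  exists Q : seq (V * V), [/\ size Q = t, all (fun a => r a.1 a.2) Q & uniq (arc_vertices Q)].
Proof.
move=> irr deg L0; elim: t => [|t IH] big; first by exists [::].
have [|Q [sQ rQ UQ]] := IH; first by apply: leq_trans big; rewrite leq_mul2r leq_mul2l leqnSn !orbT.
pose Z := [set z in arc_vertices Q].
have cZ : #|Z| <= 2 * t.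
  rewrite cardsE (leq_trans (card_size _)) // -sQ /arc_vertices.
  by clear; elim: Q => //= a Q; lia.
have [/existsP[[x y]] /and3P[rxy xZ yZ]|no] :=
    boolP [exists a : V * V, [&& r a.1 a.2, a.1 \notin Z & a.2 \notin Z]].
  exists ((x, y) :: Q); rewrite /= sQ rxy rQ; split=> //.
  move: xZ yZ; rewrite !inE => xZ yZ; rewrite negb_or xZ yZ UQ !andbT.
  by apply: contraTneq rxy => ->; rewrite /= irr.
have : #|[set a : V * V | r a.1 a.2]| <= \sum_(z in Z) (#|[set y | r z y]| + #|[set x | r x z]|).
  rewrite card_rel big_split /=.
  have -> : \sum_(z in Z) #|[set x | r x z]| = \sum_x \sum_(z in Z) (r x z : nat).
    rewrite exchange_big; apply: eq_bigr => z _; rewrite -sum1dep_card big_mkcond /=.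
    by apply: eq_bigr => x _; case: (r x z).
  rewrite [X in _ <= X + _]big_mkcond -big_split /=; apply: leq_sum => x _.
  case: ifP => xZ; first by rewrite leq_addr.
  rewrite add0n (sum_rel_row (r x)); apply/subset_leq_card/subsetP=> y; rewrite !inE => rxy.
  rewrite rxy andbT; move: no; rewrite negb_exists => /forallP/(_ (x, y)) /=.
  by rewrite rxy xZ /= negbK inE.
have : \sum_(z in Z) (#|[set y | r z y]| + #|[set x | r x z]|) <= 2 * t * L.
  apply: (@leq_trans (\sum_(z in Z) L)); first by apply: leq_sum => z _; apply: deg.
  by rewrite sum_nat_const leq_mul2r cZ orbT.
move=> h1 h2; have := leq_trans big (leq_trans h2 h1).
by rewrite leq_mul2r leq_mul2l /= ltnn orbF => /eqP E; rewrite E in L0.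
Qed.

(** Here [d] is the size of [D], with [E] arcs and [N] nonarcs inside. Both directions together, at
    most [d * (n - d)] arcs join [D] to the rest, so averaging over the nonarcs gives
    [d <= (n + 3) / 4 + 30 * E / n]. *)
Lemma excess_bound_dd (n d N E : nat) : 1000 <= n -> n <= 5 * d -> d <= n ->
  N + E + d = d * d -> 3 * n.-1 * N <= 4 * (d.-1 * (d * (n - d) + 2 * E)) ->
  4 * d * n <= n * n + 3 * n + 120 * E.
Proof.
case: d => [|m]; first lia.
rewrite succnK => n1000 n5d dn NE h.
have NE' : N + E = m.+1 * m by apply/eqP; rewrite -(eqn_add2r m.+1) NE -mulnSr.
have h1 : 3 * n.-1 * E <= 16 * m * E by rewrite leq_mul2r; apply/orP; right; lia.
have h2 : m * (3 * n.-1 * m.+1) <= m * (4 * (m.+1 * (n - m.+1)) + 24 * E).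
  have : 3 * n.-1 * (N + E) <= 4 * (m * (m.+1 * (n - m.+1) + 2 * E)) + 16 * m * E.
    by rewrite mulnDr; apply: leq_add.
  rewrite NE'; move: (m.+1 * (n - m.+1)) (3 * n.-1) => w u; clear; nia.
have m0 : 0 < m by lia.
rewrite leq_pmul2l // in h2.
have [|big] := leqP (4 * m.+1) (n + 3).
  move=> h3; have : 4 * m.+1 * n <= (n + 3) * n by rewrite leq_mul2r h3 orbT.
  by rewrite mulnDl; lia.
pose k := 4 * m.+1 - n - 3.
have kE : 4 * m.+1 = n + 3 + k by rewrite /k; lia.
have h4 : m.+1 * k <= 24 * E.
  have : m.+1 * (3 * n.-1) = m.+1 * (4 * (n - m.+1)) + m.+1 * k by rewrite -mulnDr; congr (_ * _); lia.
  move: h2; rewrite (mulnC _ m.+1) (mulnCA m.+1 4); lia.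
have h5 : n * k <= 5 * (m.+1 * k) by rewrite mulnA leq_mul2r n5d orbT.
rewrite kE; lia.
Qed.

Lemma excess_bound_dc (n a b c d t E E1 N X Y Z : nat) :
  1000 <= n -> n <= 5 * d -> n <= 6 * c -> a + b + c + d = n -> d = b + t ->
  N + E1 = d * c -> E1 <= E -> X <= d * (a + b) + E -> Y <= b * c + Z + E -> 2 * Z + c <= c * c ->
  3 * n.-1 * N <= 4 * (c * X + d * Y) ->
  4 * d * n <= n * n + 3 * n + 120 * E ->
  n * (6 * t) <= 2 * a * n + 4 * n + 330 * E.
Proof.
move=> n1000 n5d n6c tot dbt NE E1E hX hY hZ h hd.
have h1 : 3 * n.-1 * (d * c) <= d * c * (4 * a + 8 * b + 2 * c.-1) + 7 * n * E.
  have g1 : 3 * n.-1 * (d * c) <= 4 * (c * X + d * Y) + 3 * n * E.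
    rewrite -NE mulnDr leq_add //; apply: leq_mul => //; lia.
  have g2 : c * X <= c * (d * (a + b) + E) by rewrite leq_mul2l hX orbT.
  have g3 : d * Y <= d * (b * c + Z + E) by rewrite leq_mul2l hY orbT.
  have g4 : d * (2 * Z) <= d * (c * c.-1).
    by rewrite leq_mul2l; apply/orP; right; case: (c) hZ => [|c'] /=; [lia|rewrite mulSn; lia].
  have g5 : (c + d) * E <= n * E by rewrite leq_mul2r; apply/orP; right; lia.
  apply: leq_trans g1 _.
  apply: (@leq_trans (4 * (c * (d * (a + b) + E) + d * (b * c + Z + E)) + 3 * n * E)).
    by rewrite leq_add2r leq_mul2l leq_add.
  rewrite (_ : 4 * _ + _ = d * c * (4 * a + 8 * b) + 2 * (d * (2 * Z)) + 4 * ((c + d) * E) + 3 * n * E); last by ring.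
  rewrite [leqRHS](_ : _ = d * c * (4 * a + 8 * b) + 2 * (d * (c * c.-1)) + 4 * (n * E) + 3 * n * E); last by ring.
  by rewrite leq_add2r leq_add // ?leq_add2l leq_mul2l /=.
set F := 4 * a + 8 * b + 2 * c.-1 in h1.
have h2 : n * (3 * n.-1) <= n * F + 210 * E.
  have [small|big] := leqP (3 * n.-1) F.
    by apply: (@leq_trans (n * F)); rewrite ?leq_addr // leq_mul2l small orbT.
  pose k := 3 * n.-1 - F; have kE : 3 * n.-1 = F + k by rewrite /k; lia.
  rewrite kE mulnDr leq_add2l.
  have g1 : d * c * k <= 7 * n * E by move: h1; rewrite kE mulnDl (mulnC F) (mulnC k) leq_add2l.
  have g2 : n * n <= 30 * (d * c) by apply: leq_trans (leq_mul n5d n6c) _; apply: eq_leq; ring.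
  have g3 : n * (n * k) <= n * (210 * E).
    apply: (@leq_trans (30 * (7 * n * E))); last by apply: eq_leq; ring.
    by apply: leq_trans (leq_mul (leqnn 30) g1); rewrite !mulnA leq_mul2r -mulnA g2 orbT.
  by rewrite leq_pmul2l in g3; lia.
have FE : F + 6 * t + 2 = 2 * a + 4 * d + 2 * n by rewrite /F; lia.
have e1 : n * F + 6 * (n * t) + 2 * n = 2 * (a * n) + 4 * (d * n) + 2 * (n * n).
  by rewrite (_ : _ + 2 * n = n * (F + 6 * t + 2)); [rewrite FE; ring | ring].
have e2 : n * (3 * n.-1) + 3 * n = 3 * (n * n).
  have n0 : 0 < n by lia.
  by rewrite -[in X in _ = 3 * (_ * X)](prednK n0) -addn1; ring.
rewrite (_ : n * (6 * t) = 6 * (n * t)); last by ring.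
move: h2 hd; rewrite -(mulnA 4) -(mulnA 2); move: e1 e2.
move: (n * (3 * _)) (n * F) (n * t) (a * n) (d * n) (n * n); clear; lia.
Qed.

(** After elimination of [d], the average from [A] to [C] bounds [6 * t] by
    [2 + 144 * E / n + 6 * EA / a]. If [n >= 144 * t ^ 2], then [EA <= a * t.-1] leaves [6] against
    [2] plus less than [4]. Otherwise [t >= 16], the bound on [n * (6 * t)] gives [a >= 2.79 * t],
    and then [EA < 2 * t ^ 2] is too small. *)
Lemma excess_contradiction (n a b c d t E EA : nat) :
  200 * 200 <= n -> 0 < t -> 100 * (100 * t) <= n -> a + b + c + d = n -> d = b + t ->
  E < 4 * (t * t) -> EA < 2 * (t * t) -> EA <= a * t.-1 ->
  4 * d * n <= n * n + 3 * n + 120 * E ->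
  n * (6 * t) <= 2 * a * n + 4 * n + 330 * E ->
  a * n * (3 * n.-1) <= n * (a * (2 * a.-1 + 8 * b + 2 * c.-1)) + 6 * n * EA + 24 * a * E ->
  0 < c -> False.
Proof.
move=> nbig t0 tn tot dbt hE hEA hEA' hd hdc hac c0.
have tt : 100 * (100 * (t * t)) <= n * t by rewrite !mulnA leq_mul2r -mulnA tn orbT.
have a0 : 0 < a.
  rewrite lt0n; apply/eqP=> a0; rewrite a0 in hdc.
  have : n <= n * t by apply: leq_pmulr.
  lia.
have h1 : a * (n * (6 * t)) <= a * (2 * n + 144 * E) + 6 * n * EA.
  have g1 : 4 * (a * n * d) <= a * n * n + 3 * (a * n) + 120 * (a * E).
    have := leq_mul (leqnn a) hd; rewrite (_ : a * (4 * d * n) = 4 * (a * n * d)); last by ring.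
    by rewrite (_ : a * (_ + _) = a * n * n + 3 * (a * n) + 120 * (a * E)); last by ring.
  set P := 2 * a.-1 + _ + _ in hac.
  have F1 : P + 6 * t + 4 = 2 * n + 4 * d by rewrite /P; lia.
  have g2 : a * n * P + 6 * (a * n * t) + 4 * (a * n) = 2 * (a * n * n) + 4 * (a * n * d).
    rewrite (_ : _ + 4 * (a * n) = a * n * (P + 6 * t + 4)); last by ring.
    by rewrite F1; ring.
  have g3 : a * n * (3 * n.-1) + 3 * (a * n) = 3 * (a * n * n).
    have n0 : 0 < n by lia.
    by rewrite -[in X in _ = 3 * (_ * X)](prednK n0) -addn1; ring.
  have g4 : a * n * (3 * n.-1) <= a * n * P + 6 * (n * EA) + 24 * (a * E).
    by apply: leq_trans hac _; apply: eq_leq; ring.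
  rewrite (_ : a * (n * (6 * t)) = 6 * (a * n * t)); last by ring.
  rewrite (_ : _ + _ = 2 * (a * n) + 144 * (a * E) + 6 * (n * EA)); last by ring.
  move: g1 g2 g3 g4; move: (a * n * (3 * _)) (a * n * n) (a * n * d) (a * n * P) (a * n * t).
  move: (a * n) (a * E) (n * EA); clear; lia.
have [small|big] := ltnP n (144 * (t * t)); last first.
  have g1 : 6 * (n * EA) <= 6 * (a * n * t.-1).
    by rewrite leq_mul2l /= (leq_trans (leq_mul (leqnn n) hEA')) // mulnA (mulnC n).
  have g2 : 144 * (a * E) < 4 * (a * n).
    by rewrite !(mulnCA _ a) ltn_mul2l a0 /=; lia.
  have g3 : a * (n * (6 * t)) = 6 * (a * n * t.-1) + 6 * (a * n).
    by rewrite -[in LHS](prednK t0) -addn1; ring.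
  move: h1; rewrite g3 (_ : a * (_ + _) + _ = 2 * (a * n) + 144 * (a * E) + 6 * (n * EA)); last by ring.
  move: g1 g2; move: (a * n * t.-1); move: (a * n) (a * E) (n * EA); clear; lia.
have t15 : 16 <= t.
  rewrite leqNgt; apply/negP=> t16.
  have : t * t <= t * 15 by rewrite leq_mul2l; apply/orP; right; lia.
  move: nbig small t16; move: (t * t) => w; clear; lia.
have g1 : n * (293 * t) <= n * (100 * a + 200).
  rewrite (_ : n * (293 * t) = 293 * (n * t)); last by ring.
  rewrite (_ : n * (_ + _) = 100 * (a * n) + 200 * n); last by ring.
  move: hdc tt hE; rewrite (_ : n * (6 * t) = 6 * (n * t)); last by ring.
  rewrite -(mulnA 2); move: (n * t) (t * t) (a * n); clear; lia.
rewrite leq_pmul2l in g1; last lia.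
have g2 : 279 * t <= 100 * a by lia.
have g3 : a * (n * (594 * t)) <= a * (n * 200) + 1200 * (n * (t * t)).
  have u1 : a * E <= a * (4 * (t * t)) by rewrite leq_mul2l ltnW ?orbT.
  have u2 : a * (100 * (100 * (t * t))) <= a * (n * t) by rewrite leq_mul2l tt orbT.
  have u3 : n * EA <= n * (2 * (t * t)) by rewrite leq_mul2l ltnW ?orbT.
  rewrite (_ : a * (n * (594 * t)) = 594 * (a * (n * t))); last by ring.
  move: h1 u1 u2 u3; rewrite (_ : a * (n * (6 * t)) = 6 * (a * (n * t))); last by ring.
  rewrite (_ : a * (2 * n + _) + _ = 2 * (a * n) + 144 * (a * E) + 6 * (n * EA)); last by ring.
  rewrite (_ : a * (4 * _) = 4 * (a * (t * t))); last by ring.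
  rewrite (_ : a * (100 * _) = 100 * (100 * (a * (t * t)))); last by ring.
  rewrite (_ : n * (2 * _) = 2 * (n * (t * t))); last by ring.
  rewrite (_ : a * (n * 200) = 200 * (a * n)); last by ring.
  move: (a * (n * t)) (a * (t * t)) (n * (t * t)) (a * n) (a * E) (n * EA); clear; lia.
have g4 : n * (a * (594 * t)) <= n * (a * 200 + 1200 * (t * t)).
  by apply: leq_trans (leq_trans g3 _); apply: eq_leq; ring.
rewrite leq_pmul2l in g4; last lia.
have g5 : a * 200 <= a * (13 * t) by rewrite leq_mul2l; apply/orP; right; lia.
have g6 : 279 * t * (581 * t) <= 100 * a * (581 * t) by rewrite leq_mul2r g2 orbT.
have : 0 < t * t by rewrite muln_gt0 t0.
move: g4 g5 g6.
rewrite (_ : a * (594 * t) = 594 * (a * t)); last by ring.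
rewrite (_ : a * (13 * t) = 13 * (a * t)); last by ring.
rewrite (_ : 279 * t * (581 * t) = 279 * (581 * (t * t))); last by ring.
rewrite (_ : 100 * a * _ = 100 * (581 * (a * t))); last by ring.
move: (a * t) (t * t); clear; lia.
Qed.

Lemma cancel_factor (n c' k G E : nat) : n <= 6 * c' -> c' * k <= c' * G + 4 * E ->
  n * k <= n * G + 24 * E.
Proof.
move=> nc h; have [small|big] := leqP k G.
  by apply: leq_trans (leq_addr _ _); rewrite leq_mul2l small orbT.
have kE := subnKC (ltnW big); move: (k - G) kE => j kE.
rewrite -kE !mulnDr !leq_add2l in h *.
by apply: leq_trans (leq_mul nc (leqnn _)) _; rewrite -mulnA; lia.
Qed.

(** The degree condition for [x] and its out-nonneighbours [C'] in [C], averaged over [C']. Since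
    [x] has few crossing arcs, [C'] has at least [#|V| / 6] elements, so dividing by its size
    inflates the error only by a constant. *)
Lemma ore_row (V : finType) (e : rel V) (S T : {set V}) (x : V) : oriented_graph e -> ore e ->
  x \in S :\: T ->
  #|V| + 6 * #|[set y in T | e x y]| <= 6 * #|T :\: S| ->
  #|V| * (3 * #|V|.-1) <= #|V| * (4 * outdeg e x + 4 * #|~: (S :|: T)| +
    2 * #|T :\: S|.-1 + 2 * #|[set y in T :\: S | e x y]|) + 24 * arcs e S T.
Proof.
move=> oe ore_e; rewrite inE => /andP[xT xS] big; have [irr _] := oe.
set C := T :\: S in big *; set B := ~: _; set K := [set y in C | e x y].
pose C' := C :\: K.
have KC : K \subset C by apply/subsetP=> y; rewrite inE => /andP[].
have cC : #|K| + #|C'| = #|C| by rewrite -(cardsID K C) (setIidPr KC).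
have n0 : 0 < #|V| by apply/card_gt0P; exists x.
have nC' : #|V| <= 6 * #|C'|.
  have : #|K| <= #|[set y in T | e x y]|.
    by apply/subset_leq_card/subsetP=> y; rewrite !inE => /andP[/andP[_ ->] ->].
  move: big cC; clear; lia.
apply: (cancel_factor nC').
have xC' : [set x] :&: C' = set0.
  by apply/setP=> y; rewrite !inE; case: eqP => // ->; rewrite xS andbF.
have no : arcs e [set x] C' = 0.
  rewrite /arcs big_set1 big1 // => y; rewrite !inE negb_and => /andP[+ /andP[yS yT]].
  by rewrite yS yT /= => /negbTE ->.
have := nonarcs_count [set x] C' irr; rewrite xC' cards0 no !addn0 cards1 mul1n => cN.
have := ore_average [set x] C' ore_e; rewrite cN cards1 mul1n -sum_outdeg big_set1.
rewrite (arcs_splitl e setT C' S) setTI setTD (arcs_splitl e (~: S) C' T).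
have -> : ~: S :&: T = C by apply/setP=> y; rewrite !inE andbC.
have -> : ~: S :\: T = B by apply/setP=> y; rewrite !inE negb_or andbC.
rewrite (arcs_splitl e C C' K) (setIidPr KC) -/C'.
have h1 : arcs e S C' <= arcs e S T.
  by apply: arcs_sub => //; apply/subsetP=> y; rewrite !inE => /and3P[].
have h2 := arcs_leq e B C'; have h3 := arcs_leq e K C'; have h4 := arcs_diag C' oe.
move: (arcs e S C') (arcs e B C') (arcs e K C') (arcs e C' C') (arcs e S T) h1 h2 h3 h4.
rewrite -cC; have c0 : 0 < #|C'| by lia.
move: #|C'| #|K| #|B| (outdeg e x) (3 * _) c0; clear.
move=> c k b o N c0 s bc kc cc E h1 h2 h3 h4 h.
have e1 : c ^ 2 = c * c.-1 + c by rewrite -mulnn -mulnSr prednK.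
have e2 : (k + c).-1 = k + c.-1 by lia.
rewrite e1 in h4; rewrite e2.
rewrite (_ : c * _ + _ = 4 * (c * o) + 4 * (b * c) + 4 * (k * c) + 2 * (c * c.-1) + 4 * E); last by ring.
move: h1 h2 h3 h4 h; rewrite (mulnC N); move: (c * N) (c * o) (b * c) (k * c) (c * c.-1); clear; lia.
Qed.

(** The thresholds are what a greedy choice of [t] disjoint arcs needs when a vertex meets at most
    [2 * t] crossing arcs, or at most [t] if the tails are restricted to [S :\: T]. If both fail,
    the averages inside [D], from [D] to [C] and from [A] to [C] are incompatible. *)
Lemma cross_arcs_abundant (V : finType) (e : rel V) (S T : {set V}) (t : nat) :
  oriented_graph e -> ore e -> 200 * 200 <= #|V| -> 0 < t -> 100 * (100 * t) <= #|V| ->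
  #|S| + #|T| = #|V| + t -> #|V| <= 5 * #|S :&: T| -> #|V| + 6 * t <= 6 * #|T :\: S| ->
  {in S :\: T, forall x, #|[set y in T | e x y]| < t} ->
  4 * (t * t) <= arcs e S T \/ 2 * (t * t) <= arcs e (S :\: T) T.
Proof.
move=> oe ore_e nbig t0 tn ST Dbig Cbig rowA; have [irr _] := oe.
have [|E4] := leqP (4 * (t * t)) (arcs e S T); first by left.
have [|EA2] := leqP (2 * (t * t)) (arcs e (S :\: T) T); first by right.
exfalso; set A := S :\: T in rowA EA2 *; set C := T :\: S in Cbig *; set D := S :&: T in Dbig.
pose B := ~: (S :|: T); set n := #|V| in nbig tn ST Dbig Cbig *.
have cS : #|D| + #|A| = #|S| by rewrite -(cardsID T S).
have cT : #|D| + #|C| = #|T| by rewrite -(cardsID S T) setIC.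
have cU : #|S :|: T| + #|B| = n by rewrite cardsC.
have cUI := cardsUI S T; rewrite -/D in cUI.
have cV : #|A| + #|B| + #|C| + #|D| = n by lia.
have dbt : #|D| = #|B| + t by lia.
have DS : D \subset S by apply: subsetIl.
have DT : D \subset T by apply: subsetIr.
have CT : C \subset T by apply: subsetDl.
have hd : 4 * #|D| * n <= n * n + 3 * n + 120 * arcs e S T.
  apply: (@leq_trans (n * n + 3 * n + 120 * arcs e D D)); last first.
    by rewrite leq_add2l leq_mul2l arcs_sub.
  have := nonarcs_count D D irr; rewrite setIid => cN.
  apply: (excess_bound_dd _ Dbig _ cN); [lia|lia|].
  apply: leq_trans (ore_average_diag D ore_e) _; rewrite leq_mul2l leq_mul2l /=; apply/orP; right.
  rewrite (arcs_splitr e D setT D) (arcs_splitl e setT D D) setTI setTD.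
  have := arcs_anti D (~: D) oe; have := cardsC D; rewrite -/n => <-; rewrite addKn.
  move: (arcs e D D) => z; clear; lia.
have cA' : {in A, forall x, n * (3 * n.-1) <= n * (4 * outdeg e x + 4 * #|B| +
    2 * #|C|.-1 + 2 * #|[set y in C | e x y]|) + 24 * arcs e S T}.
  move=> x xA; apply: ore_row => //; apply: leq_trans Cbig; rewrite leq_add2l leq_mul2l.
  by rewrite /= ltnW // rowA.
have hac : #|A| * n * (3 * n.-1) <= n * (#|A| * (2 * #|A|.-1 + 8 * #|B| + 2 * #|C|.-1)) +
     6 * n * arcs e A T + 24 * #|A| * arcs e S T.
  have g1 : #|A| * (n * (3 * n.-1)) <= n * (4 * arcs e A setT + 4 * (#|A| * #|B|) +
      2 * (#|A| * #|C|.-1) + 2 * arcs e A C) + 24 * (#|A| * arcs e S T).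
    rewrite -sum_nat_const; apply: leq_trans (leq_sum _ cA') _.
    rewrite big_split /= -big_distrr /= sum_nat_const.
    rewrite (eq_bigr (fun x => 4 * outdeg e x + 2 * #|[set y in C | e x y]| +
      (4 * #|B| + 2 * #|C|.-1))); last by move=> x _; ring.
    rewrite big_split big_split /= sum_nat_const -2!big_distrr /= sum_outdeg -arcs_rows.
    by apply: eq_leq; ring.
  have g2 : 2 * arcs e A setT <= #|A| * #|A|.-1 + 2 * (#|A| * #|B|) + 2 * arcs e A T.
    rewrite (arcs_splitr e A setT T) setTI setTD (arcs_splitr e A (~: T) S).
    have -> : ~: T :&: S = A by apply/setP=> y; rewrite !inE.
    have -> : ~: T :\: S = B by apply/setP=> y; rewrite !inE negb_or.
    have := arcs_leq e A B; have := arcs_diag A oe.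
    case: (posnP #|A|) => [a0|a0].
      by have := arcs_leq e A A; rewrite a0 !mul0n; clear; lia.
    have -> : #|A| ^ 2 = #|A| * #|A|.-1 + #|A| by rewrite -mulnn -mulnSr prednK.
    move: (#|A| * #|A|.-1) (#|A| * #|B|); clear; lia.
  have g3 : arcs e A C <= arcs e A T by apply: arcs_sub.
  rewrite -mulnA; apply: leq_trans g1 _.
  rewrite (_ : n * (#|A| * _) + _ + _ = n * (2 * (#|A| * #|A|.-1) + 8 * (#|A| * #|B|) + 2 * (#|A| * #|C|.-1) + 6 * arcs e A T) + 24 * (#|A| * arcs e S T)); last by ring.
  rewrite leq_add2r leq_mul2l; apply/orP; right.
  move: g2 g3; move: (#|A| * #|B|) (#|A| * _) (#|A| * _) (arcs e A setT); clear; lia.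
have hEA : arcs e A T <= #|A| * t.-1.
  rewrite arcs_rows -sum_nat_const; apply: leq_sum => x /rowA.
  by case: (t) t0.
apply: (@excess_contradiction n #|A| #|B| #|C| #|D| t (arcs e S T) (arcs e A T)) => //; last lia.
have cDC := nonarcs_count D C irr.
have DC0 : D :&: C = set0 by apply/setP=> y; rewrite !inE; case: (y \in S); rewrite ?andbF.
rewrite DC0 cards0 addn0 in cDC.
have EDC : arcs e D C <= arcs e S T by apply: arcs_sub.
have hX : arcs e D setT <= #|D| * (#|A| + #|B|) + arcs e S T.
  rewrite (arcs_splitr e D setT T) setTI setTD addnC; apply: leq_add; last exact: arcs_sub.
  have -> : #|A| + #|B| = #|~: T| by have := cardsC T; rewrite -/n; lia.
  exact: arcs_leq.
have hY : arcs e setT C <= #|B| * #|C| + arcs e C C + arcs e S T.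
  rewrite (arcs_splitl e setT C S) setTI setTD (arcs_splitl e (~: S) C T).
  have -> : ~: S :&: T = C by apply/setP=> y; rewrite !inE andbC.
  have -> : ~: S :\: T = B by apply/setP=> y; rewrite !inE negb_or andbC.
  have : arcs e S C <= arcs e S T by apply: arcs_sub.
  have := arcs_leq e B C; clear; lia.
have hZ : 2 * arcs e C C + #|C| <= #|C| * #|C| by rewrite mulnn; apply: arcs_diag.
apply: (@excess_bound_dc n #|A| #|B| #|C| #|D| t _ _ _ _ _ _ _ _ _ cV dbt cDC EDC hX hY hZ) => //.
- lia.
- lia.
- exact: ore_average.
Qed.

(** * Building the linear forest of crossing arcs *)

Lemma uniq_paths_cons (V : eqType) p (ps : seq (V * seq V)) :
  uniq (flatten (map (@path_vertices V) (p :: ps))) ->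
  (forall q v, q \in ps -> v \in path_vertices q -> v \notin path_vertices p) /\
  uniq (flatten (map (@path_vertices V) ps)).
Proof.
rewrite (_ : flatten _ = path_vertices p ++ flatten (map (@path_vertices V) ps)) //.
rewrite cat_uniq => /and3P[_ /hasPn dis U]; split=> // q v qin vq; apply: dis.
by apply/flattenP; exists (path_vertices q) => //; apply: map_f.
Qed.

Lemma count_paths_leq1 (V : eqType) (ps : seq (V * seq V)) (P : pred (V * seq V)) (v : V) :
  uniq (flatten (map (@path_vertices V) ps)) ->
  (forall q, P q -> v \in path_vertices q) -> count P ps <= 1.
Proof.
move=> + Pv; elim: ps => // p ps IH /uniq_paths_cons[out U] /=.
case Pp: (P p); last exact: IH.
rewrite addnC addn1 ltnS leqn0; apply/eqP/eqP; rewrite -leqn0 leqNgt -has_count.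
by apply/hasPn=> q qin; apply/negP=> /Pv /(out _ _ qin); rewrite Pv.
Qed.

Definition cross_forest (V : finType) (e : rel V) (S T : {set V}) (t : nat)
    (ps : seq (V * seq V)) : Prop :=
  [/\ uniq (flatten (map (@path_vertices V) ps)),
      all (fun a => [&& e a.1 a.2, a.1 \in S & a.2 \in T]) (flatten (map (@path_arcs V) ps)),
      size (flatten (map (@path_arcs V) ps)) = t &
      size (flatten (map (@path_vertices V) ps)) <= 2 * t].

Lemma cross_forest_add (V : finType) (e : rel V) (S T S' T' : {set V}) (t : nat) ps x y :
  cross_forest e S' T' t ps -> S' \subset S -> T' \subset T ->
  x \in S -> y \in T -> e x y -> x != y ->
  x \notin map fst (flatten (map (@path_arcs V) ps)) ->
  y \notin map snd (flatten (map (@path_arcs V) ps)) ->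
  (forall q, q \in ps -> q.1 = y -> last q.1 q.2 != x) ->
  exists ps', cross_forest e S T t.+1 ps'.
Proof.
move=> [U A sA sV] S'S T'T xS yT exy xy xt yh nc.
have [ps' [U' A' sV']] := forest_add_arc U xy xt yh nc.
exists ps'; split=> //.
- rewrite (perm_all _ A') /= exy xS yT; apply/allP=> a aA.
  have /and3P[-> aS aT] := allP A a aA.
  by rewrite (subsetP S'S _ aS) (subsetP T'T _ aT).
- by rewrite (perm_size A') /= sA.
- by rewrite (leq_trans sV') // mulnS addnC leq_add2l.
Qed.

Lemma pick_outside (V : finType) (X : {set V}) (s : seq V) :
  size s < #|X| -> exists2 x, x \in X & x \notin s.
Proof.
move=> h; have /subsetPn[x xX xs] : ~~ (X \subset [set z in s]).
  apply: contraL h => /subset_leq_card; rewrite -leqNgt => h.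
  by rewrite (leq_trans h) // cardsE card_size.
by exists x => //; move: xs; rewrite inE.
Qed.

Lemma cross_forest_disjoint (V : finType) (e : rel V) (S T S' T' : {set V}) (t L : nat) :
  irreflexive e -> S' \subset S -> T' \subset T -> 0 < L ->
  (forall z, (z \in S') * #|[set y in T' | e z y]| + (z \in T') * #|[set x in S' | e x z]| <= L) ->
  2 * t * L <= arcs e S' T' -> exists ps, cross_forest e S T t ps.
Proof.
move=> irr S'S T'T L0 deg big; pose r x y := [&& e x y, x \in S' & y \in T'].
have rE : #|[set a : V * V | r a.1 a.2]| = arcs e S' T'.
  rewrite card_rel arcs_rows [RHS]big_mkcond /=; apply: eq_bigr => x _; case: ifP => xS.
    by apply: eq_card => y; rewrite !inE /r xS andbC.
  by apply/eqP; rewrite cards_eq0; apply/eqP/setP=> y; rewrite !inE /r xS andbF.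
have [|||Q [sQ rQ UQ]] := @disjoint_arcs V r t L _ _ L0 _.
- by move=> x; rewrite /r irr.
- move=> z; apply: leq_trans (deg z); apply: leq_add.
    case: (boolP (z \in S')) => zS.
      by rewrite mul1n; apply/subset_leq_card/subsetP=> y; rewrite !inE => /and3P[-> _ ->].
    by rewrite leqn0 cards_eq0; apply/eqP/setP=> y; rewrite !inE /r (negbTE zS) andbF.
  case: (boolP (z \in T')) => zT.
    by rewrite mul1n; apply/subset_leq_card/subsetP=> y; rewrite !inE => /and3P[-> -> _].
  by rewrite leqn0 cards_eq0; apply/eqP/setP=> y; rewrite !inE /r (negbTE zT) !andbF.
- by rewrite rE.
exists [seq (a.1, [:: a.2]) | a <- Q].
have vE : flatten (map (@path_vertices V) [seq (a.1, [:: a.2]) | a <- Q]) = arc_vertices Q.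
  by rewrite /arc_vertices; clear; elim: Q => //= a Q ->.
have aE : flatten (map (@path_arcs V) [seq (a.1, [:: a.2]) | a <- Q]) = Q.
  by clear; elim: Q => //= -[a b] Q ->.
rewrite /cross_forest vE aE; split=> //.
  apply/allP=> a aQ; have /and3P[-> aS aT] := allP rQ a aQ.
  by rewrite (subsetP S'S _ aS) (subsetP T'T _ aT).
by rewrite -sQ /arc_vertices; clear; elim: Q => //= a Q; lia.
Qed.

(* A vertex with more crossing arcs than the excess can be removed and added
   back at the end; otherwise the crossing arcs are spread out and numerous. *)
Lemma exists_cross_forest (V : finType) (e : rel V) (t : nat) :
  oriented_graph e -> ore e -> 200 * 200 <= #|V| ->
  forall S T : {set V}, 100 * (100 * t) <= #|V| -> #|S| + #|T| = #|V| + t ->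
  #|V| + 5 * t <= 5 * #|S :&: T| -> #|V| + 6 * t <= 6 * #|T :\: S| ->
  exists ps, cross_forest e S T t ps.
Proof.
move=> oe ore_e nbig; have [irr _] := oe.
have neq x y : e x y -> x != y by apply: contraTneq => ->; rewrite irr.
(* The slacks [5 * t] and [6 * t] pay for the removals: each takes at most one vertex from [S :&: T]
   or [T :\: S] and lowers [t] by one. *)
elim: t => [|t IH] S T tn ST Dbig Cbig; first by exists [::].
have tn' : 100 * (100 * t) <= #|V| by apply: leq_trans tn; rewrite leq_mul2l leq_mul2l leqnSn !orbT.
have heads S' T' ps : cross_forest e S' T' t ps ->
    {subset map snd (flatten (map (@path_arcs V) ps)) <= T'}.
  by case=> _ /allP A _ _ _ /mapP[a /A /and3P[_ _ aT] ->].
have tails S' T' ps : cross_forest e S' T' t ps ->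
    {subset map fst (flatten (map (@path_arcs V) ps)) <= S'}.
  by case=> _ /allP A _ _ _ /mapP[a /A /and3P[_ aS _] ->].
have last_head ps (q : V * seq V) : q \in ps -> q.2 != [::] ->
    last q.1 q.2 \in map snd (flatten (map (@path_arcs V) ps)).
  case: q => u [//|w p] qin _ /=.
  have : last w p \in map snd (path_arcs (u, w :: p)) by rewrite path_arcs_heads mem_last.
  case/mapP=> a aq ->; apply: map_f; apply/flattenP; exists (path_arcs (u, w :: p)) => //; exact: map_f.
have first_tail ps (q : V * seq V) : q \in ps -> q.2 != [::] ->
    q.1 \in map fst (flatten (map (@path_arcs V) ps)).
  case: q => u [//|w p] qin _ /=.
  have : u \in map fst (path_arcs (u, w :: p)) by rewrite path_arcs_tails /= inE eqxx.
  case/mapP=> a aq ->; apply: map_f; apply/flattenP; exists (path_arcs (u, w :: p)) => //; exact: map_f.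
have sz S' T' ps : cross_forest e S' T' t ps -> size (flatten (map (@path_arcs V) ps)) = t by case.
have remS x : x \in S -> #|S :\ x| + #|T| = #|V| + t.
  by move=> xS; have := cardsD1 x S; rewrite xS; lia.
have remT y : y \in T -> #|S| + #|T :\ y| = #|V| + t.
  by move=> yT; have := cardsD1 y T; rewrite yT; lia.
(* A vertex outside [T] is not a head of the forest built without it, so adding an arc at [x] cannot
   close a cycle. The forest has [t] heads, and one of the more than [t] heads available at [x] is
   free. *)
have [/existsP[x /andP[xS xbig]]|noA] :=
    boolP [exists x, (x \in S :\: T) && (t < #|[set y in T | e x y]|)].
  have /setDP[xS' xT] := xS.
  have [||ps F] := IH (S :\ x) T tn' (remS x xS').
  - rewrite (_ : _ :&: T = S :&: T); first by lia.
    by apply/setP=> y; rewrite !inE; case: eqP => // ->; rewrite (negbTE xT) !andbF.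
  - rewrite (_ : T :\: _ = T :\: S); first by lia.
    by apply/setP=> y; rewrite !inE; case: eqP => // ->; rewrite (negbTE xT) !andbF.
  have [|y] := @pick_outside V [set y in T | e x y] (map snd (flatten (map (@path_arcs V) ps))).
    by rewrite size_map (sz _ _ _ F).
  rewrite inE => /andP[yT exy] yh.
  apply: (cross_forest_add F (subD1set _ _) (subxx _) xS' yT exy (neq _ _ exy)) => //.
    by apply/negP=> /(tails _ _ _ F); rewrite !inE eqxx.
  move=> q qin qy; apply/eqP=> qx; have [q0|q0] := eqVneq q.2 [::].
    by move: qx; rewrite q0 /= qy => E; move: exy; rewrite E irr.
  by have := heads _ _ _ F _ (last_head _ _ qin q0); rewrite qx (negbTE xT).
have [/existsP[y /andP[yT ybig]]|noC] :=
    boolP [exists y, (y \in T :\: S) && (t < #|[set x in S | e x y]|)].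
  have /setDP[yT' yS] := yT.
  have [||ps F] := IH S (T :\ y) tn' (remT y yT').
  - rewrite (_ : S :&: _ = S :&: T); first by lia.
    by apply/setP=> x; rewrite !inE; case: eqP => // ->; rewrite (negbTE yS).
  - rewrite (_ : _ :\: S = (T :\: S) :\ y); last by apply/setP=> x; rewrite !inE andbCA.
    by have := cardsD1 y (T :\: S); rewrite yT; lia.
  have [|x] := @pick_outside V [set x in S | e x y] (map fst (flatten (map (@path_arcs V) ps))).
    by rewrite size_map (sz _ _ _ F).
  rewrite inE => /andP[xS exy] xt.
  apply: (cross_forest_add F (subxx _) (subD1set _ _) xS yT' exy (neq _ _ exy)) => //.
    by apply/negP=> /(heads _ _ _ F); rewrite !inE eqxx.
  move=> q qin qy; apply/eqP=> qx; have [q0|q0] := eqVneq q.2 [::].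
    by move: qx; rewrite q0 /= qy => E; move: exy; rewrite E irr.
  by have := tails _ _ _ F _ (first_tail _ _ qin q0); rewrite qy (negbTE yS).
(* Now [x] may be the end of a path, whose first vertex has to be avoided as well; therefore one
   more arc at [x] is required. *)
have [/existsP[x /andP[xD xbig]]|noD] :=
    boolP [exists x, (x \in S :&: T) && (t.+1 < #|[set y in T | e x y]|)].
  have /setIP[xS xT] := xD.
  have [||ps F] := IH (S :\ x) T tn' (remS x xS).
  - rewrite (_ : _ :&: T = (S :&: T) :\ x); last by apply/setP=> y; rewrite !inE andbA.
    by have := cardsD1 x (S :&: T); rewrite xD; lia.
  - apply: leq_trans (_ : 6 * #|T :\: S| <= _); first by lia.
    by rewrite leq_mul2l /=; apply/subset_leq_card/setDS/subD1set.
  have [U _ _ _] := F.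
  pose st := [seq q.1 | q <- ps & last q.1 q.2 == x].
  have sst : size st <= 1.
    rewrite size_map size_filter; apply: (count_paths_leq1 (v := x) U) => q /eqP <-.
    exact: mem_last.
  have [|y] := @pick_outside V [set y in T | e x y] (map snd (flatten (map (@path_arcs V) ps)) ++ st).
    by rewrite size_cat size_map (sz _ _ _ F) (leq_ltn_trans _ xbig) // -addn1 leq_add2l.
  rewrite inE mem_cat negb_or => /andP[yT exy] /andP[yh yst].
  apply: (cross_forest_add F (subD1set _ _) (subxx _) xS yT exy (neq _ _ exy)) => //.
    by apply/negP=> /(tails _ _ _ F); rewrite !inE eqxx.
  move=> q qin qy; apply: contra yst => qx; apply/mapP; exists q => //.
  by rewrite mem_filter qx.
have [/existsP[y /andP[yD ybig]]|noD'] :=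
    boolP [exists y, (y \in S :&: T) && (t.+1 < #|[set x in S | e x y]|)].
  have /setIP[yS yT] := yD.
  have [||ps F] := IH S (T :\ y) tn' (remT y yT).
  - rewrite (_ : S :&: _ = (S :&: T) :\ y); last by apply/setP=> x; rewrite !inE andbCA.
    by have := cardsD1 y (S :&: T); rewrite yD; lia.
  - rewrite (_ : _ :\: S = T :\: S); first by lia.
    by apply/setP=> x; rewrite !inE; case: eqP => // ->; rewrite yS.
  have [U _ _ _] := F.
  pose en := [seq last q.1 q.2 | q <- ps & q.1 == y].
  have sen : size en <= 1.
    rewrite size_map size_filter; apply: (count_paths_leq1 (v := y) U) => q /eqP <-.
    exact: mem_head.
  have [|x] := @pick_outside V [set x in S | e x y] (map fst (flatten (map (@path_arcs V) ps)) ++ en).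
    by rewrite size_cat size_map (sz _ _ _ F) (leq_ltn_trans _ ybig) // -addn1 leq_add2l.
  rewrite inE mem_cat negb_or => /andP[xS exy] /andP[xt xen].
  apply: (cross_forest_add F (subxx _) (subD1set _ _) xS yT exy (neq _ _ exy)) => //.
    by apply/negP=> /(heads _ _ _ F); rewrite !inE eqxx.
  move=> q qin qy; apply: contra xen => /eqP qx; apply/mapP; exists q => //.
  by rewrite mem_filter qy eqxx.
move: noA noC noD noD'; rewrite !negb_exists => /forallP noA /forallP noC /forallP noD /forallP noD'.
have rowA x : x \in S :\: T -> #|[set y in T | e x y]| <= t.
  by move=> xA; have := noA x; rewrite xA /= -leqNgt.
have rowD x : x \in S :&: T -> #|[set y in T | e x y]| <= t.+1.
  by move=> xD; have := noD x; rewrite xD /= -leqNgt.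
have colC y : y \in T :\: S -> #|[set x in S | e x y]| <= t.
  by move=> yC; have := noC y; rewrite yC /= -leqNgt.
have colD y : y \in S :&: T -> #|[set x in S | e x y]| <= t.+1.
  by move=> yD; have := noD' y; rewrite yD /= -leqNgt.
have colT y : y \in T -> #|[set x in S | e x y]| <= t.+1.
  move=> yT; have [yS|yS] := boolP (y \in S); first by apply: colD; rewrite inE yS.
  by apply: leqW; apply: colC; rewrite inE yS.
have rowS x : x \in S -> #|[set y in T | e x y]| <= t.+1.
  move=> xS; have [xT|xT] := boolP (x \in T); first by apply: rowD; rewrite inE xS.
  by apply: leqW; apply: rowA; rewrite inE xT.
have Dbig' : #|V| <= 5 * #|S :&: T| by lia.
have [many|many] := cross_arcs_abundant oe ore_e nbig (ltn0Sn t) tn ST Dbig' Cbig rowA.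
- apply: (@cross_forest_disjoint V e S T S T t.+1 (2 * t.+1)) => //; last first.
    by apply: leq_trans many; apply: eq_leq; ring.
  move=> z; rewrite mul2n -addnn; apply: leq_add.
    by case: (boolP (z \in S)) => // zS; rewrite mul1n rowS.
  by case: (boolP (z \in T)) => // zT; rewrite mul1n colT.
- apply: (@cross_forest_disjoint V e S T (S :\: T) T t.+1 t.+1) => //; last first.
  + by apply: leq_trans many; apply: eq_leq; ring.
  + move=> z; case: (boolP (z \in S :\: T)) => zA.
      by have /setDP[_ /negbTE ->] := zA; rewrite addn0 mul1n leqW // rowA.
    case: (boolP (z \in T)) => // zT; rewrite mul0n mul1n add0n (leq_trans _ (colT z zT)) //.
    by apply/subset_leq_card/subsetP=> x; rewrite !inE => /andP[/andP[_ ->] ->].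
  + exact: subsetDl.
Qed.

(** * Reversing paths and forests *)

Definition rev_path (V : Type) (q : V * seq V) : V * seq V := (last q.1 q.2, rev (belast q.1 q.2)).

Lemma rev_path_vertices (V : Type) (q : V * seq V) : path_vertices (rev_path q) = rev (path_vertices q).
Proof. by case: q => x p; rewrite /path_vertices /= (lastI x p) rev_rcons. Qed.

Lemma rev_path_arcs (V : Type) (q : V * seq V) :
  path_arcs (rev_path q) = rev (map swap_pair (path_arcs q)).
Proof.
case: q => x p; rewrite /path_arcs /rev_path /=; elim/last_ind: p => [|p y IH] //=.
rewrite last_rcons belast_rcons -cats1 pairmap_cat map_cat rev_cat -IH.
by rewrite (lastI x p) rev_rcons.
Qed.

Lemma perm_flatten_rev (T U : eqType) (f g : U -> seq T) (s : seq U) :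
  (forall x, perm_eq (f x) (g x)) -> perm_eq (flatten (map f s)) (flatten (map g s)).
Proof. by move=> fg; elim: s => //= x s IH; apply: perm_cat. Qed.

Lemma cross_forest_rev (V : finType) (e : rel V) (S T : {set V}) (t : nat) ps :
  cross_forest (fun x y => e y x) T S t ps -> cross_forest e S T t (map (@rev_path V) ps).
Proof.
case=> U /allP A sA sV.
have pv : perm_eq (flatten (map (@path_vertices V) (map (@rev_path V) ps))) (flatten (map (@path_vertices V) ps)).
  by rewrite -map_comp; apply: perm_flatten_rev => q /=; rewrite rev_path_vertices perm_rev.
have pa : perm_eq (flatten (map (@path_arcs V) (map (@rev_path V) ps)))
    (map swap_pair (flatten (map (@path_arcs V) ps))).
  rewrite -map_comp map_flatten -map_comp.
  by apply: perm_flatten_rev => q /=; rewrite rev_path_arcs perm_rev.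
split.
- by rewrite (perm_uniq pv).
- apply/allP=> a; rewrite (perm_mem pa) => /mapP[b /A /and3P[h1 h2 h3] ->] /=.
  by rewrite h1 h2 h3.
- by rewrite (perm_size pa) size_map.
- by rewrite (perm_size pv).
Qed.

Lemma cross_forest_exists (V : finType) (e : rel V) (S T : {set V}) (t : nat) :
  oriented_graph e -> ore e -> 200 * 200 <= #|V| ->
  100 * (100 * t) <= #|V| -> #|S| + #|T| = #|V| + t -> #|V| + 5 * t <= 5 * #|S :&: T| ->
  #|V| + 6 * t <= 6 * #|T :\: S| \/ #|V| + 6 * t <= 6 * #|S :\: T| ->
  exists ps, cross_forest e S T t ps.
Proof.
move=> oe ore_e nbig tn ST D [C|A]; first exact: exists_cross_forest.
have ST' : #|T| + #|S| = #|V| + t by rewrite addnC.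
rewrite setIC in D.
have [ps P] := exists_cross_forest (oriented_rev oe) (ore_rev ore_e) nbig tn ST' D A.
by exists (map (@rev_path V) ps); apply: cross_forest_rev.
Qed.

Lemma cross_forest_excess (V : finType) (e : rel V) (S T : {set V}) (t : nat) ps :
  cross_forest e S T t ps -> excess S T (flatten (map (@path_arcs V) ps)) = (t%:Z)%R.
Proof.
case=> _ /allP A sA _; rewrite -sA /excess big_seq (eq_bigr (fun _ => 1%R : int)).
  by rewrite -big_seq big_const_seq count_predT iter_addr_0 natz.
by move=> a /A /and3P[_ -> ->].
Qed.

Lemma cross_forest_paths (V : finType) (e : rel V) (S T : {set V}) (t : nat) ps :
  cross_forest e S T t ps -> all (fun q => path e q.1 q.2) ps.
Proof.
case=> _ /allP A _ _; apply/allP=> -[x p] qps; rewrite path_arcs_all; apply/allP=> a aq.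
have /A /and3P[] // : a \in flatten (map (@path_arcs V) ps).
by apply/flattenP; exists (path_arcs (x, p)) => //; apply: map_f.
Qed.

(** * The structure of sparse pairs *)

Local Open Scope ring_scope.

(** Division by a factor [w >= s / k] turns an error [s * s] into one of order [s], which is why the
    averages are needed up to [s * s]. Below, [a], [b], [c], [d] stand for the densities of the four
    classes, and [ab] for that of the arcs from the first to the second, and so on. *)
Lemma cancel_small (R : realFieldType) (w y s k : R) :
  0 < w -> 0 < s -> s <= k * w -> w * y <= s * s -> y <= k * s.
Proof.
move=> w0 s0 sw h; rewrite -(ler_pM2l w0) (le_trans h) //.
by rewrite mulrCA mulrA; apply: ler_wpM2r => //; apply: ltW.
Qed.

Lemma bound_ac (R : realFieldType) (a b c aa ab bc cc q : R) : 0 <= a -> 0 <= c ->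
  2 * aa <= a * a -> ab <= a * b -> bc <= b * c -> 2 * cc <= c * c ->
  3 / 4 * (a * c) - q <= c * (aa + ab) + a * (bc + cc) ->
  a * c * (3 / 4 - (a / 2 + 2 * b + c / 2)) <= q.
Proof.
move=> a0 c0 /(ler_wpM2l c0) h1 /(ler_wpM2l c0) h2 /(ler_wpM2l a0) h3 /(ler_wpM2l a0) h4.
lra.
Qed.

Lemma bound_dc (R : realFieldType) (a b c d da db bc cc q : R) : 0 <= c -> 0 <= d ->
  da <= a * d -> db <= b * d -> bc <= b * c -> 2 * cc <= c * c ->
  3 / 4 * (c * d) - q <= c * (da + db) + d * (bc + cc) ->
  c * d * (3 / 4 - (a + 2 * b + c / 2)) <= q.
Proof.
move=> c0 d0 /(ler_wpM2l c0) h1 /(ler_wpM2l c0) h2 /(ler_wpM2l d0) h3 /(ler_wpM2l d0) h4.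
lra.
Qed.

Lemma bound_dd (R : realFieldType) (a b c d da db bd cd q : R) : 0 <= d ->
  a + b + c + d = 1 -> da <= a * d -> cd <= c * d -> db + bd <= b * d ->
  3 / 4 * (d * d) - q <= d * (da + db + bd + cd) ->
  d * (d * (d - 1 / 4)) <= q.
Proof.
move=> d0 tot h1 h2 h3.
have h4 : da + db + bd + cd <= d * (1 - d) by rewrite -tot; lra.
have := ler_wpM2l d0 h4; lra.
Qed.

Lemma quarter_upper (R : realFieldType) (d s : R) : 0 <= d -> 0 < s -> 20 * s <= 1 ->
  d * (d * (d - 1 / 4)) <= s * s -> d <= 1 / 4 + s.
Proof.
move=> d0 s0 s1 h; have [d4|d4] := leP d (1 / 4); first by lra.
have dd : 0 < d * d by apply: mulr_gt0; lra.
have d16 : 1 / 16 <= d * d by have := ler_pM (_ : 0 <= 1 / 4) (_ : 0 <= 1 / 4) (ltW d4) (ltW d4); lra.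
have : d - 1 / 4 <= 1 * s by apply: (cancel_small dd s0); rewrite -?mulrA //; lra.
lra.
Qed.

(** With [a + c = 1 - b - d] the bracket equals [(1 / 2 - (3 * b - d)) / 2], and the factor [a * c]
    is at least [s / 20]. *)
Lemma half_of_ac (R : realFieldType) (a b c d s : R) :
  0 < s -> 100 * s <= 1 -> a + b + c + d = 1 -> 0 <= a -> 0 <= b -> 0 <= c ->
  s <= a -> s <= c -> b <= d + s -> d <= 1 / 4 + s ->
  a * c * (3 / 4 - (a / 2 + 2 * b + c / 2)) <= s * s -> 1 / 2 - 40 * s <= 3 * b - d.
Proof.
move=> s0 s1 tot a0 b0 c0 sa sc bd d4 h.
have w0 : 0 < a * c by apply: mulr_gt0; lra.
have sw : s <= 20 * (a * c).
  have [a20|c20] : 1 / 20 <= a \/ 1 / 20 <= c.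
    by have [|] := leP (1 / 20) a; [left|right; lra].
    by have := ler_pM (_ : 0 <= 1 / 20) (ltW s0) a20 sc; lra.
  by have := ler_pM (ltW s0) (_ : 0 <= 1 / 20) sa c20; lra.
have := cancel_small w0 s0 sw h; lra.
Qed.

(** Takes the place of [half_of_ac] when [A] is too small for a division by [a * c]. *)
Lemma half_of_dc (R : realFieldType) (a b c d s : R) :
  0 < s -> 100 * s <= 1 -> a + b + c + d = 1 -> 0 <= a ->
  a <= s -> b <= d + s -> 1 / 10 <= a + d -> d <= 1 / 4 + s ->
  c * d * (3 / 4 - (a + 2 * b + c / 2)) <= s * s -> 1 / 2 - 40 * s <= 3 * b - d.
Proof.
move=> s0 s1 tot a0 sa bd ad d4 h.
have w : 1 / 40 <= c * d.
  by have := @ler_pM _ (1 / 3) c (1 / 12) d; lra.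
have w0 : 0 < c * d by lra.
have sw : s <= 1 * (c * d) by lra.
have := cancel_small w0 s0 sw h; lra.
Qed.

Lemma quarters (R : realFieldType) (b d s : R) : 0 < s -> b <= d + s -> d <= 1 / 4 + s ->
  1 / 2 - 40 * s <= 3 * b - d ->
  1 / 4 - 25 * s <= b <= 1 / 4 + 2 * s /\ 1 / 4 - 25 * s <= d <= 1 / 4 + s.
Proof. by move=> s0 h1 h2 h3; split; apply/andP; split; lra. Qed.

(** For [d] close to [1 / 4], the trivial upper bounds leave almost no room in the average over [D],
    so each of them is almost attained. *)
Lemma complete_d (R : realFieldType) (a b c d da db bd cd s : R) :
  0 < s -> 1000 * s <= 1 -> a + b + c + d = 1 ->
  1 / 4 - 25 * s <= d -> d <= 1 / 4 + s ->
  da <= a * d -> cd <= c * d -> db + bd <= b * d ->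
  3 / 4 * (d * d) - s * s <= d * (da + db + bd + cd) ->
  a * d - da <= 13 * s /\ c * d - cd <= 13 * s.
Proof.
move=> s0 s1 tot d1 d2 h1 h2 h3 h.
have d5 : 1 / 5 <= d by lra.
have d0 : 0 < d by lra.
have key : 3 / 4 * d - (da + db + bd + cd) <= 5 * s.
  by apply: (cancel_small d0 s0); lra.
have E : a * d + b * d + c * d = d * (1 - d) by rewrite -tot; ring.
have : d * (1 / 4 - d) <= d * (25 * s) by apply: ler_wpM2l; lra.
have : d * (25 * s) <= 3 / 10 * (25 * s) by apply: ler_wpM2r; lra.
have : s * s <= 1 / 1000 * s by apply: ler_wpM2r; lra.
move=> u1 u2 u3; split; lra.
Qed.

(** If [C] is not tiny, the average over [A] and [C] can be divided by [c]; otherwise the one over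
    [A] and [D] is divided by [d]. *)
Lemma complete_ac (R : realFieldType) (a b c d aa ab bc cc bd cd s : R) :
  0 < s -> 1000 * s <= 1 -> a + b + c + d = 1 -> 0 <= a -> 0 <= b -> 0 <= c ->
  1 / 4 - 25 * s <= d -> b <= 1 / 4 + 2 * s -> 0 <= aa -> 0 <= ab -> a <= 1 ->
  2 * aa <= a * a -> ab <= a * b -> bc <= b * c -> 2 * cc <= c * c -> cd <= c * d -> bd <= b * d ->
  3 / 4 * (a * c) - s * s <= c * (aa + ab) + a * (bc + cc) ->
  3 / 4 * (a * d) - s * s <= d * (aa + ab) + a * (bd + cd) ->
  a * b - ab <= 25 * s /\ a * a / 2 - aa <= 25 * s.
Proof.
move=> s0 s1 tot a0 b0 c0 d1 b2 aa0 ab0 a1 haa hab hbc hcc hcd hbd hac had.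
have fin (z : R) : z * (a * b - ab + (a * a / 2 - aa)) <= z * (25 * s) -> 0 < z ->
    a * b - ab <= 25 * s /\ a * a / 2 - aa <= 25 * s.
  by move=> h z0; rewrite ler_pM2l // in h; split; lra.
have d0 : 0 < d by lra.
have ss0 : 0 <= s * s by apply: mulr_ge0; apply: ltW.
have as1 : a * s <= s by rewrite -[leRHS]mul1r ler_wpM2r // ltW.
have [cs|cs] := leP s c.
  apply: (fin c); last lra.
  have g3 := ler_wpM2l a0 hbc; have g4 := ler_wpM2l a0 hcc.
  have u : a * c * (a / 2 + 2 * b + c / 2) <= a * c * (3 / 4 + 16 * s).
    by apply: ler_wpM2l; [apply: mulr_ge0 | lra].
  have u2 : c * (a * s) <= c * s by apply: ler_wpM2l.
  have u3 : s * s <= c * s by apply: ler_wpM2r => //; apply: ltW.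
  lra.
apply: (fin d) => //.
have g3 := ler_wpM2l a0 hbd; have g4 := ler_wpM2l a0 hcd.
have u : a * d * (a / 2 + 2 * b + c) <= a * d * (3 / 4 + 17 * s).
  by apply: ler_wpM2l; [apply: mulr_ge0 => //; apply: ltW | lra].
have u2 : d * (a * s) <= d * s by apply: ler_wpM2l => //; apply: ltW.
have u3 : s * s <= d * s by apply: ler_wpM2r; lra.
lra.
Qed.

(** Together with its mirror image this settles both directions between [B] and [D]: the lower
    bounds [c * d / 2] and [a * d / 2] add up to about [b * d], as [a + c] is about [1 / 2] and [b]
    about [1 / 4]. *)
Lemma density_db (R : realFieldType) (a b c d da db bc cc s : R) :
  0 < s -> 1000 * s <= 1 -> a + b + c + d = 1 -> 0 <= c -> c <= 1 -> 0 <= db ->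
  1 / 4 - 25 * s <= d -> d <= 1 / 4 + s ->
  da <= a * d -> bc <= b * c -> 2 * cc <= c * c ->
  3 / 4 * (c * d) - s * s <= c * (da + db) + d * (bc + cc) ->
  c * d / 2 - db <= 30 * s.
Proof.
move=> s0 s1 tot c0 c1 db0 d1 d2 hda hbc hcc h.
have d0 : 0 <= d by lra.
have [cs|cs] := leP s c; last first.
  have : c * d <= s * d by apply: ler_wpM2r => //; apply: ltW.
  have : s * d <= s * 1 by apply: ler_wpM2l; lra.
  lra.
have c0' : 0 < c by lra.
rewrite -(ler_pM2l c0').
have ss0 : 0 <= s * s by apply: mulr_ge0; apply: ltW.
have g1 := ler_wpM2l c0 hda; have g3 := ler_wpM2l d0 hbc; have g4 := ler_wpM2l d0 hcc.
have cd0 : 0 <= c * d by apply: mulr_ge0.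
have u : c * d * (c / 2 - 25 * s) <= c * d * (3 / 4 - a - b - c / 2).
  by apply: ler_wpM2l => //; lra.
have u2 : c * d * s <= c * 1 * s by apply: ler_wpM2r; [lra | apply: ler_wpM2l; lra].
have u3 : s * s <= c * s by apply: ler_wpM2r => //; apply: ltW.
lra.
Qed.

Lemma tight_real (R : realFieldType) (a b c d aa ab bc cc da db bd cd s : R) :
  0 <= a -> 0 <= b -> 0 <= c -> 0 <= d -> a + b + c + d = 1 ->
  0 < s -> 1000 * s <= 1 -> b <= d + s -> 1 / 10 <= a + d -> 1 / 10 <= c + d ->
  0 <= aa -> 0 <= ab -> 0 <= bc -> 0 <= cc -> 0 <= db -> 0 <= bd ->
  2 * aa <= a * a -> ab <= a * b -> bc <= b * c -> 2 * cc <= c * c ->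
  da <= a * d -> cd <= c * d -> db + bd <= b * d ->
  3 / 4 * (a * c) - s * s <= c * (aa + ab) + a * (bc + cc) ->
  3 / 4 * (a * d) - s * s <= d * (aa + ab) + a * (bd + cd) ->
  3 / 4 * (c * d) - s * s <= c * (da + db) + d * (bc + cc) ->
  3 / 4 * (d * d) - s * s <= d * (da + db + bd + cd) ->
  [/\ 1 / 4 - 25 * s <= b <= 1 / 4 + 2 * s, 1 / 4 - 25 * s <= d <= 1 / 4 + s,
      a * d - da <= 13 * s & c * d - cd <= 13 * s] /\
  [/\ a * b - ab <= 25 * s, b * c - bc <= 25 * s, a * a / 2 - aa <= 25 * s &
      c * c / 2 - cc <= 25 * s] /\
  (c * d / 2 - db <= 30 * s /\ a * d / 2 - bd <= 30 * s).
Proof.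
move=> a0 b0 c0 d0 tot s0 s1 bds hS hT aa0 ab0 bc0 cc0 db0 bd0 haa hab hbc hcc hda hcd hdb.
move=> hac had hdc hdd.
have s20 : 20 * s <= 1 by clear -s0 s1; lra.
have s100 : 100 * s <= 1 by clear -s0 s1; lra.
have tot' : c + b + a + d = 1 by rewrite -tot; ring.
have hdb1 : db <= b * d by clear -hdb bd0; lra.
have hbd1 : bd <= b * d by clear -hdb db0; lra.
have d4 := quarter_upper d0 s0 s20 (bound_dd d0 tot hda hcd hdb hdd).
have half : 1 / 2 - 40 * s <= 3 * b - d.
  have [sa|sa] := leP s a; have [sc|sc] := leP s c.
  - exact: (half_of_ac s0 s100 tot a0 b0 c0 sa sc bds d4 (bound_ac a0 c0 haa hab hbc hcc hac)).
  - apply: (half_of_dc s0 s100 tot' c0 (ltW sc) bds hT d4).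
    have hab' : ab <= b * a by rewrite mulrC.
    have hcd' : cd <= c * d by [].
    apply: (bound_dc a0 d0 hcd' hbd1 hab' haa).
    by clear -had; lra.
  - exact: (half_of_dc s0 s100 tot a0 (ltW sa) bds hS d4 (bound_dc c0 d0 hda hdb1 hbc hcc hdc)).
  - exact: (half_of_dc s0 s100 tot a0 (ltW sa) bds hS d4 (bound_dc c0 d0 hda hdb1 hbc hcc hdc)).
have [hb hd] := quarters s0 bds d4 half.
have [b1 b2] := andP hb; have [d1 d2] := andP hd.
have [f1 f2] := complete_d s0 s1 tot d1 d2 hda hcd hdb hdd.
have a1 : a <= 1 by clear -a0 b0 c0 d0 tot; lra.
have c1 : c <= 1 by clear -a0 b0 c0 d0 tot; lra.
have [f3 f4] := complete_ac s0 s1 tot a0 b0 c0 d1 b2 aa0 ab0 a1 haa hab hbc hcc hcd hbd1 hac had.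
have hac' : 3 / 4 * (c * a) - s * s <= a * (cc + bc) + c * (ab + aa) by clear -hac; lra.
have hdc' : 3 / 4 * (c * d) - s * s <= d * (cc + bc) + c * (db + da) by clear -hdc; lra.
have hbc' : bc <= c * b by rewrite mulrC.
have hab' : ab <= b * a by rewrite mulrC.
have [f5 f5'] := complete_ac s0 s1 tot' c0 b0 a0 d1 b2 cc0 bc0 c1 hcc hbc' hab' haa hda hdb1 hac' hdc'.
have f6 := density_db s0 s1 tot c0 c1 db0 d1 d2 hda hbc hcc hdc.
have had2 : 3 / 4 * (a * d) - s * s <= a * (cd + bd) + d * (ab + aa) by clear -had; lra.
have f7 := density_db s0 s1 tot' a0 a1 bd0 d1 d2 hcd hab' haa had2.
by do 2?split=> //; split=> //; rewrite mulrC.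
Qed.

(** * Densities, and the degree condition in terms of them *)

Definition dens (R : realFieldType) (V : finType) (X : {set V}) : R := #|X|%:R / #|V|%:R.

Definition adens (R : realFieldType) (V : finType) (e : rel V) (X Y : {set V}) : R :=
  (arcs e X Y)%:R / (#|V|%:R * #|V|%:R).

Lemma dens_ge0 (R : realFieldType) (V : finType) (X : {set V}) : 0 <= dens R X.
Proof. by rewrite divr_ge0 ?ler0n. Qed.

Lemma adens_ge0 (R : realFieldType) (V : finType) (e : rel V) (X Y : {set V}) : 0 <= adens R e X Y.
Proof. by rewrite divr_ge0 ?ler0n // mulr_ge0 ?ler0n. Qed.

Lemma dens_split (R : realFieldType) (V : finType) (X Z : {set V}) :
  dens R X = dens R (X :&: Z) + dens R (X :\: Z).
Proof. by rewrite /dens -mulrDl -natrD cardsID. Qed.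

Lemma dens_sub (R : realFieldType) (V : finType) (X Y : {set V}) : X \subset Y -> dens R X <= dens R Y.
Proof.
by move=> /setIidPr XY; rewrite [leRHS](dens_split R Y X) XY lerDl dens_ge0.
Qed.

Lemma dens_setT (R : realFieldType) (V : finType) : (0 < #|V|)%N -> dens R [set: V] = 1.
Proof. by move=> n0; rewrite /dens cardsT divff // pnatr_eq0 -lt0n. Qed.

Lemma adens_splitl (R : realFieldType) (V : finType) (e : rel V) (X Y Z : {set V}) :
  adens R e X Y = adens R e (X :&: Z) Y + adens R e (X :\: Z) Y.
Proof. by rewrite /adens -mulrDl -natrD -arcs_splitl. Qed.

Lemma adens_splitr (R : realFieldType) (V : finType) (e : rel V) (X Y Z : {set V}) :
  adens R e X Y = adens R e X (Y :&: Z) + adens R e X (Y :\: Z).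
Proof. by rewrite /adens -mulrDl -natrD -arcs_splitr. Qed.

Lemma adens_sub (R : realFieldType) (V : finType) (e : rel V) (X Y X' Y' : {set V}) :
  X \subset X' -> Y \subset Y' -> adens R e X Y <= adens R e X' Y'.
Proof.
move=> XX YY; apply: ler_wpM2r; last by rewrite ler_nat arcs_sub.
by rewrite invr_ge0 mulr_ge0 ?ler0n.
Qed.

Lemma dens_mul (R : realFieldType) (V : finType) (X Y : {set V}) :
  dens R X * dens R Y = (#|X| * #|Y|)%:R / (#|V|%:R * #|V|%:R).
Proof. by rewrite /dens natrM mulrACA -invfM. Qed.

Lemma adens_leq (R : realFieldType) (V : finType) (e : rel V) (X Y : {set V}) :
  adens R e X Y <= dens R X * dens R Y.
Proof.
rewrite dens_mul; apply: ler_wpM2r; last by rewrite ler_nat arcs_leq.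
by rewrite invr_ge0 mulr_ge0 ?ler0n.
Qed.

Lemma adens_anti (R : realFieldType) (V : finType) (e : rel V) (X Y : {set V}) :
  oriented_graph e -> adens R e X Y + adens R e Y X <= dens R X * dens R Y.
Proof.
move=> oe; rewrite dens_mul /adens -mulrDl -natrD.
by apply: ler_wpM2r; rewrite ?invr_ge0 ?mulr_ge0 ?ler0n // ler_nat arcs_anti.
Qed.

Lemma adens_diag (R : realFieldType) (V : finType) (e : rel V) (X : {set V}) :
  oriented_graph e -> 2 * adens R e X X <= dens R X * dens R X.
Proof.
move=> oe; have := @adens_anti R V e X X oe; lra.
Qed.

Lemma adens_rev (R : realFieldType) (V : finType) (e : rel V) (X Y : {set V}) :
  adens R (fun x y => e y x) X Y = adens R e Y X.
Proof. by rewrite /adens arcs_rev. Qed.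

(** The slack [q] absorbs the terms of lower order: the constant 3 of the degree condition and the
    common vertices of [X] and [Y]. *)
Lemma ore_density (R : realFieldType) (V : finType) (e : rel V) (X Y : {set V}) (q : R) :
  (0 < #|V|)%N -> oriented_graph e -> ore e -> 2 <= q * #|V|%:R ->
  3 / 4 * (dens R X * dens R Y - adens R e X Y) - q <=
  dens R Y * adens R e X setT + dens R X * adens R e setT Y.
Proof.
move=> n0 oe ore_e; have [irr _] := oe.
have := ore_average X Y ore_e; have := nonarcs_count X Y irr.
have xyn : (#|X :&: Y| <= #|V|)%N by apply: max_card.
have xyN : (#|X| * #|Y| <= #|V| * #|V|)%N by rewrite leq_mul ?max_card.
rewrite dens_mul /dens /adens; move: (nonarcs e X Y) (arcs e X Y) (arcs e X setT) (arcs e setT Y).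
move: #|X :&: Y| #|X| #|Y| #|V| n0 xyn xyN => i x y n n0 xyn xyN N E P Q cN hN qn.
have nR : 0 < n%:R :> R by rewrite ltr0n.
have nz : n%:R != 0 :> R by rewrite gt_eqF.
have n3 : 0 < n%:R * n%:R * n%:R :> R by rewrite !mulr_gt0.
rewrite -(ler_pM2l n3).
have -> : n%:R * n%:R * n%:R * (y%:R / n%:R * (P%:R / (n%:R * n%:R)) + x%:R / n%:R * (Q%:R / (n%:R * n%:R))) =
   y%:R * P%:R + x%:R * Q%:R :> R by field.
have -> : n%:R * n%:R * n%:R * (3 / 4 * ((x * y)%:R / (n%:R * n%:R) - E%:R / (n%:R * n%:R)) - q) =
   3 / 4 * n%:R * ((x * y)%:R - E%:R) - q * n%:R * (n%:R * n%:R) :> R by field.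
have hN' : 3 * (n%:R - 1) * N%:R <= 4 * (y%:R * P%:R + x%:R * Q%:R) :> R.
  by rewrite -(natrB _ n0) -!natrM -natrD -!natrM ler_nat subn1.
have cN' : N%:R + E%:R + i%:R = (x * y)%:R :> R by rewrite -!natrD cN.
have iN : i%:R <= n%:R :> R by rewrite ler_nat.
have xyN' : (x * y)%:R <= n%:R * n%:R :> R by rewrite -natrM ler_nat.
have E0 : 0 <= E%:R :> R by []; have i0 : 0 <= i%:R :> R by [].
have N0 : 0 <= N%:R :> R by [].
have h1 : n%:R * i%:R <= n%:R * n%:R :> R by apply: ler_wpM2l => //; apply: ltW.
have h2 : 2 * (n%:R * n%:R) <= q * n%:R * (n%:R * n%:R) :> R.
  by apply: ler_wpM2r => //; rewrite mulr_ge0 ?ltW.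
rewrite -cN' in xyN' *.
move: hN' h1 h2 xyN' E0 i0 N0 iN.
move: (N%:R : R) (E%:R : R) (i%:R : R) (n%:R : R) (y%:R * P%:R + x%:R * Q%:R : R) (q * _ * _).
clear; move=> N E i n W Z; lra.
Qed.

(* The classes A = S \ T, B = V \ (S u T), C = T \ S and D = S n T form an
   approximate blow-up A -> B -> C -> D -> A with |B| = |D| = n/4. *)
Definition near_extremal (R : realFieldType) (V : finType) (e : rel V) (S T : {set V}) (s : R) : Prop :=
  let A := S :\: T in let B := ~: (S :|: T) in let C := T :\: S in let D := S :&: T in
  [/\ 1 / 4 - 25 * s <= dens R B <= 1 / 4 + 2 * s, 1 / 4 - 25 * s <= dens R D <= 1 / 4 + s,
      dens R A * dens R D - adens R e D A <= 13 * s & dens R C * dens R D - adens R e C D <= 13 * s] /\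
  [/\ dens R A * dens R B - adens R e A B <= 25 * s, dens R B * dens R C - adens R e B C <= 25 * s,
      dens R A * dens R A / 2 - adens R e A A <= 25 * s &
      dens R C * dens R C / 2 - adens R e C C <= 25 * s] /\
  (dens R C * dens R D / 2 - adens R e D B <= 30 * s /\ dens R A * dens R D / 2 - adens R e B D <= 30 * s).

Lemma near_extremal_rev (R : realFieldType) (V : finType) (e : rel V) (S T : {set V}) (s : R) :
  near_extremal e S T s -> near_extremal (fun x y => e y x) T S s.
Proof.
rewrite /near_extremal (setUC T S) (setIC T S) !(adens_rev R e).
move=> [[h1 h2 h3 h4] [[h5 h6 h7 h8] [h9 h10]]]; do 2?split=> //; split=> //; by rewrite mulrC.
Qed.

Lemma class_sum (R : realFieldType) (V : finType) (S T : {set V}) : (0 < #|V|)%N ->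
  dens R (S :\: T) + dens R (~: (S :|: T)) + dens R (T :\: S) + dens R (S :&: T) = 1.
Proof.
move=> n0; transitivity (dens R [set: V]); last exact: dens_setT.
rewrite (dens_split R setT S) setTI setTD (dens_split R S T) (dens_split R (~: S) T).
have -> : ~: S :&: T = T :\: S by apply/setP=> x; rewrite !inE andbC.
have -> : ~: S :\: T = ~: (S :|: T) by apply/setP=> x; rewrite !inE negb_or andbC.
by ring.
Qed.

Lemma adens_from (R : realFieldType) (V : finType) (e : rel V) (X S T : {set V}) :
  adens R e X setT = adens R e X T + adens R e X (S :\: T) + adens R e X (~: (S :|: T)).
Proof.
rewrite (adens_splitr R e X setT T) setTI setTD (adens_splitr R e X (~: T) S) addrA.
by congr (_ + adens R e X _ + adens R e X _); apply/setP=> x; rewrite !inE ?negb_or.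
Qed.

Lemma adens_to (R : realFieldType) (V : finType) (e : rel V) (X S T : {set V}) :
  adens R e setT X = adens R e S X + adens R e (T :\: S) X + adens R e (~: (S :|: T)) X.
Proof.
rewrite (adens_splitl R e setT X S) setTI setTD (adens_splitl R e (~: S) X T) addrA.
by congr (_ + adens R e _ X + adens R e _ X); apply/setP=> x; rewrite !inE ?negb_or // andbC.
Qed.

Lemma dens_leq1 (R : realFieldType) (V : finType) (X : {set V}) : dens R X <= 1.
Proof.
have [n0|n0] := posnP #|V|; first by rewrite /dens n0 invr0 mulr0.
by rewrite -(dens_setT R n0) dens_sub ?subsetT.
Qed.

Lemma ore_slack (R : realFieldType) (x y e1 e2 e3 u v q : R) : x <= 1 -> y <= 1 ->
  0 <= e1 -> 0 <= e2 -> 0 <= q -> e1 <= q -> e2 <= q -> e3 <= q -> 0 <= x -> 0 <= y ->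
  3 / 4 * (x * y - e3) - q <= y * (e1 + u) + x * (e2 + v) ->
  3 / 4 * (x * y) - 4 * q <= y * u + x * v.
Proof.
move=> x1 y1 e10 e20 q0 h1 h2 h3 x0 y0 h.
have u1 : y * e1 <= 1 * q by apply: ler_pM.
have u2 : x * e2 <= 1 * q by apply: ler_pM.
lra.
Qed.

(** As [S] sends almost nothing to [T], only out-arcs to [A] and [B] and in-arcs from [C] and [B]
    count. *)
Lemma ore_tight (R : realFieldType) (V : finType) (e : rel V) (S T X Y : {set V}) (q : R) :
  (0 < #|V|)%N -> oriented_graph e -> ore e -> 2 <= q * #|V|%:R ->
  adens R e S T <= q -> X \subset S -> Y \subset T ->
  3 / 4 * (dens R X * dens R Y) - 4 * q <=
  dens R Y * (adens R e X (S :\: T) + adens R e X (~: (S :|: T))) +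
  dens R X * (adens R e (T :\: S) Y + adens R e (~: (S :|: T)) Y).
Proof.
move=> n0 oe ore_e qn eST XS YT.
have h := ore_density X Y n0 oe ore_e qn.
rewrite (adens_from R e X S T) (adens_to R e Y S T) -!addrA in h.
have q0 : 0 <= q.
  have nR : 0 < #|V|%:R :> R by rewrite ltr0n.
  by rewrite -(pmulr_lge0 _ nR); apply: le_trans qn; apply: ler0n.
apply: (ore_slack _ _ _ _ q0 _ _ _ _ _ h); rewrite ?dens_leq1 ?dens_ge0 ?adens_ge0 //.
- by apply: le_trans eST; apply: adens_sub.
- by apply: le_trans eST; apply: adens_sub.
- by apply: le_trans eST; apply: adens_sub.
Qed.

Lemma weaken_slack (R : realFieldType) (x q s z : R) : 8 * q <= s * s -> 0 <= q ->
  x - 4 * q <= z -> x - s * s <= z.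
Proof. by move=> h1 h2 h3; lra. Qed.

(** Four averages determine the structure: those from [A] to [C], from [A] to [D], from [D] to [C]
    and inside [D]. *)
Lemma tight_structure (R : realFieldType) (V : finType) (e : rel V) (S T : {set V}) (s q : R) :
  (0 < #|V|)%N -> oriented_graph e -> ore e -> 2 <= q * #|V|%:R ->
  0 < s -> 1000 * s <= 1 -> 8 * q <= s * s -> adens R e S T <= q ->
  1 / 10 <= dens R S -> 1 / 10 <= dens R T -> 1 - s <= dens R S + dens R T ->
  near_extremal e S T s.
Proof.
move=> n0 oe ore_e qn s0 s1 qs eST hS hT hST.
have tot := class_sum R S T n0.
have SE : dens R S = dens R (S :\: T) + dens R (S :&: T) by rewrite addrC -dens_split.
have TE : dens R T = dens R (T :\: S) + dens R (S :&: T) by rewrite addrC setIC -dens_split.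
have q0 : 0 <= q by apply: le_trans eST; apply: adens_ge0.
have ot X Y := @ore_tight R V e S T X Y q n0 oe ore_e qn eST.
have o1 := weaken_slack qs q0 (ot _ _ (subsetDl S T) (subsetDl T S)).
have o2 := weaken_slack qs q0 (ot _ _ (subsetDl S T) (subsetIr S T)).
have o3 := weaken_slack qs q0 (ot _ _ (subsetIl S T) (subsetDl T S)).
have o4 := weaken_slack qs q0 (ot _ _ (subsetIl S T) (subsetIr S T)).
rewrite SE in hS hST; rewrite TE in hT hST.
apply: (@tight_real R _ _ _ _ _ _ _ _ _ _ _ _ _ _ _ _ _ tot s0 s1);
  rewrite ?dens_ge0 ?adens_ge0 ?adens_diag ?adens_leq //.
- by move: tot hST; clear; lra.
- by rewrite mulrC; apply: adens_leq.
- by rewrite addrC; apply: adens_anti.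
- by rewrite [adens R e _ _ + adens R e (T :\: S) _]addrC.
- by rewrite [adens R e (~: _) _ + _]addrC.
- by rewrite (mulrC (dens R (T :\: S))) [adens R e (~: _) _ + _]addrC.
- by move: o4; clear; lra.
Qed.

(** * Robust expansion near the extremal structure *)

Lemma one_side_small (R : realFieldType) (x y t : R) : 0 < t -> x * y <= t * t -> x <= t \/ y <= t.
Proof.
move=> t0 h; have [|xt] := leP x t; [by left|right]; rewrite leNgt; apply/negP=> yt.
have : t * t < x * y by apply: ltr_pM => //; apply: ltW.
lra.
Qed.

(** [a1] and [d1] are the parts of [X] in [A] and [D], [x] and [y] the parts of [Y] in [A] and [B],
    and [j] is the overlap inside [A]. One factor of each of the first two products is small, which
    leaves four cases. In two of them [X] or [Y] is too small; in one the overlap is large but spans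
    few arcs, although [A] is almost a tournament. *)
Lemma no_sparse_sides (R : realFieldType) (a b c d a1 d1 x y j s t z : R) :
  a + b + c + d = 1 -> 0 <= c -> c <= 1 -> 1 / 4 - 25 * s <= d -> d <= 1 / 4 + s -> b <= 1 / 4 + 2 * s ->
  0 < s -> 40 * s <= t -> 100 * t <= z * z -> 0 < z -> 10 * z <= 1 ->
  0 <= d1 -> d1 <= d -> 0 <= y -> y <= b ->
  z <= a1 + d1 -> z <= x + y -> a + d - t <= a1 + d1 + x + y ->
  d1 * x <= t * t -> a1 * y <= t * t -> d1 * y <= t * t + b * d - c * d / 2 ->
  c * d1 * (3 / 4 - (a + 2 * b - y + c / 2)) <= t * t ->
  a1 + x - a <= j -> j * j / 2 <= t * t -> False.
Proof.
move=> tot c0 c1 dl du bu s0 st tz z0 z1 d10 d1d y0 yb zS zT sum h1 h2 h3 h4 hj h5.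
have t0 : 0 < t by clear -s0 st; lra.
have zz : z * z <= 1 / 10 * z by apply: ler_wpM2r; clear -z0 z1; lra.
have zt : 1000 * t <= z by clear -zz tz; lra.
have t1 : 10000 * t <= 1 by clear -zt z1; lra.
have tt : t * t <= 1 / 1000 * t by apply: ler_wpM2r; clear -t0 t1; lra.
have [dt|xt] := one_side_small t0 h1; have [a1t|yt] := one_side_small t0 h2.
- by clear -zS dt a1t zt t0; lra.
- have j5 : 1 / 5 <= j by clear -hj sum dt yt dl st s0 t1; lra.
  have := ler_pM (_ : 0 <= 1 / 5) (_ : 0 <= 1 / 5) j5 j5.
  by clear -h5 tt t1 t0; lra.
(* The case of [D] against [B]. The degree condition for [D :&: X] and [C] forces [c] close to [0]
   or to [1 / 2]. In the former case [y] would exceed the size of [B], since [a] is about [1 / 2];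
   in the latter [D -> B] is almost complete, so [d1 * y] would be small. *)
- have ya : a - 3 * t <= y by clear -sum d1d xt a1t; lra.
  have d1z : z - t <= d1 by clear -zS a1t; lra.
  have yz : z - t <= y by clear -zT xt; lra.
  have cc : c * (1 / 2 - c) <= 10 * t.
    rewrite leNgt; apply/negP=> big.
    have w0 : 0 <= c * (1 / 4 - c / 2 - 4 * t).
      have : c * t <= 1 * t by apply: ler_wpM2r => //; apply: ltW.
      by clear -big t0; lra.
    have k1 : c * d1 * (1 / 4 - c / 2 - 4 * t) <= c * d1 * (3 / 4 - (a + 2 * b - y + c / 2)).
      by apply: ler_wpM2l; [apply: mulr_ge0 | clear -ya bu st s0; lra].
    have k2 : 500 * t * (c * (1 / 4 - c / 2 - 4 * t)) <= d1 * (c * (1 / 4 - c / 2 - 4 * t)).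
      by apply: ler_wpM2r => //; clear -d1z zt t0; lra.
    have k3 : t * (500 * (c * (1 / 4 - c / 2 - 4 * t))) <= t * t by move: k1 k2 h4; clear; lra.
    rewrite ler_pM2l // in k3.
    have : c * t <= 1 * t by apply: ler_wpM2r => //; apply: ltW.
    by clear -k3 big t0; lra.
  have [c40|c40] := leP c (60 * t).
    by clear -tot dl du bu ya yb c40 st s0 t1 t0; lra.
  have [c2|c2] := leP (1 / 2 - 60 * t) c; last first.
    have [c4|c4] := leP c (1 / 4).
      have : 60 * t * (1 / 5) < c * (1 / 2 - c) by apply: ltr_pM; clear -c40 t0 c4 t1; lra.
      by clear -cc t0; lra.
    have : 1 / 5 * (60 * t) < c * (1 / 2 - c) by apply: ltr_pM; clear -c2 t0 c4 t1; lra.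
    by clear -cc t0; lra.
  have k1 : (z - t) * (z - t) <= d1 * y by apply: ler_pM => //; clear -zt t0 z0; lra.
  have k2 : d * (b - c / 2) <= d * (31 * t).
    by apply: ler_wpM2l; [clear -d1d d10 | clear -bu c2 st s0]; lra.
  have k3 : d * (31 * t) <= 3 / 10 * (31 * t).
    by apply: ler_wpM2r; [clear -t0 | clear -du st s0 t1]; lra.
  have k4 : t * z <= t * 1 by apply: ler_wpM2l; [clear -t0|clear -z0 z1]; lra.
  have k5 : 0 <= t * t by apply: mulr_ge0; apply: ltW.
  by clear -k1 k2 k3 k4 k5 h3 tt tz t0; lra.
- by clear -zT yt xt zt t0; lra.
Qed.

Lemma deficit_sub (R : realFieldType) (V : finType) (e : rel V) (X Y X' Y' : {set V}) :
  X' \subset X -> Y' \subset Y ->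
  dens R X' * dens R Y' - adens R e X' Y' <= dens R X * dens R Y - adens R e X Y.
Proof.
move=> XX YY; have eX : X :&: X' = X' by apply/setIidPr.
have eY : Y :&: Y' = Y' by apply/setIidPr.
have h1 := adens_leq R e (X :\: X') Y; have h2 := adens_leq R e X' (Y :\: Y').
rewrite (adens_splitl R e X Y X') eX (adens_splitr R e X' Y Y') eY.
rewrite (dens_split R X X') eX (dens_split R Y Y') eY.
rewrite (dens_split R Y Y') eY in h1; lra.
Qed.

Lemma deficit_diag_sub (R : realFieldType) (V : finType) (e : rel V) (X X' : {set V}) :
  oriented_graph e -> X' \subset X ->
  dens R X' * dens R X' / 2 - adens R e X' X' <= dens R X * dens R X / 2 - adens R e X X.
Proof.
move=> oe XX; have eX : X :&: X' = X' by apply/setIidPr.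
have h1 := adens_anti R X' (X :\: X') oe; have h2 := adens_diag R (X :\: X') oe.
rewrite (adens_splitl R e X X X') eX (adens_splitr R e X' X X') eX.
rewrite (adens_splitr R e (X :\: X') X X') eX (dens_split R X X') eX; lra.
Qed.

Lemma near_extremal_robust (R : realFieldType) (V : finType) (e : rel V) (S T X Y : {set V}) (s q k t z : R) :
  (0 < #|V|)%N -> oriented_graph e -> ore e -> 2 <= q * #|V|%:R ->
  adens R e S T <= q -> near_extremal e S T s -> 0 < s -> q <= k ->
  10 * k + 60 * s <= t * t -> 40 * s <= t -> 100 * t <= z * z -> 0 < z -> 10 * z <= 1 ->
  X \subset S -> Y \subset ~: T -> z <= dens R X -> z <= dens R Y ->
  dens R S - t <= dens R X + dens R Y -> adens R e X Y <= k -> False.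
Proof.
move=> n0 oe ore_e qn eST ne s0 qk kt st tz z0 z1 XS YT zX zY sum eXY.
have [[/andP[bl bu] /andP[dl du] hDA hCD] [[hAB hBC hAA hCC] [hDB hBD]]] := ne.
have tot := class_sum R S T n0.
set A := S :\: T in hDA hAB hAA hBD tot *; set B := ~: (S :|: T) in bl bu hAB hBC hDB hBD tot *.
set C := T :\: S in hCD hBC hCC hDB tot *; set D := S :&: T in dl du hDA hCD hDB hBD tot *.
have AXE : A :&: X = X :\: T.
  apply/setP=> v; rewrite !inE; case: (boolP (v \in X)) => [vX|]; last by rewrite !andbF.
  by rewrite (subsetP XS _ vX) !andbT.
have DXE : D :&: X = X :&: T.
  apply/setP=> v; rewrite !inE; case: (boolP (v \in X)) => [vX|]; last by rewrite !andbF.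
  by rewrite (subsetP XS _ vX) andbT.
have AYE : A :&: Y = Y :&: S.
  apply/setP=> v; rewrite !inE; case: (boolP (v \in Y)) => [vX|]; last by rewrite !andbF.
  by have := subsetP YT _ vX; rewrite inE => ->; rewrite andbT.
have BYE : B :&: Y = Y :\: S.
  apply/setP=> v; rewrite !inE negb_or; case: (boolP (v \in Y)) => [vX|]; last by rewrite !andbF.
  by have := subsetP YT _ vX; rewrite inE => ->; rewrite !andbT.
have Xs : dens R X = dens R (D :&: X) + dens R (A :&: X) by rewrite DXE AXE; apply: dens_split.
have Ys : dens R Y = dens R (A :&: Y) + dens R (B :&: Y) by rewrite AYE BYE; apply: dens_split.
have Ss : dens R S = dens R D + dens R A by apply: dens_split.
have eDA : adens R e (D :&: X) (A :&: Y) <= k by apply: le_trans eXY; apply: adens_sub; apply: subsetIr.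
have eAB : adens R e (A :&: X) (B :&: Y) <= k by apply: le_trans eXY; apply: adens_sub; apply: subsetIr.
have eDB : adens R e (D :&: X) (B :&: Y) <= k by apply: le_trans eXY; apply: adens_sub; apply: subsetIr.
have eJ : adens R e (A :&: X :&: Y) (A :&: X :&: Y) <= k.
  apply: le_trans eXY; apply: adens_sub; last exact: subsetIr.
  by rewrite setIAC; apply: subsetIr.
have f1 := deficit_sub R e (subsetIl D X) (subsetIl A Y).
have f2 := deficit_sub R e (subsetIl A X) (subsetIl B Y).
have f3 := deficit_sub R e (subsetIl D X) (subsetIl B Y).
have f5 := deficit_diag_sub R oe (_ : A :&: X :&: Y \subset A).
rewrite -setIA subsetIl in f5; have {}f5 := f5 isT; rewrite setIA in f5.
have f4 := @ore_tight R V e S T (D :&: X) C q n0 oe ore_e qn eST.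
have DXS : D :&: X \subset S by rewrite DXE (subset_trans (subsetIl _ _)).
have {}f4 := f4 DXS (subsetDl T S); rewrite -/A -/B -/C in f4.
have g1 := adens_leq R e (D :&: X) A; have g2 := adens_leq R e B C; have g3 := adens_diag R C oe.
have g4 := adens_leq R e (D :&: X) (B :\: Y).
have g5 := adens_splitr R e (D :&: X) B Y; have g6 := dens_split R B Y.
have g7 := dens_split R A Y; have g8 := dens_split R (A :\: Y) X.
have g9 := dens_split R (A :&: Y) X.
have g10 : dens R (A :&: X) = dens R (A :&: X :&: Y) + dens R (A :&: X :\: Y) by apply: dens_split.
have g11 : dens R ((A :\: Y) :&: X) = dens R (A :&: X :\: Y).
  by congr (dens R _); apply/setP=> v; rewrite !inE; do ?[case: (_ \in _)].
have g12 := dens_ge0 R (A :\: Y :\: X).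
have k0 : 0 <= q by apply: le_trans eST; apply: adens_ge0.
have c0 := dens_ge0 R C; have c1 := dens_leq1 R C; have d10 := dens_ge0 R (D :&: X).
have d1l := dens_leq1 R (D :&: X).
have y0 := dens_ge0 R (B :&: Y).
have d1d := dens_sub R (subsetIl D X); have yb := dens_sub R (subsetIl B Y).
rewrite Xs in zX sum; rewrite Ys in zY sum; rewrite Ss in sum.
have final := @no_sparse_sides R (dens R A) (dens R B) (dens R C) (dens R D) (dens R (A :&: X))
  (dens R (D :&: X)) (dens R (A :&: Y)) (dens R (B :&: Y)) (dens R (A :&: X :&: Y)) s t z.
have h1 : dens R (D :&: X) * dens R (A :&: Y) <= t * t.
  by move: f1 eDA hDA kt s0 k0 qk; rewrite (mulrC (dens R D)); clear; lra.
have h2 : dens R (A :&: X) * dens R (B :&: Y) <= t * t by move: f2 eAB hAB kt s0 k0 qk; clear; lra.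
have h3 : dens R (D :&: X) * dens R (B :&: Y) <= t * t + dens R B * dens R D - dens R C * dens R D / 2.
  by move: f3 eDB hDB kt s0 k0 qk; rewrite (mulrC (dens R D)); clear; lra.
have h4 : dens R C * dens R (D :&: X) * (3 / 4 - (dens R A + 2 * dens R B - dens R (B :&: Y) + dens R C / 2)) <= t * t.
  have u1 : dens R C * (adens R e (D :&: X) A + adens R e (D :&: X) B) <=
     dens R C * (dens R (D :&: X) * dens R A + (k + dens R (D :&: X) * (dens R B - dens R (B :&: Y)))).
    apply: ler_wpM2l => //; rewrite g5; rewrite {1}g6 addrAC subrr add0r.
    by move: g1 g4 eDB; clear; lra.
  have u2 : dens R (D :&: X) * (adens R e C C + adens R e B C) <=
     dens R (D :&: X) * (dens R C * dens R C / 2 + dens R B * dens R C).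
    by apply: ler_wpM2l => //; move: g2 g3; clear; lra.
  have u3 : dens R C * k <= 1 * k by apply: ler_wpM2r => //; apply: le_trans qk.
  by move: f4 u1 u2 u3 kt s0 k0 qk; clear; lra.
have h5 : dens R (A :&: X :&: Y) * dens R (A :&: X :&: Y) / 2 <= t * t.
  by move: f5 eJ hAA kt s0 k0 qk; clear; lra.
have hj : dens R (A :&: X) + dens R (A :&: Y) - dens R A <= dens R (A :&: X :&: Y).
  by move: g7 g8 g10 g11 g12; clear; lra.
apply: final h1 h2 h3 h4 hj h5 => //; by move: zX zY sum tot; clear; lra.
Qed.

(** The two clauses are the two blocks of the double cover: [z] is the least size of the sets, [t]
    the permitted shortfall and [k] the guaranteed density of arcs. *)
Definition robust (R : realFieldType) (V : finType) (e : rel V) (S T : {set V}) (z t k : R) : Prop :=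
  (forall X Y : {set V}, X \subset S -> Y \subset ~: T -> z <= dens R X -> z <= dens R Y ->
     dens R S - t <= dens R X + dens R Y -> k < adens R e X Y) /\
  (forall X Y : {set V}, X \subset ~: S -> Y \subset T -> z <= dens R X -> z <= dens R Y ->
     dens R T - t <= dens R X + dens R Y -> k < adens R e X Y).

Lemma robust_of_near_extremal (R : realFieldType) (V : finType) (e : rel V) (S T : {set V})
    (s q k t z : R) :
  (0 < #|V|)%N -> oriented_graph e -> ore e -> 2 <= q * #|V|%:R ->
  adens R e S T <= q -> near_extremal e S T s -> 0 < s -> q <= k ->
  10 * k + 60 * s <= t * t -> 40 * s <= t -> 100 * t <= z * z -> 0 < z -> 10 * z <= 1 ->
  robust e S T z t k.
Proof.
move=> n0 oe ore_e qn eST ne s0 qk kt st tz z0 z1.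
have eST' : adens R (fun x y => e y x) T S <= q by rewrite (adens_rev R e T S).
split=> X Y XS YT zX zY sum; rewrite ltNge; apply/negP=> eXY.
  exact: (near_extremal_robust n0 oe ore_e qn eST ne s0 qk kt st tz z0 z1 XS YT).
have eYX : adens R (fun x y => e y x) Y X <= k by rewrite (adens_rev R e Y X).
rewrite [leRHS]addrC in sum.
exact: (near_extremal_robust n0 (oriented_rev oe) (ore_rev ore_e) qn eST' (near_extremal_rev ne)
  s0 qk kt st tz z0 z1 YT XS zY zX sum eYX).
Qed.

Lemma robust_shift (R : realFieldType) (V : finType) (e : rel V) (S T S' T' : {set V}) (z t k w : R) :
  dens R (S :\: S') <= w -> dens R (S' :\: S) <= w -> dens R (T :\: T') <= w ->
  dens R (T' :\: T) <= w -> robust e S T z t k -> robust e S' T' (z + w) (t - 3 * w) k.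
Proof.
move=> h1 h2 h3 h4 [r1 r2].
have sub (X P Q : {set V}) : X \subset P -> dens R X - dens R (P :\: Q) <= dens R (X :&: Q).
  by move=> XP; have := dens_split R X Q; have := dens_sub R (setSD Q XP); lra.
have dS := dens_split R S S'; have := dens_sub R (subsetIr S S') => dS'.
have dT := dens_split R T T'; have := dens_sub R (subsetIr T T') => dT'.
have cS : ~: S' :\: ~: S = S :\: S' by apply/setP=> v; rewrite !inE; do ?case: (_ \in _).
have cT : ~: T' :\: ~: T = T :\: T' by apply/setP=> v; rewrite !inE; do ?case: (_ \in _).
split=> X Y XS YT zX zY sum.
  have uX := sub X S' S XS; have uY := sub Y (~: T') (~: T) YT; rewrite cT in uY.
  apply: lt_le_trans (adens_sub R e (subsetIl X S) (subsetIl Y (~: T))).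
  by apply: r1; rewrite ?subsetIr //; move: uX uY zX zY sum dS dS' h1 h2 h3 h4; clear; lra.
have uX := sub X (~: S') (~: S) XS; have uY := sub Y T' T YT; rewrite cS in uX.
apply: lt_le_trans (adens_sub R e (subsetIl X (~: S)) (subsetIl Y T)).
by apply: r2; rewrite ?subsetIr //; move: uX uY zX zY sum dT dT' h1 h2 h3 h4; clear; lra.
Qed.

Lemma dens_setC (R : realFieldType) (V : finType) (X : {set V}) : (0 < #|V|)%N ->
  dens R (~: X) = 1 - dens R X.
Proof.
move=> n0; have := dens_split R setT X; rewrite setTI setTD.
by have := dens_setT R n0 => -> ->; rewrite addrC addKr.
Qed.

(** Complementation interchanges the two blocks; because [dens R S + dens R T <= 1], the new size
    conditions imply the old ones. *)
Lemma robust_setC (R : realFieldType) (V : finType) (e : rel V) (S T : {set V}) (z t k : R) :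
  (0 < #|V|)%N -> dens R S + dens R T <= 1 -> robust e S T z t k -> robust e (~: S) (~: T) z t k.
Proof.
move=> n0 ST [r1 r2]; split=> X Y; rewrite ?setCK (dens_setC R _ n0) => XS YT zX zY sum.
  by apply: r2 => //; lra.
by apply: r1 => //; lra.
Qed.

Lemma noncross_setC (V : finType) (e : rel V) (S T : {set V}) :
  noncross e (~: S) (~: T) =2 noncross e S T.
Proof. by move=> x y; rewrite /noncross !inE; case: (x \in S); case: (y \in T). Qed.

Lemma arcs_eq (V : finType) (e e' : rel V) (X Y : {set V}) :
  {in X & Y, forall x y, e x y = e' x y} -> arcs e X Y = arcs e' X Y.
Proof. by move=> ee; apply: eq_bigr => x xX; apply: eq_bigr => y yY; rewrite ee. Qed.

Lemma arcs_noncross (V : finType) (e : rel V) (S T X Y : {set V}) :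
  X \subset S /\ Y \subset ~: T \/ X \subset ~: S /\ Y \subset T ->
  arcs (noncross e S T) X Y = arcs e X Y.
Proof.
move=> XY; apply: arcs_eq => x y xX yY; rewrite /noncross.
case: XY => -[/subsetP/(_ x xX) xS /subsetP/(_ y yY) yT].
  by move: yT; rewrite inE xS => ->; rewrite andbT.
by move: xS; rewrite inE yT => /negbTE ->; rewrite andbT.
Qed.

(** Cut [X] along [S] and its complement along [T]. The shortfalls of the two resulting pairs add up
    to the density of [D] minus that of [B], which is at most [t1], so one pair falls short by at
    most [t1]. If one of its members is smaller than [z1], the other pair has members of size at
    least [z2] and a shortfall of at most [t2]. *)
Lemma robust_connected (R : realFieldType) (V : finType) (e : rel V) (S T X : {set V})
    (z1 t1 z2 t2 k w : R) :
  (0 < #|V|)%N -> robust e S T z1 t1 k -> robust e S T z2 t2 k ->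
  0 < z1 -> 0 <= t1 -> z1 + 2 * t1 <= t2 -> z1 + z2 <= w -> z1 + z2 <= 1 / 5 ->
  1 / 5 <= dens R (~: (S :|: T)) -> 1 / 5 <= dens R (S :&: T) ->
  - t1 <= dens R S + dens R T - 1 <= t1 -> w <= dens R X -> w <= dens R (~: X) ->
  k < adens R (noncross e S T) X (~: X).
Proof.
move=> n0 [r11 r12] [r21 r22] z10 t10 zt zw z5 bB bD /andP[ST1 ST2] wX wZ.
set P := X :&: S; set P' := ~: X :\: T; set Q := X :\: S; set Q' := ~: X :&: T.
have k1 : k < adens R e P P' -> k < adens R (noncross e S T) X (~: X).
  move=> h; apply: lt_le_trans h _.
  have -> : adens R e P P' = adens R (noncross e S T) P P'.
    by rewrite /adens arcs_noncross //; left; split; rewrite /P /P' ?setDE subsetIr.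
  by apply: adens_sub; rewrite ?subsetIl ?subsetDl.
have k2 : k < adens R e Q Q' -> k < adens R (noncross e S T) X (~: X).
  move=> h; apply: lt_le_trans h _.
  have -> : adens R e Q Q' = adens R (noncross e S T) Q Q'.
    by rewrite /adens arcs_noncross //; right; split; rewrite /Q /Q' ?setDE subsetIr.
  by apply: adens_sub; rewrite ?subsetIl ?subsetDl.
have PS : P \subset S by apply: subsetIr.
have PT : P' \subset ~: T by rewrite /P' setDE subsetIr.
have QS : Q \subset ~: S by rewrite /Q setDE subsetIr.
have QT : Q' \subset T by apply: subsetIr.
have q11 := r11 P P' PS PT; have q21 := r21 P P' PS PT.
have q12 := r12 Q Q' QS QT; have q22 := r22 Q Q' QS QT.
set D := S :&: T in bD; set B := ~: (S :|: T) in bB.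
have f1 := dens_split R X S; have f2 := dens_split R (~: X) T.
have f3 := dens_split R D X; have f4 := dens_split R B X.
have s1 : dens R P + dens R P' - dens R S = dens R (B :\: X) - dens R (D :\: X).
  rewrite (dens_split R S X) (dens_split R (S :\: X) T) (dens_split R P' S) (setIC S X) -/P.
  have -> : (S :\: X) :&: T = D :\: X by apply/setP=> v; rewrite /D /B /P /P' /Q /Q' !inE; do ?case: (_ \in _).
  have -> : P' :\: S = B :\: X by apply/setP=> v; rewrite /D /B /P /P' /Q /Q' !inE; do ?case: (_ \in _).
  have -> : P' :&: S = S :\: X :\: T by apply/setP=> v; rewrite /D /B /P /P' /Q /Q' !inE; do ?case: (_ \in _).
  by ring.
have s2 : dens R Q + dens R Q' - dens R T = dens R (B :&: X) - dens R (D :&: X).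
  rewrite (dens_split R T X) (dens_split R (T :&: X) S) (dens_split R Q T).
  have -> : T :&: X :&: S = D :&: X by apply/setP=> v; rewrite /D /B /P /P' /Q /Q' !inE; do ?case: (_ \in _).
  have -> : Q :\: T = B :&: X by apply/setP=> v; rewrite /D /B /P /P' /Q /Q' !inE; do ?case: (_ \in _).
  have -> : T :&: X :\: S = Q :&: T by apply/setP=> v; rewrite /D /B /P /P' /Q /Q' !inE; do ?case: (_ \in _).
  have -> : T :\: X = Q' by apply/setP=> v; rewrite /D /B /P /P' /Q /Q' !inE; do ?case: (_ \in _).
  by ring.
have tot : dens R S + dens R T - 1 = dens R D - dens R B.
  rewrite -(class_sum R S T n0) (dens_split R S T) (dens_split R T S) (setIC T) -/D -/B; ring.
have g1 : dens R (D :&: X) <= dens R P.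
  by apply: dens_sub; apply/subsetP=> v; rewrite !inE => /andP[/andP[-> _] ->].
have g2 : dens R (D :\: X) <= dens R Q'.
  by apply: dens_sub; apply/subsetP=> v; rewrite !inE => /andP[-> /andP[_ ->]].
have g3 : dens R (B :&: X) <= dens R Q.
  by apply: dens_sub; apply/subsetP=> v; rewrite !inE negb_or => /andP[/andP[-> _] ->].
have g4 : dens R (B :\: X) <= dens R P'.
  by apply: dens_sub; apply/subsetP=> v; rewrite !inE negb_or => /andP[-> /andP[_ ->]].
have p1 := dens_ge0 R (D :&: X); have p2 := dens_ge0 R (D :\: X).
have p3 := dens_ge0 R (B :&: X); have p4 := dens_ge0 R (B :\: X).
rewrite -/P -/Q in f1; rewrite -/P' -/Q' in f2.
move: (dens R (D :&: X)) (dens R (D :\: X)) (dens R (B :&: X)) (dens R (B :\: X)) s1 s2 f3 f4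
  g1 g2 g3 g4 p1 p2 p3 p4 => xd zd xb zb s1 s2 f3 f4 g1 g2 g3 g4 p1 p2 p3 p4.
move: q11 q12 q21 q22 k1 k2 f1 f2 s1 s2 g1 g2 g3 g4 tot f3 f4 bB bD ST1 ST2 wX wZ.
move: (dens R P) (dens R P') (dens R Q) (dens R Q') (dens R S) (dens R T) (dens R X) (dens R (~: X))
  (dens R D) (dens R B) => p p' r r' ds dt dx dz d b.
move=> q11 q12 q21 q22 k1 k2 f1 f2 s1 s2 g1 g2 g3 g4 tot f3 f4 bB bD ST1 ST2 wX wZ.
clear r11 r12 r21 r22 PS PT QS QT.
have [h|h] := leP (- t1) (zb - zd).
  have [c1|c1] := leP z1 p; [have [c2|c2] := leP z1 p'|].
  - by apply: k1; apply: q11 => //; clear -s1 h; lra.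
  - by apply: k2; apply: q22; clear -c2 h zt zw z5 s2 g1 g2 g3 g4 tot f2 f3 f4 bB bD ST1 ST2 wZ p1 p2 p3 p4 z10 t10; lra.
  - by apply: k2; apply: q22; clear -c1 h zt zw z5 s2 g1 g2 g3 g4 tot f1 f3 f4 bB bD ST1 ST2 wX p1 p2 p3 p4 z10 t10; lra.
have {}h : - t1 <= xb - xd by clear -h tot ST1 ST2 f3 f4 t10; lra.
have [c1|c1] := leP z1 r; [have [c2|c2] := leP z1 r'|].
- by apply: k2; apply: q12 => //; clear -s2 h; lra.
- by apply: k1; apply: q21; clear -c2 h zt zw z5 s1 g1 g2 g3 g4 tot f2 f3 f4 bB bD ST1 ST2 wZ p1 p2 p3 p4 z10 t10; lra.
- by apply: k1; apply: q21; clear -c1 h zt zw z5 s1 g1 g2 g3 g4 tot f1 f3 f4 bB bD ST1 ST2 wX p1 p2 p3 p4 z10 t10; lra.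
Qed.

(** * Few vertices change sides *)

Lemma adens_rows_leq (R : realFieldType) (V : finType) (e : rel V) (X Y : {set V}) (m : nat) :
  (0 < #|V|)%N -> (forall x, x \in X -> m * #|[set y in Y | e x y]| <= #|V|)%N ->
  m%:R * adens R e X Y <= dens R X.
Proof.
move=> n0 h; have nR : 0 < #|V|%:R :> R by rewrite ltr0n.
have : (m * arcs e X Y <= #|X| * #|V|)%N.
  by rewrite arcs_rows big_distrr /= -sum_nat_const; apply: leq_sum.
rewrite -(ler_nat R) !natrM /adens /dens mulrA => {}h.
by rewrite ler_pdivrMr ?mulr_gt0 // mulrA divfK ?gt_eqF.
Qed.

Lemma adens_rows_geq (R : realFieldType) (V : finType) (e : rel V) (X Y : {set V}) (m : nat) :
  (0 < #|V|)%N -> (forall x, x \in X -> #|V| <= m * #|[set y in Y | e x y]|)%N ->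
  dens R X <= m%:R * adens R e X Y.
Proof.
move=> n0 h; have nR : 0 < #|V|%:R :> R by rewrite ltr0n.
have : (#|X| * #|V| <= m * arcs e X Y)%N.
  by rewrite arcs_rows big_distrr /= -sum_nat_const; apply: leq_sum.
rewrite -(ler_nat R) !natrM /adens /dens mulrA => {}h.
by rewrite ler_pdivlMr ?mulr_gt0 // mulrA divfK ?gt_eqF.
Qed.

Lemma few_bad_real (R : realFieldType) (a b c d x e1 e2 e3 s q : R) :
  0 < s -> 100 * (1000 * s) <= 1 -> 0 <= q -> 10 * q <= s -> 1 / 4 - 25 * s <= d -> d <= 1 / 4 + s ->
  b <= 1 / 4 + 2 * s -> c <= 1 / 10 -> 0 <= x -> x <= b ->
  40 * e1 <= x -> e2 <= 25 * s + b * x -> e3 <= q + c * d / 2 + b * d + 30 * s ->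
  3 / 4 * (x * d - e1) - q <= d * (e1 + e2) + x * e3 -> x <= 700 * s.
Proof.
move=> s0 s1 q0 qs d1 d2 bu c10 x0 xb h1 h2 h3 h.
have d24 : 24 / 100 <= d by clear -s0 s1 d1; lra.
have k2 : d * (e1 + e2) <= d * (x / 40 + 25 * s + b * x).
  by apply: ler_wpM2l; [clear -d24; lra | clear -h1 h2; lra].
have k3 : x * e3 <= x * (q + c * d / 2 + b * d + 30 * s) by apply: ler_wpM2l.
have k4 : d * (2 * b + c / 2) <= d * (11 / 20 + 4 * s).
  by apply: ler_wpM2l; [clear -d24; lra | clear -bu c10; lra].
have k5 : x * (d * (2 * b + c / 2)) <= x * (d * (11 / 20 + 4 * s)) by apply: ler_wpM2l.
have k6 : x * s <= 26 / 100 * s.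
  by apply: ler_wpM2r; [exact: ltW | clear -xb bu s0 s1; lra].
have k7 : x * q <= 26 / 100 * q by apply: ler_wpM2r => //; clear -xb bu s0 s1; lra.
have k8 : x * (24 / 100) <= x * d by apply: ler_wpM2l.
have k9 : d * s <= 26 / 100 * s.
  by apply: ler_wpM2r; [exact: ltW | clear -d2 s0 s1; lra].
have k10 : x * d * s <= x * d * (1 / 1000).
  by apply: ler_wpM2l; [apply: mulr_ge0 => //; clear -d24; lra | clear -s1 s0; lra].
have {}h : x * (3 / 4 * d - 3 / 160 - d / 40) <= q + 25 * (d * s) + x * q + 30 * (x * s) + x * (d * (2 * b + c / 2)).
  move: h k2 k3 h1; clear; lra.
by clear -h k5 k6 k7 k8 k9 k10 s0 q0 qs x0; lra.
Qed.

(** Bad tails in [C] are few because [C -> D] is almost complete, and bad tails in [B] because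
    [B -> C] is, provided [C] is not small. If it is, the degree condition between the bad tails in
    [B] and [D] limits them to [700 * s]. *)
Lemma few_bad_tails (R : realFieldType) (V : finType) (e : rel V) (S T X : {set V}) (s q : R) :
  (0 < #|V|)%N -> oriented_graph e -> ore e -> 2 <= q * #|V|%:R ->
  adens R e S T <= q -> near_extremal e S T s -> 0 < s -> 100 * (1000 * s) <= 1 -> 10 * q <= s ->
  X \subset ~: S -> (forall x, x \in X -> 40 * #|[set y in T | e x y]| <= #|V|)%N ->
  dens R X <= 1000 * s.
Proof.
move=> n0 oe ore_e qn eST ne s0 s1 qs XS low.
have [[/andP[bl bu] /andP[dl du] hDA hCD] [[hAB hBC hAA hCC] [hDB hBD]]] := ne.
have q0 : 0 <= q by apply: le_trans eST; apply: adens_ge0.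
set A := S :\: T in hDA hAB hAA hBD *; set B := ~: (S :|: T) in bl bu hAB hBC hDB hBD *.
set C := T :\: S in hCD hBC hCC hDB *; set D := S :&: T in dl du hDA hCD hDB hBD *.
have XC : X :&: T \subset C.
  by apply/subsetP=> v; rewrite !inE => /andP[/(subsetP XS) vX ->]; rewrite inE in vX; rewrite vX.
have XB : X :\: T \subset B.
  by apply/subsetP=> v; rewrite !inE => /andP[vT /(subsetP XS) vX]; rewrite inE in vX; rewrite negb_or vX.
have lowC : 40 * adens R e (X :&: T) T <= dens R (X :&: T).
  by apply: adens_rows_leq => // x /setIP[/low].
have lowB : 40 * adens R e (X :\: T) T <= dens R (X :\: T).
  by apply: adens_rows_leq => // x /setDP[/low].
have f1 := deficit_sub R e XC (subxx D); have f2 := deficit_sub R e XB (subxx C).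
have f3 := deficit_sub R e (subxx A) XB.
have g1 := adens_sub R e (subxx (X :&: T)) (subsetIr S T); rewrite -/D in g1.
have g2 := adens_sub R e (subxx (X :\: T)) (subsetDl T S); rewrite -/C in g2.
have g3 := adens_sub R e (subxx (X :\: T)) (subsetIr S T); rewrite -/D in g3.
have xC0 := dens_ge0 R (X :&: T); have xB0 := dens_ge0 R (X :\: T).
have xCs : dens R (X :&: T) <= 100 * s.
  have : dens R (X :&: T) * (24 / 100) <= dens R (X :&: T) * dens R D.
    by apply: ler_wpM2l => //; move: dl s0 s1; clear; lra.
  by move: f1 g1 lowC hCD s0; clear; lra.
suff xBs : dens R (X :\: T) <= 700 * s by rewrite (dens_split R X T); clear -xCs xBs s0; lra.
have [c10|c10] := leP (dens R C) (1 / 10); last first.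
  have : dens R (X :\: T) * (1 / 10) <= dens R (X :\: T) * dens R C.
    by apply: ler_wpM2l => //; move: c10; clear; lra.
  by move: f2 g2 lowB hBC s0; clear; lra.
have h := ore_density (X :\: T) D n0 oe ore_e qn.
rewrite (adens_from R e (X :\: T) S T) (adens_to R e D S T) -/A -/B -/C in h.
have u1 := adens_anti R A (X :\: T) oe; have u2 := adens_leq R e (X :\: T) B.
have u3 := adens_sub R e (subxx S) (subsetIr S T); rewrite -/D in u3.
have u4 := adens_leq R e C D; have u5 := adens_anti R B D oe.
have xb := dens_sub R XB.
apply: (@few_bad_real R (dens R A) (dens R B) (dens R C) (dens R D) _ (adens R e (X :\: T) T)
  (adens R e (X :\: T) A + adens R e (X :\: T) B)
  (adens R e S D + adens R e C D + adens R e B D) s q s0 s1 q0 qs dl du bu c10 xB0 xb lowB _ _ _).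
- by move: u1 u2 f3 hAB; clear; lra.
- by move: u3 u4 u5 eST hDB; clear; lra.
- by move: h g3; clear; lra.
Qed.

Lemma dens_side_added (R : realFieldType) (V : finType) (e : rel V) (S T : {set V}) (s q : R) :
  (0 < #|V|)%N -> oriented_graph e -> ore e -> 2 <= q * #|V|%:R ->
  adens R e S T <= q -> near_extremal e S T s -> 0 < s -> 100 * (1000 * s) <= 1 -> 10 * q <= s ->
  dens R (side e S T :\: S) <= 1000 * s.
Proof.
move=> n0 oe ore_e qn eST ne s0 s1 qs.
apply: (few_bad_tails n0 oe ore_e qn eST ne s0 s1 qs); first by rewrite setDE subsetIr.
by move=> x /setDP[]; rewrite inE => h xS; move: h; rewrite (negbTE xS) => /ltnW.
Qed.

(** A vertex leaving [S] has at least [(1 / 8 - 1 / 40) * #|V| = #|V| / 10] out-neighbours in [T],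
    and there are few arcs from [S] to [T]. *)
Lemma dens_side_removed (R : realFieldType) (V : finType) (e : rel V) (S T : {set V}) (q : R) :
  (100 <= #|V|)%N -> oriented_graph e -> ore e -> adens R e S T <= q ->
  dens R (S :\: side e S T) <= 10 * q.
Proof.
move=> n0 oe ore_e eST.
apply: (@le_trans _ _ (10 * adens R e (S :\: side e S T) T)); last first.
  by rewrite ler_pM2l // (le_trans _ eST) // adens_sub ?subsetDl.
apply: adens_rows_geq => [|x /setDP[xS]]; first exact: leq_trans n0.
rewrite inE xS -ltnNge; have := ore_outdeg x oe ore_e n0; rewrite (outdeg_split e T); clear.
by move: #|[set y in T | e x y]| #|[set y in ~: T | e x y]| #|V|; lia.
Qed.

Lemma dens_nat (R : realFieldType) (V : finType) (X : {set V}) (m : nat) (w : R) :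
  (0 < #|V|)%N -> dens R X <= w -> m%:R * w <= 1 -> (m * #|X| <= #|V|)%N.
Proof.
move=> n0 h mw; have nR : 0 < #|V|%:R :> R by rewrite ltr0n.
rewrite -(ler_nat R) natrM -[leRHS]mul1r -ler_pdivrMr // -mulrA.
by apply: le_trans mw; apply: ler_wpM2l; rewrite ?ler0n.
Qed.

(** * Hamilton cycles near the extremal structure *)

Lemma robust_weaken (R : realFieldType) (V : finType) (e : rel V) (S T : {set V}) (z t z' t' k : R) :
  z <= z' -> t' <= t -> robust e S T z t k -> robust e S T z' t' k.
Proof.
by move=> zz tt [r1 r2]; split=> X Y XS YT zX zY sum; [apply: r1 | apply: r2] => //; lra.
Qed.

Lemma dens_geq (R : realFieldType) (V : finType) (X : {set V}) (m : nat) (w : R) :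
  (0 < #|V|)%N -> (#|V| <= m * #|X|)%N -> m%:R * w <= 1 -> w <= dens R X.
Proof.
move=> n0 h mw; have nR : 0 < #|V|%:R :> R by rewrite ltr0n.
have m0 : 0 < m%:R :> R by rewrite ltr0n lt0n; apply: contraTneq (leq_trans n0 h) => ->; rewrite mul0n.
by rewrite -(ler_pM2l m0) (le_trans mw) // mulrA ler_pdivlMr // mul1r -natrM ler_nat h.
Qed.

Lemma arcs_geq (R : realFieldType) (V : finType) (e : rel V) (X Y : {set V}) (m : nat) (k : R) :
  (0 < #|V|)%N -> k < adens R e X Y -> 1 <= k * m%:R -> (#|V| ^ 2 <= m * arcs e X Y)%N.
Proof.
move=> n0 h km; have nR : 0 < #|V|%:R :> R by rewrite ltr0n.
rewrite -mulnn -(ler_nat R) !natrM.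
rewrite ltr_pdivlMr ?mulr_gt0 // in h.
have := ler_wpM2l (ler0n R m) (ltW h); apply: le_trans.
by rewrite mulrA (mulrC m%:R) -[leLHS]mul1r ler_wpM2r // mulr_ge0 ?ltW.
Qed.

Lemma dens_sum_geq (R : realFieldType) (V : finType) (S X Y : {set V}) (m : nat) (t : R) :
  (0 < #|V|)%N -> (m * #|S| <= m * (#|X| + #|Y|) + #|V|)%N -> 1 <= t * m%:R ->
  dens R S - t <= dens R X + dens R Y.
Proof.
move=> n0 h tm; have nR : 0 < #|V|%:R :> R by rewrite ltr0n.
have m0 : 0 < m%:R :> R.
  rewrite lt0r ler0n andbT; apply/negP=> /eqP m0; move: tm; rewrite m0 mulr0; lra.
rewrite lerBlDr -mulrDl ler_pdivrMr // -(ler_pM2l m0).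
move: h; rewrite -(ler_nat R) natrD !natrM natrD => /le_trans; apply.
have -> : m%:R * (((#|X|%:R + #|Y|%:R) / #|V|%:R + t) * #|V|%:R) =
   m%:R * (#|X|%:R + #|Y|%:R) + (t * m%:R) * #|V|%:R :> R by field; rewrite gt_eqF.
by rewrite lerD2l -[leLHS]mul1r ler_wpM2r // ltW.
Qed.

Lemma robust_pair_hamilton (R : realFieldType) (M2 : nat) (z1 t1 z2 t2 k : R) :
  (400 <= M2)%N -> 1 <= k * M2%:R -> 1 <= t1 * M2%:R -> 0 < z1 -> 0 <= t1 ->
  z1 + 2 * t1 <= t2 -> 0 < z2 -> 400 * (z1 + z2) <= 1 ->
  exists M3 n0, forall (V : finType) (e : rel V) (S T : {set V}) (t : nat) ps,
    (n0 <= #|V|)%N -> irreflexive e ->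
    (forall x, #|V| <= 50 * #|[set y | noncross e S T x y]|)%N ->
    (forall y, #|V| <= 50 * #|[set x | noncross e S T x y]|)%N ->
    robust e S T z1 t1 k -> robust e S T z2 t2 k ->
    1 / 5 <= dens R (~: (S :|: T)) -> 1 / 5 <= dens R (S :&: T) ->
    - t1 <= dens R S + dens R T - 1 <= t1 ->
    (#|S| + #|T| = #|V| + t)%N -> cross_forest e S T t ps -> (M3 * (2 * t) <= #|V|)%N ->
    has_hamilton_cycle e.
Proof.
move=> M400 kM tM z10 t10 zt z20 z400.
have [M3 [n0 H]] := @robust_hamilton 50 400 M2 isT isT M400.
exists M3, n0.+1 => V e S T t ps nbig irr out in_ r1 r2 bB bD ST card F small.
have n0' : (0 < #|V|)%N by apply: leq_trans nbig.
have [r11 r12] := r1.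
have zz (X : {set V}) : (#|V| <= 400 * #|X|)%N -> z1 + z2 <= dens R X.
  by move=> h; apply: dens_geq h z400.
have z1z (x : R) : z1 + z2 <= x -> z1 <= x by move: z20; clear; lra.
apply: (H V e S T ps (ltnW nbig) irr out in_).
- move=> X hX hX'; apply: (arcs_geq n0' _ kM).
  apply: (robust_connected n0' r1 r2 z10 t10 zt (lexx _) _ bB bD ST) => //.
  + by move: z400; clear; lra.
  + exact: zz.
  + exact: zz.
- move=> X Y XS YT hX hY sum; rewrite arcs_noncross; last by left.
  apply: (arcs_geq n0' _ kM); apply: r11 => //; [exact/z1z/zz | exact/z1z/zz |].
  exact: dens_sum_geq sum tM.
- move=> X Y XS YT hX hY sum; rewrite arcs_noncross; last by right.
  apply: (arcs_geq n0' _ kM); apply: r12 => //; [exact/z1z/zz | exact/z1z/zz |].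
  exact: dens_sum_geq sum tM.
- exact: cross_forest_paths F.
- by case: F.
- by rewrite (cross_forest_excess F) -PoszD card PoszD addrC addKr.
- by apply: leq_trans small; rewrite leq_mul2l; case: F => _ _ _ ->; rewrite orbT.
Qed.

Lemma dens_card_geq (R : realFieldType) (V : finType) (X : {set V}) (w : R) :
  (0 < #|V|)%N -> w <= dens R X -> w * #|V|%:R <= #|X|%:R.
Proof. by move=> n0; rewrite ler_pdivlMr // ltr0n. Qed.

Lemma dens_cover (R : realFieldType) (V : finType) (X Y Z W : {set V}) :
  X \subset Y :|: Z :|: W -> dens R X <= dens R Y + dens R Z + dens R W.
Proof.
move=> XYZ; rewrite /dens -!mulrDl -!natrD; apply: ler_wpM2r; first by rewrite invr_ge0.
rewrite ler_nat; apply: leq_trans (subset_leq_card XYZ) _.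
by apply: leq_trans (leq_card_setU _ _) _; rewrite leq_add2r leq_card_setU.
Qed.

(** If [#|S| + #|T| < #|V|], both sets are replaced by their complements. This preserves the
    noncrossing arcs, interchanges [B] with [D] and makes the imbalance nonnegative, as the forest
    of crossing arcs requires. *)
Lemma balanced_pair_hamilton (R : realFieldType) (M2 : nat) (z1 t1 z2 t2 k : R) :
  (400 <= M2)%N -> 1 <= k * M2%:R -> 1 <= t1 * M2%:R -> 0 < z1 -> 0 <= t1 ->
  z1 + 2 * t1 <= t2 -> 0 < z2 -> 400 * (z1 + z2) <= 1 ->
  exists M3 n0, forall (V : finType) (e : rel V) (S T : {set V}) (r : R),
    (n0 <= #|V|)%N -> oriented_graph e -> ore e ->
    (forall x, #|V| <= 50 * #|[set y | noncross e S T x y]|)%N ->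
    (forall y, #|V| <= 50 * #|[set x | noncross e S T x y]|)%N ->
    robust e S T z1 t1 k -> robust e S T z2 t2 k ->
    24 / 100 <= dens R (~: (S :|: T)) -> 24 / 100 <= dens R (S :&: T) ->
    1 / 5 <= dens R (T :\: S) \/ 1 / 5 <= dens R (S :\: T) ->
    - r <= dens R S + dens R T - 1 <= r -> r <= t1 -> 100 * (100 * r) <= 1 -> r * M3%:R <= 1 ->
    has_hamilton_cycle e.
Proof.
move=> M400 kM tM z10 t10 zt z20 z400.
have [M3 [n0 H]] := robust_pair_hamilton M400 kM tM z10 t10 zt z20 z400.
have [N hN] : exists N, (200 * 200 <= N)%N by exists (200 * 200)%N.
exists (2 * M3)%N, (n0 + N)%N => V e.
suff nonneg (S T : {set V}) (r : R) : (n0 + N <= #|V|)%N -> oriented_graph e -> ore e ->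
    (forall x, #|V| <= 50 * #|[set y | noncross e S T x y]|)%N ->
    (forall y, #|V| <= 50 * #|[set x | noncross e S T x y]|)%N ->
    robust e S T z1 t1 k -> robust e S T z2 t2 k ->
    24 / 100 <= dens R (~: (S :|: T)) -> 24 / 100 <= dens R (S :&: T) ->
    1 / 5 <= dens R (T :\: S) \/ 1 / 5 <= dens R (S :\: T) ->
    - r <= dens R S + dens R T - 1 <= r -> r <= t1 -> 100 * (100 * r) <= 1 ->
    r * (2 * M3)%N%:R <= 1 -> (#|V| <= #|S| + #|T|)%N -> has_hamilton_cycle e.
  move=> S T r nbig oe ore_e out in_ r1 r2 bB bD AC ST rt r1' rM.
  have [big|small] := leqP #|V| (#|S| + #|T|)%N.
    exact: (nonneg S T r nbig oe ore_e out in_ r1 r2 bB bD AC ST rt r1' rM big).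
  have V0 : (0 < #|V|)%N by apply: leq_ltn_trans small.
  have ST1 : dens R S + dens R T <= 1.
    by rewrite -mulrDl ler_pdivrMr ?ltr0n // mul1r -natrD ler_nat ltnW.
  apply: (nonneg (~: S) (~: T) r nbig oe ore_e _ _ (robust_setC V0 ST1 r1) (robust_setC V0 ST1 r2)
    _ _ _ _ rt r1' rM).
  - move=> x; apply: leq_trans (out x) _; rewrite leq_mul2l /= subset_leq_card //.
    by apply/subsetP=> y; rewrite !inE noncross_setC.
  - move=> y; apply: leq_trans (in_ y) _; rewrite leq_mul2l /= subset_leq_card //.
    by apply/subsetP=> x; rewrite !inE noncross_setC.
  - by rewrite setCU !setCK.
  - by rewrite -setCU.
  - have E (P Q : {set V}) : ~: P :\: ~: Q = Q :\: P by apply/setP=> v; rewrite !inE negbK andbC.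
    by rewrite !E; case: AC; [right|left].
  - by rewrite !(dens_setC R _ V0); move: ST => /andP[]; clear; move=> h1 h2; apply/andP; split; lra.
  - have := cardsC S; have := cardsC T; move: small; clear.
    by move: #|~: S| #|~: T| #|S| #|T| #|V|; lia.
move=> nbig oe ore_e out in_ r1 r2 bB bD AC /andP[ST1 ST2] rt r1' rM big.
have nN : (N <= #|V|)%N by apply: leq_trans nbig; apply: leq_addl.
have V0 : (0 < #|V|)%N by apply: leq_trans nN; apply: leq_trans hN; rewrite muln_gt0.
have nR : 0 < #|V|%:R :> R by rewrite ltr0n.
have card : (#|S| + #|T| = #|V| + (#|S| + #|T| - #|V|))%N by rewrite subnKC.
set t := (#|S| + #|T| - #|V|)%N in card.
have tr : t%:R <= r * #|V|%:R.
  have -> : t%:R = (dens R S + dens R T - 1) * #|V|%:R :> R.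
    rewrite mulrBl mulrDl mul1r !divfK ?gt_eqF //.
    by rewrite -[in RHS]natrD card natrD addrAC subrr add0r.
  by rewrite ler_wpM2r // ltW.
have tr' : 100 * (100 * t%:R) <= #|V|%:R :> R.
  have : 100 * (100 * r) * #|V|%:R <= 1 * #|V|%:R by rewrite ler_wpM2r // ltW.
  by move: tr; clear; lra.
have D' := dens_card_geq V0 bD.
have nN' : (200 * 200 <= #|V|)%N by apply: leq_trans nN.
have tn : (100 * (100 * t) <= #|V|)%N by rewrite -(ler_nat R) !natrM.
have Dn : (#|V| + 5 * t <= 5 * #|S :&: T|)%N.
  by rewrite -(ler_nat R) natrD !natrM; move: D' tr' nR; clear; lra.
have ACn : (#|V| + 6 * t <= 6 * #|T :\: S| \/ #|V| + 6 * t <= 6 * #|S :\: T|)%N.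
  case: AC => /(dens_card_geq V0) h; [left|right];
    by rewrite -(ler_nat R) natrD !natrM; move: h tr' nR; clear; lra.
have [ps F] := cross_forest_exists oe ore_e nN' tn card Dn ACn.
apply: (H V e S T t ps _ _ out in_ r1 r2 _ _ _ card F).
- by apply: leq_trans nbig; apply: leq_addr.
- by case: oe.
- by apply: le_trans bB; clear; lra.
- by apply: le_trans bD; clear; lra.
- by apply/andP; split; move: ST1 ST2 rt; clear; lra.
- rewrite -(ler_nat R) natrM natrM mulrA [_ * 2]mulrC -natrM.
  apply: (@le_trans _ _ ((2 * M3)%:R * (r * #|V|%:R))); first by apply: ler_wpM2l.
  by rewrite mulrCA mulrA -[leRHS]mul1r ler_wpM2r // ltW.
Qed.

(* The scale parameters satisfy s << k << t1 << z1 << t2 << z2. *)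
Lemma tight_hamilton (R : realFieldType) (M2 : nat) (z1 t1 z2 t2 k : R) :
  (400 <= M2)%N -> 1 <= k * M2%:R -> 2 <= t1 * M2%:R -> 0 < t1 -> 0 < z1 -> 0 < z2 -> 0 < k ->
  100 * t1 <= z1 * z1 -> 5 * z1 <= t2 -> 100 * t2 <= z2 * z2 -> 2000 * z2 <= 1 ->
  20 * k <= t1 * t1 ->
  exists M3 n0, forall (V : finType) (e : rel V) (S T : {set V}) (s q : R),
    (n0 <= #|V|)%N -> oriented_graph e -> ore e -> 2 <= q * #|V|%:R ->
    0 < s -> 120 * s <= t1 * t1 -> 10 * q <= s -> q <= k ->
    100 * (100 * s) * M3%:R <= 1 -> adens R e S T <= q -> near_extremal e S T s ->
    has_hamilton_cycle e.
Proof.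
move=> M400 kM tM t10 z10 z20 k0 tz1 zt tz2 z2s kt.
have z2z : z2 * z2 <= 1 / 2000 * z2 by apply: ler_wpM2r; [apply: ltW | clear -z2s; lra].
have z1s : 1000 * (1000 * z1) <= 1 by clear -z2z z2s zt tz2 z10; lra.
have z1z : z1 * z1 <= 1 / 1000 * z1 by apply: ler_wpM2r; [apply: ltW | clear -z1s z10; lra].
have t1z : 100 * (1000 * t1) <= z1 by clear -tz1 z1z; lra.
have t1s : 1000 * (1000 * t1) <= 1 by clear -t1z z1s t10; lra.
have tt : t1 * t1 <= 1 / 1000 * (1 / 1000 * t1).
  by rewrite mulrA; apply: ler_wpM2r; [apply: ltW | clear -t1s; lra].
have [||||||M3 [n0 H]] := @balanced_pair_hamilton R M2 (2 * z1) (t1 / 2) (2 * z2) (t2 / 2) k M400 kM.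
- by clear -tM; lra.
- by clear -z10; lra.
- by clear -t10; lra.
- by clear -zt t1z t10 z10; lra.
- by clear -z20; lra.
- by clear -z2s z1s z10 z20; lra.
have [N hN] : exists N, (100 <= N)%N by exists 100%N.
exists M3, (n0 + N)%N => V e S T s q nbig oe ore_e qn s0 st qs qk sM eST ne.
have n100 : (100 <= #|V|)%N.
  by apply: leq_trans hN _; apply: leq_trans nbig; apply: leq_addl.
have V0 : (0 < #|V|)%N by apply: leq_trans n100.
have s1 : 1000 * (1000 * (100 * s)) <= t1 by clear -tt st s0 t10; lra.
have [c1 c2] : 10 * k + 60 * s <= t1 * t1 /\ 40 * s <= t1.
  by split; [clear -kt st | clear -s1 s0]; lra.
have tt2 : t1 * t1 <= t2 * t2 by apply: ler_pM; rewrite ?ltW //; clear -t1z zt z10 t10; lra.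
(* Robustness is proved for the original sides at both scales; moving the exceptional vertices then
   costs a factor two in [z] and in [t]. *)
have r1 : robust e S T z1 t1 k.
  by apply: (robust_of_near_extremal V0 oe ore_e qn eST ne s0 qk) => //; clear -z1s z10; lra.
have r2 : robust e S T z2 t2 k.
  apply: (robust_of_near_extremal V0 oe ore_e qn eST ne s0 qk) => //.
  - by clear -c1 tt2; lra.
  - by clear -c2 t1z zt z10 t10; lra.
  - by clear -z2s z20; lra.
have s100 : 100 * (1000 * s) <= 1 by clear -s1 t1s t10 s0; lra.
pose e' : rel V := fun x y => e y x; pose S' := side e S T; pose T' := side e' T S.
have oe' : oriented_graph e' := oriented_rev oe.
have ore_e' : ore e' := ore_rev ore_e.
have eTS : adens R e' T S <= q by rewrite /e' (adens_rev R e T S).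
have qw : 10 * q <= 1000 * s by clear -qs s0; lra.
have h1 : dens R (S' :\: S) <= 1000 * s := dens_side_added V0 oe ore_e qn eST ne s0 s100 qs.
have h2 : dens R (S :\: S') <= 1000 * s := le_trans (dens_side_removed n100 oe ore_e eST) qw.
have h3 : dens R (T' :\: T) <= 1000 * s :=
  dens_side_added V0 oe' ore_e' qn eTS (near_extremal_rev ne) s0 s100 qs.
have h4 : dens R (T :\: T') <= 1000 * s := le_trans (dens_side_removed n100 oe' ore_e' eTS) qw.
have w1 : 1000%N%:R * (1000 * s) <= 1 :> R by clear -s1 t1s t10 s0; lra.
have out x : (#|V| <= 50 * #|[set y | noncross e S' T' x y]|)%N.
  by apply: side_outdeg; [exact: ore_outdeg | exact: dens_nat h4 w1 | exact: dens_nat h3 w1].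
have in_ y : (#|V| <= 50 * #|[set x | noncross e S' T' x y]|)%N.
  by apply: side_indeg; [exact: ore_indeg | exact: dens_nat h2 w1 | exact: dens_nat h1 w1].
clearbody S' T'.
have r1' : robust e S' T' (2 * z1) (t1 / 2) k.
  apply: (robust_weaken _ _ (robust_shift h2 h1 h4 h3 r1)); clear -s1 s0 t1z t10; lra.
have r2' : robust e S' T' (2 * z2) (t2 / 2) k.
  apply: (robust_weaken _ _ (robust_shift h2 h1 h4 h3 r2)); last by clear -s1 s0 t1z t10 zt z10; lra.
  by clear -s1 s0 t1z t10 zt z10 tz2 z2z z20; lra.
have [[/andP[bl bu] /andP[dl du] _ _] _] := ne.
have tot := class_sum R S T V0.
have cB : dens R (~: (S :|: T)) <= dens R (~: (S' :|: T')) + dens R (S' :\: S) + dens R (T' :\: T).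
  apply: dens_cover; apply/subsetP=> v; rewrite !inE.
  by case: (v \in S); case: (v \in T); case: (v \in S'); case: (v \in T').
have cD : dens R (S :&: T) <= dens R (S' :&: T') + dens R (S :\: S') + dens R (T :\: T').
  apply: dens_cover; apply/subsetP=> v; rewrite !inE.
  by case: (v \in S); case: (v \in T); case: (v \in S'); case: (v \in T').
have cC : dens R (T :\: S) <= dens R (T' :\: S') + dens R (S' :\: S) + dens R (T :\: T').
  apply: dens_cover; apply/subsetP=> v; rewrite !inE.
  by case: (v \in S); case: (v \in T); case: (v \in S'); case: (v \in T').
have cA : dens R (S :\: T) <= dens R (S' :\: T') + dens R (S :\: S') + dens R (T' :\: T).
  apply: dens_cover; apply/subsetP=> v; rewrite !inE.
  by case: (v \in S); case: (v \in T); case: (v \in S'); case: (v \in T').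
have SE := dens_split R S T; have TE := dens_split R T S; rewrite (setIC T) in TE.
have S1 := dens_split R S S'; have S2 := dens_split R S' S; rewrite (setIC S') in S2.
have T1 := dens_split R T T'; have T2 := dens_split R T' T; rewrite (setIC T') in T2.
have p1 := dens_ge0 R (S' :\: S); have p2 := dens_ge0 R (S :\: S').
have p3 := dens_ge0 R (T' :\: T); have p4 := dens_ge0 R (T :\: T').
apply: (H V e S' T' (2100 * s) _ oe ore_e out in_ r1' r2').
- by apply: leq_trans nbig; apply: leq_addr.
- by move: cB h1 h3 bl s1 t1s t10 s0; clear; lra.
- by move: cD h2 h4 dl s1 t1s t10 s0; clear; lra.
(* [A] and [C] together have density about [1 / 2], so one of them exceeds [1 / 5] even after the
   change of sides. *)
- have [c5|c5] := leP (1 / 5) (dens R (T' :\: S')); [by left|right].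
  by move: c5 cA cC tot bu du h1 h2 h3 h4 s1 t1s t10 s0; clear; lra.
- apply/andP; split; move: SE TE S1 S2 T1 T2 p1 p2 p3 p4 tot bl bu dl du h1 h2 h3 h4 s0; clear; lra.
- by clear -s1 s0; lra.
- by clear -s1 s0 t1s t10; lra.
- apply: le_trans sM; apply: ler_wpM2r; first exact: ler0n.
  by clear -s0; lra.
Qed.

(** * The theorem *)

(** The complement of [Y] has density at most [1 / 10 + 1 / 400 <= 1 / 9], so each vertex has at
    least [(1 / 8 - 1 / 9) * #|V| = #|V| / 72] out-neighbours in [Y]. *)
Lemma small_set_sends (R : realFieldType) (V : finType) (e : rel V) (X Y : {set V}) (r : R) :
  (0 < #|V|)%N -> (forall x, #|V| <= 8 * outdeg e x)%N -> 400 * r <= 1 ->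
  1 - r <= dens R X + dens R Y -> dens R X <= 1 / 10 -> dens R X <= 72 * adens R e X Y.
Proof.
move=> n0 d8 rs XY X10; apply: (@adens_rows_geq R V e X Y 72 n0) => x _.
have : (9 * #|~: Y| <= #|V|)%N.
  apply: (@dens_nat R V _ 9 (1 / 9) n0); last by lra.
  by rewrite dens_setC //; lra.
have := d8 x; rewrite (outdeg_split e Y).
have : (#|[set y in ~: Y | e x y]| <= #|~: Y|)%N.
  by apply/subset_leq_card/subsetP=> y; rewrite inE => /andP[].
clear; move: #|[set y in ~: Y | e x y]| #|[set y in Y | e x y]| #|~: Y| #|V|; lia.
Qed.

(** Sets of density below [1 / 10] are handled by the minimum semidegrees, which give arc density at
    least [1 / (32 * 72)], more than [1 / 3000]. *)
Lemma expanding_pair (R : realFieldType) (V : finType) (e : rel V) (X Y : {set V}) (q r s : R) :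
  (0 < #|V|)%N -> (forall x, #|V| <= 8 * outdeg e x)%N -> (forall y, #|V| <= 8 * indeg e y)%N ->
  (forall S T : {set V}, 1 / 10 <= dens R S -> 1 / 10 <= dens R T -> 1 - s <= dens R S + dens R T ->
    q < adens R e S T) ->
  3000 * q < 1 -> r <= s -> 400 * r <= 1 -> 1 - r <= dens R X + dens R Y ->
  1 / 32 <= dens R X -> 1 / 32 <= dens R Y -> q < adens R e X Y.
Proof.
move=> n0 out in_ H q3 rs r400 XY X32 Y32.
have [X10|X10] := leP (1 / 10) (dens R X).
  have [Y10|Y10] := leP (1 / 10) (dens R Y); first by apply: H => //; lra.
  have YX : 1 - r <= dens R Y + dens R X by rewrite [leRHS]addrC.
  have := @small_set_sends R V (fun x y => e y x) Y X r n0 in_ r400 YX (ltW Y10).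
  by rewrite (adens_rev R e Y X); move: Y32 q3; clear; lra.
by have := small_set_sends n0 out r400 XY (ltW X10); move: X32 q3; clear; lra.
Qed.

Lemma expanding_hamilton (R : realFieldType) (M2 : nat) (s q : R) :
  (400 <= M2)%N -> 1 <= q * M2%:R -> 1 <= s * M2%:R -> 3000 * q < 1 -> 400 * s <= 1 -> 0 <= s ->
  exists n0, forall (V : finType) (e : rel V),
    (n0 <= #|V|)%N -> oriented_graph e -> ore e ->
    (forall S T : {set V}, 1 / 10 <= dens R S -> 1 / 10 <= dens R T ->
      1 - s <= dens R S + dens R T -> q < adens R e S T) ->
    has_hamilton_cycle e.
Proof.
move=> M400 qM sM q3 s4 s0.
have [M3 [n0 H]] := @robust_hamilton 8 32 M2 isT isT (leq_trans (isT : 32 <= 400)%N M400).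
exists (n0 + 100)%N => V e nbig oe ore_e dense.
have n100 : (100 <= #|V|)%N by apply: leq_trans nbig; apply: leq_addl.
have V0 : (0 < #|V|)%N by apply: leq_trans n100.
have out x := ore_outdeg x oe ore_e n100; have in_ y := ore_indeg y oe ore_e n100.
have gE (x y : V) : noncross e set0 setT x y = e x y by rewrite /noncross !inE andbT.
have gA (X Y : {set V}) : arcs (noncross e set0 setT) X Y = arcs e X Y by apply: arcs_eq => x y _ _.
have d32 (X : {set V}) : (#|V| <= 32 * #|X|)%N -> 1 / 32 <= dens R X.
  by move=> h; apply: (dens_geq V0 h); lra.
(* With [S] empty and [T] everything, all arcs are noncrossing, one block is empty and the excess to
   be provided is zero. *)
apply: (H V e set0 setT [::] _ oe.1).
- by apply: leq_trans nbig; apply: leq_addr.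
- move=> x; apply: leq_trans (out x) _; rewrite leq_mul2l /= subset_leq_card //.
  by apply/subsetP=> y; rewrite !inE gE.
- move=> y; apply: leq_trans (in_ y) _; rewrite leq_mul2l /= subset_leq_card //.
  by apply/subsetP=> x; rewrite !inE gE.
- move=> X /d32 hX /d32 hX'; rewrite gA; apply: (arcs_geq V0 _ qM).
  apply: (expanding_pair V0 out in_ dense q3 s0 _ _ hX hX'); first by rewrite mulr0.
  by rewrite dens_setC //; lra.
- move=> X Y; rewrite subset0 => /eqP-> _; rewrite cards0 muln0 leqn0 => /eqP n0'.
  by rewrite n0' in V0.
- move=> X Y _ _ /d32 hX /d32 hY sum; rewrite gA; apply: (arcs_geq V0 _ qM).
  apply: (expanding_pair V0 out in_ dense q3 (lexx s) s4 _ hX hY).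
  by rewrite -(dens_setT R V0); apply: dens_sum_geq sum sM.
- by [].
- by [].
- by rewrite /= /excess big_nil cards0 cardsT add0r subrr.
- by rewrite muln0.
Qed.

Lemma small_positive (R : realFieldType) (m c d : R) : 0 < m -> 0 < c -> 0 < d ->
  exists t : R, [/\ 0 < t, m * t <= c & t <= d].
Proof.
move=> m0 c0 d0; exists (Num.min (c / m) d); split.
- by rewrite lt_min d0 divr_gt0.
- by rewrite mulrC -ler_pdivlMr // ge_min lexx.
- by rewrite ge_min lexx orbT.
Qed.

Lemma nat_multiple_geq (R : archiRealFieldType) (x y : R) : 0 < x -> 0 <= y ->
  exists m : nat, y <= x * m%:R.
Proof.
move=> x0 y0; exists (Num.Def.archi_bound (y / x)).
by rewrite mulrC -ler_pdivrMr // ltW // archi_boundP // divr_ge0 // ltW.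
Qed.

Lemma ore_hamilton (R : archiRealFieldType) : exists n0, forall (V : finType) (e : rel V),
  (n0 <= #|V|)%N -> oriented_graph e -> ore e -> has_hamilton_cycle e.
Proof.
have p1 : 0 < 1 :> R by []; have p2 : 0 < 2 :> R by []; have p8 : 0 < 8 :> R by []; have p10 : 0 < 10 :> R by []; have p5 : 0 < 5 :> R by [].
have p100 : 0 < 100 :> R by []; have p20 : 0 < 20 :> R by []; have p2000 : 0 < 2000 :> R by [].
have p120 : 0 < 120 :> R by [].
(* The scales are fixed from coarse to fine. The precision [s'] and the sparseness [q] come last,
   because they must also be small in terms of the constant [M3] of the near-extremal case. *)
have [z2 [z20 z2s _]] := small_positive p2000 p1 p1.
have [t2 [t20 t2s _]] := small_positive p100 (mulr_gt0 z20 z20) p1.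
have [z1 [z10 z1s _]] := small_positive p5 t20 p1.
have [t1 [t10 t1s _]] := small_positive p100 (mulr_gt0 z10 z10) p1.
have [k [k0 ks _]] := small_positive p20 (mulr_gt0 t10 t10) p1.
have grow (x y : R) m m' : 0 < x -> y <= x * m%:R -> (m <= m')%N -> y <= x * m'%:R.
  by move=> x0 h mm; apply: le_trans h _; rewrite ler_pM2l // ler_nat.
have [m1 hm1] := nat_multiple_geq k0 (ltW p1); have [m2 hm2] := nat_multiple_geq t10 (ltW p2).
pose M2 := maxn 400 (maxn m1 m2).
have m1M : (m1 <= M2)%N by rewrite !leq_max leqnn !orbT.
have m2M : (m2 <= M2)%N by rewrite !leq_max leqnn !orbT.
have [M3 [n1 tight]] := tight_hamilton (leq_maxl _ _ : 400 <= M2)%N (grow _ _ _ _ k0 hm1 m1M)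
  (grow _ _ _ _ t10 hm2 m2M) t10 z10 z20 k0 t1s z1s t2s z2s ks.
have c0 : 0 < 100 * (100 * (M3%:R + 1)) :> R by rewrite !mulr_gt0 // ltr_wpDl ?ler0n.
have [s [s0 sM sk]] := small_positive c0 p1 k0.
have [s' [s'0 s't s's]] := small_positive p120 (mulr_gt0 t10 t10) s0.
have [q [q0 qs _]] := small_positive p8 (mulr_gt0 s'0 s'0) p1.
have sM0 : 0 <= s * M3%:R by rewrite mulr_ge0 ?ler0n // ltW.
have s'M : s' * M3%:R <= s * M3%:R by rewrite ler_wpM2r // ler0n.
have s1 : 100 * (100 * s') <= 1 by move: sM sM0 s's; clear; lra.
have q10 : 1000 * q <= s'.
  have : s' * s' <= 1 / 1000 * s' by apply: ler_wpM2r; [exact: ltW | move: s1 s'0; clear; lra].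
  by move: qs s1 s'0; clear; lra.
have [m3 hm3] := nat_multiple_geq q0 (ltW p1).
have [m4 hm4] := nat_multiple_geq s'0 (ltW p1).
have [m5 hm5] := nat_multiple_geq q0 (ltW p2).
pose M4 := maxn 400 (maxn m3 m4).
have m3M : (m3 <= M4)%N by rewrite !leq_max leqnn !orbT.
have m4M : (m4 <= M4)%N by rewrite !leq_max leqnn !orbT.
have q3 : 3000 * q < 1 by move: q10 s1 s'0; clear; lra.
have s4 : 400 * s' <= 1 by move: s1 s'0; clear; lra.
have [n2 loose] := expanding_hamilton (leq_maxl _ _ : 400 <= M4)%N (grow _ _ _ _ q0 hm3 m3M)
  (grow _ _ _ _ s'0 hm4 m4M) q3 s4 (ltW s'0).
exists (n1 + n2 + m5 + 1)%N => V e nbig oe ore_e.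
have [b1 b2 b5 V0] : [/\ n1 <= #|V|, n2 <= #|V|, m5 <= #|V| & 0 < #|V|]%N.
  by move: nbig; clear; move: #|V| => n; split; lia.
have qn : 2 <= q * #|V|%:R by apply: grow q0 hm5 b5.
case: (boolP [exists S : {set V}, [exists T : {set V}, [&& 1 / 10 <= dens R S, 1 / 10 <= dens R T,
    1 - s' <= dens R S + dens R T & adens R e S T <= q]]]) => [/existsP[S /existsP[T]]|none].
  case/and4P=> S10 T10 ST eST.
  have ne : near_extremal e S T s'.
    by apply: (tight_structure V0 oe ore_e qn s'0 _ qs eST S10 T10 ST); move: s1 s'0; clear; lra.
  apply: (tight V e S T s' q b1 oe ore_e qn s'0 s't _ _ _ eST ne).
  - by move: q10 q0; clear; lra.
  - by apply: le_trans sk; apply: le_trans s's; move: q10 q0; clear; lra.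
  - by move: sM sM0 s'M s0; clear; lra.
apply: (loose V e b2 oe ore_e) => S T S10 T10 ST; rewrite ltNge; apply/negP=> eST.
by case/existsP: none; exists S; apply/existsP; exists T; rewrite S10 T10 ST.
Qed.

Lemma ore_of_rat (V : finType) (e : rel V) :
  (forall x y : V, x != y -> ~~ e x y ->
     (3 * #|V|%:R - 3) / 4 <= (outdeg e x)%:R + (indeg e y)%:R :> rat) -> ore e.
Proof.
move=> h x y xy nxy; have := h x y xy nxy.
rewrite ler_pdivrMr // lerBlDr -!natrD -!natrM -natrD ler_nat mulnC [in leqRHS]mulnC.
by rewrite [in X in (X <= _)%N]mulnC.
Qed.

Theorem theorem1p4 :
  exists2 n0 : nat, (0 < n0)%N &
    forall n : nat, (n0 <= n)%N ->
    forall (V : finType) (e : rel V),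
      #|V| = n ->
      oriented_graph e ->
      (forall x y : V, x != y -> ~~ e x y ->
         ((3 * n%:R - 3) / 4 <= (outdeg e x)%:R + (indeg e y)%:R :> rat)%R) ->
      has_hamilton_cycle e.
Proof.
have [n0 H] := ore_hamilton rat.
exists n0.+1 => // n nbig V e Vn oe ore_e; rewrite -Vn in nbig ore_e.
exact: H (ltnW nbig) oe (ore_of_rat ore_e).
Qed.
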